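(* Let $\mathbb K$ be an algebraically closed field of characteristic zero and let $f=y^n+a_2(x)y^{n-2}+\dots+a_n(x)\in\mathbb K[x][y]$, $n\ge2$, $\deg_xa_i(x)<i$ for all $i$, be a polynomial with one place at infinity. Let $m=\deg_xa_n(x)$, and let $r_0,\dots,r_h$ and $d_1,\dots,d_{h+1}$ be the characteristic sequences of $f$. The following conditions are equivalent: (i) $\mu(f)=0$; (ii) $r_i=d_{i+1}$ for all $1\le i\le h$; (iii) the conductor of $\Gamma(f)$ is $0$; (iv) there exist $x(t),y(t)\in\mathbb K[t]$ such that $f(x(t),y(t))=0$ and $\mathbb K[x(t),y(t)]=\mathbb K[t]$. Furthermore, each of these conditions implies that $m$ divides $n$.
   Context: One place at infinity: writing $f=y^n+\sum_{i+j<n}c_{ij}x^iy^j$, $f$ has one place at infinity if $y^n+\sum c_{ij}u^{n-i-j}y^j$ is irreducible in $\mathbb K[[u,y]]$. $\mathrm{int}(f,p)=\dim_{\mathbb K}\mathbb K[x,y]/(f,p)$; $\Gamma(f)=\{\mathrm{int}(f,p)\mid p\in\mathbb K[x,y]\setminus(f)\}$ (a numerical semigroup); its conductor is the least integer $c\ge0$ such that all integers $\ge c$ lie in $\Gamma(f)$. $\mu(f)=\dim_{\mathbb K}\mathbb K[x,y]/(f_x,f_y)$, where $f_x,f_y$ are the partial derivatives. For $d\mid n$, the $d$th approximate root $\mathrm{App}_d(f)$ is the unique $G\in\mathbb K[x][y]$ monic in $y$ of $y$-degree $n/d$ such that in the expansion $f=G^d+\alpha_1G^{d-1}+\dots+\alpha_d$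 with $\deg_y\alpha_i<n/d$ one has $\alpha_1=0$. Characteristic sequences: $r_0=d_1=n$, $g_1=y$, $r_1=m=\deg_xa_n(x)=\mathrm{int}(f,y)$, and for $k\ge2$: $d_k=\gcd(d_{k-1},r_{k-1})$, $g_k=\mathrm{App}_{d_k}(f)$, $r_k=\mathrm{int}(f,g_k)$; $h$ is the first index with $d_{h+1}=1$ (it exists), and $g_{h+1}=f$. *)

(* Defs.v *)
From mathcomp Require Import all_boot all_algebra.
From mathcomp Require Import boolp classical_sets.

Set Implicit Arguments.
Unset Strict Implicit.
Unset Printing Implicit Defensive.

Import GRing.Theory.
Local Open Scope ring_scope.

(** K[x, y] is [{poly {poly K}}]: the coefficients are polynomials in x and the
    outer indeterminate ['X] is y.  A degree bound [deg p < k] is written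
    [size p <= k], which also covers [p = 0] (degree -oo). *)

Section PowerSeries.
Variable K : nzRingType.

(** K[[u, y]]; [F i j] is the coefficient of u^i y^j. *)
Definition series2 : Type := nat -> nat -> K.

Definition series2_one : series2 :=
  fun i j => ((i == 0%N) && (j == 0%N))%:R.

Definition series2_mul (F G : series2) : series2 := fun i j =>
  \sum_(k < i.+1) \sum_(l < j.+1) F k l * G (i - k)%N (j - l)%N.

Definition series2_unit (F : series2) : Prop :=
  exists G : series2, series2_mul F G = series2_one.

(** The zero series is excluded: 0 = 0 * 0 with 0 not a unit. *)
Definition series2_irreducible (F : series2) : Prop :=
  ~ series2_unit F /\
  forall G H : series2, F = series2_mul G H -> series2_unit G \/ series2_unit H.

End PowerSeries.

Section PlaneCurve.
Variable K : fieldType.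
Implicit Types (f p a b G : {poly {poly K}}) (x y q : {poly K}).

Definition degy f : nat := (size f).-1.

Definition dfdx f : {poly {poly K}} := map_poly (@deriv K) f.
Definition dfdy f : {poly {poly K}} := f^`().

(** For f = y^n + sum_(i + j < n) c_ij x^i y^j, the polynomial
    y^n + sum_(i + j < n) c_ij u^(n-i-j) y^j, with inner indeterminate u. *)
Definition at_infinity f : {poly {poly K}} :=
  let n := degy f in
  'X^n + \sum_(j < n) \sum_(i < n | (i + j < n)%N)
           ((f`_j)`_i *: 'X^(n - i - j)) *: 'X^j.

Definition series2_of_poly p : series2 K := fun i j => (p`_j)`_i.

Definition one_place_at_infinity f : Prop :=
  series2_irreducible (series2_of_poly (at_infinity f)).

Definition in_ideal2 a b p : Prop :=
  exists u v : {poly {poly K}}, p = u * a + v * b.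

(** K[x, y]/(a, b) has a K-basis with N elements (the classes of the [e i]). *)
Definition quotient_has_dim a b (N : nat) : Prop :=
  exists e : 'I_N -> {poly {poly K}}, forall p,
    exists! c : {ffun 'I_N -> K},
      in_ideal2 a b (p - \sum_(i < N) (c i)%:P *: e i).

(** [None] stands for infinite dimension. *)
Definition quotient_dim a b : option nat :=
  xget None [set Some N | N in [set N | quotient_has_dim a b N]]%classic.

Definition intersection f p : option nat := quotient_dim f p.

Definition milnor f : option nat := quotient_dim (dfdx f) (dfdy f).

Definition Gamma f : set nat :=
  [set s | exists p, ~ (exists u, p = u * f) /\ intersection f p = Some s]%classic.

Definition is_conductor (S : set nat) (c : nat) : Prop :=
  (forall s, (c <= s)%N -> S s) /\
  (forall c', (forall s, (c' <= s)%N -> S s) -> (c <= c')%N).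

Definition is_approx_root (d : nat) f G : Prop :=
  let e := (degy f %/ d)%N in
  [/\ G \is monic, size G = e.+1 &
      exists alpha : nat -> {poly {poly K}},
        [/\ forall i, (size (alpha i) <= e)%N,
            f = G ^+ d + \sum_(1 <= i < d.+1) alpha i * G ^+ (d - i)
          & alpha 1%N = 0]].

(** Meaningful for d dividing the y-degree of a monic f (and d invertible in K),
    in which case the approximate root exists and is unique. *)
Definition App (d : nat) f : {poly {poly K}} :=
  xget 0 [set G | is_approx_root d f G]%classic.

(** [g_k] and [r_k] as functions of [k] and of the value [d] of [d_k]; they
    depend on the earlier terms only through [d_k].  [g_0] is unused, and
    [App 1 f = f] gives [g_(h+1) = f].  For f irreducible, the default value 0 is only
    reached when f divides [g_k], hence not for k <= h. *)
Definition char_g_from f (k d : nat) : {poly {poly K}} :=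
  if (k <= 1)%N then 'X else App d f.

Definition char_r_from f (k d : nat) : nat :=
  match k with
  | 0 => degy f
  | 1 => (size f`_0).-1
  | _ => odflt 0%N (intersection f (char_g_from f k d))
  end.

(** [d_0] is unused. *)
Fixpoint char_d f (k : nat) : nat :=
  match k with
  | 0 | 1 => degy f
  | (k'.+1 as j).+1 => gcdn (char_d f j) (char_r_from f j (char_d f j))
  end.

Definition char_g f (k : nat) : {poly {poly K}} := char_g_from f k (char_d f k).

Definition char_r f (k : nat) : nat := char_r_from f k (char_d f k).

Definition char_h f : nat :=
  xget 0%N [set h | char_d f h.+1 = 1%N /\
                    forall k, (k < h)%N -> char_d f k.+1 <> 1%N]%classic.

(** p(x(t), y(t)) *)
Definition eval2 p x y : {poly K} := (map_poly (comp_poly x) p).[y].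

(** K[x(t), y(t)] = K[t] *)
Definition generate_Kt x y : Prop := forall q, exists p, q = eval2 p x y.

End PlaneCurve.

(* Main.v *)
Require Import Defs.
From HB Require Import structures.
From mathcomp Require Import all_boot all_order all_algebra cyclic separable cyclotomic.
From mathcomp Require Import boolp classical_sets.
From mathcomp Require Import ring zify.

Set Implicit Arguments.
Unset Strict Implicit.
Unset Printing Implicit Defensive.

Import Order.TTheory GRing.Theory Num.Theory.
Local Open Scope ring_scope.

(** One place at infinity means that the branches of f at infinity are the n conjugates
    of a single Puiseux parametrization x = t^-n, y = t^-n s(t).  Then v p = - ord_t p(x, y)
    is nonnegative on K[x, y] / (f), because the norm of p is a nonzero polynomial in x, and
    int(f, p) = v p: representatives of least value of the residue classes modulo v p
    form a basis of K[x, y] / (f, p).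

    If d_k divides all exponents of s below b but not b, both f and its d_k-th approximate
    root have an explicit leading form along the truncation of s at b.  It shows that
    d_k does not divide r_k, whereas polynomials of y-degree less than n / d_k have values
    divisible by d_k.

    The derivation jac(f, -) changes v by v(f_y) - n.  If v(f_y) = n - 1 it lowers values by
    exactly one, so that every natural number is a value.  Conversely, some z of value 1
    generates K[x, y] / (f), x = X(z) and y = Y(z), and differentiating these two
    relations gives v(f_y) = n - 1.  Finally v(f_y) = n - 1 is equivalent to mu(f) = 0: the norm
    of f_x modulo f_y has degree v(f_y) + 1 - n in x, since the values of f at the roots of
    f_y all have poles at infinity. *)

(** The minimal polynomial of a truncated branch is easy to describe, but the approximate root is a
    different polynomial. It is reached from the former by Tschirnhausen corrections, and these keep
    the leading form: along the branch truncated at [b], [f] has the form of the product of the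
    [X - omega^l * s_b], whose roots have sum zero, so each correction has a vanishing form at the
    order that matters. If [r_i = d_(i+1)] for all [i], then [r_h = 1] is a value and so is every
    integer. Conversely, in an expansion in powers of [g_k] the terms have values distinct modulo
    [d_k]; an element of value [d_(i+1)] can therefore be chosen of small degree, and its expansion
    must involve [g_i], whence [r_i <= d_(i+1)]. That [f] has a pole at each zero of [f_y] also
    comes from approximate roots: the contact orders involved add up to [d] times the order of one
    of them, which is at most 0 and not a multiple of [d]. Everything analytic is condensed into the
    interface [curve_valuation]; what follows it is an argument on values only. *)

Section PowerSeriesRing.
Variable K : fieldType.

(** A record keeps series apart from bare functions, so that their product can be convolution. *)
Record pseries := PSeries { coefs :> nat -> K }.
Implicit Types a b c : pseries.

Lemma psP a b : (forall i, a i = b i) -> a = b.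
Proof. by case: a b => [a] [b] /= ab; congr PSeries; apply: funext. Qed.

HB.instance Definition _ := gen_eqMixin pseries.
HB.instance Definition _ := gen_choiceMixin pseries.

Definition ps_zero := PSeries (fun=> 0).
Definition ps_opp a := PSeries (fun i => - a i).
Definition ps_add a b := PSeries (fun i => a i + b i).

Lemma ps_addA : associative ps_add.
Proof. by move=> a b c; apply: psP => i /=; rewrite addrA. Qed.
Lemma ps_addC : commutative ps_add.
Proof. by move=> a b; apply: psP => i /=; rewrite addrC. Qed.
Lemma ps_add0 : left_id ps_zero ps_add.
Proof. by move=> a; apply: psP => i /=; rewrite add0r. Qed.
Lemma ps_addN : left_inverse ps_zero ps_opp ps_add.
Proof. by move=> a; apply: psP => i /=; rewrite addNr. Qed.

HB.instance Definition _ :=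
  GRing.isZmodule.Build pseries ps_addA ps_addC ps_add0 ps_addN.

Definition ps_trunc N a : {poly K} := \poly_(i < N) a i.

Definition ps_one := PSeries (fun i => (i == 0%N)%:R).
Definition ps_mul a b := PSeries (fun k => \sum_(i < k.+1) a i * b (k - i)%N).

(** A coefficient of a product only sees truncations, so associativity and commutativity are
    inherited from [{poly K}]. *)
Lemma ps_mul_trunc N a b k : (k < N)%N ->
  ps_mul a b k = (ps_trunc N a * ps_trunc N b)`_k.
Proof.
move=> kN; rewrite coefM /=; apply: eq_bigr => i _; rewrite !coef_poly.
by rewrite !ifT //; have := ltn_ord i; lia.
Qed.

Lemma ps_mulA : associative ps_mul.
Proof.
move=> a b c; apply: psP => k.
have tr d e i : (i <= k)%N ->
    (ps_trunc k.+1 (ps_mul d e))`_i = (ps_trunc k.+1 d * ps_trunc k.+1 e)`_i.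
  by move=> ik; rewrite coef_poly ltnS ik (@ps_mul_trunc k.+1).
rewrite !(@ps_mul_trunc k.+1) //; transitivity
  ((ps_trunc k.+1 a * ps_trunc k.+1 b * ps_trunc k.+1 c)`_k).
  rewrite -mulrA [RHS]coefM [LHS]coefM.
  by apply: eq_bigr => i _; rewrite tr // leq_subr.
rewrite [RHS]coefM [LHS]coefM; apply: eq_bigr => i _.
by rewrite tr // -ltnS.
Qed.

Lemma ps_mulC : commutative ps_mul.
Proof. by move=> a b; apply: psP => k; rewrite !(@ps_mul_trunc k.+1) // mulrC. Qed.

Lemma ps_mul1 : left_id ps_one ps_mul.
Proof.
move=> a; apply: psP => k /=; rewrite big_ord_recl subn0 mul1r big1 ?addr0 //.
by move=> i _; rewrite mul0r.
Qed.

Lemma ps_mulDl : left_distributive ps_mul ps_add.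
Proof.
move=> a b c; apply: psP => k /=; rewrite -big_split; apply: eq_bigr => i _.
by rewrite mulrDl.
Qed.

Lemma ps_one_neq0 : ps_one != ps_zero.
Proof.
by apply/eqP => /(congr1 (fun a : pseries => a 0%N)) /= /eqP; rewrite oner_eq0.
Qed.

HB.instance Definition _ :=
  GRing.Zmodule_isComNzRing.Build pseries ps_mulA ps_mulC ps_mul1 ps_mulDl ps_one_neq0.

Lemma ps_coefD a b i : (a + b) i = a i + b i. Proof. by []. Qed.
Lemma ps_coefN a i : (- a) i = - a i. Proof. by []. Qed.
Lemma ps_coefB a b i : (a - b) i = a i - b i. Proof. by []. Qed.
Lemma ps_coef0 i : (0 : pseries) i = 0. Proof. by []. Qed.
Lemma ps_coef1 i : (1 : pseries) i = (i == 0%N)%:R. Proof. by []. Qed.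
Lemma ps_coefM a b k : (a * b) k = \sum_(i < k.+1) a i * b (k - i)%N.
Proof. by []. Qed.

Lemma ps_coef_sum I (r : seq I) (P : pred I) (F : I -> pseries) i :
  (\sum_(j <- r | P j) F j) i = \sum_(j <- r | P j) F j i.
Proof. by elim/big_rec2: _ => // j x y _ <-. Qed.

Lemma ps_coefM0 a b : (a * b) 0%N = a 0%N * b 0%N.
Proof. by rewrite ps_coefM big_ord1. Qed.

(** The geometric series of [1 / (1 - u)], scaled by the inverse constant term. As [u] has no
    constant term, coefficient [k] only involves powers up to [k], so finite sums suffice. *)
Definition ps_inv a :=
  let u := 1 - PSeries (fun i => (a 0%N)^-1 * a i) in
  PSeries (fun k => (a 0%N)^-1 * (\sum_(i < k.+1) u ^+ i) k).

Definition ps_vanish N a := forall i, (i < N)%N -> a i = 0.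

Lemma ps_vanishM N M a b :
  ps_vanish N a -> ps_vanish M b -> ps_vanish (N + M) (a * b).
Proof.
move=> va vb k kNM; rewrite ps_coefM big1 // => i _.
have [iN|Ni] := ltnP i N; first by rewrite va ?mul0r.
rewrite vb ?mulr0 //; have := ltn_ord i; lia.
Qed.

Lemma ps_coefM_eq N a b c k : (k < N)%N ->
  (forall i, (i < N)%N -> b i = c i) -> (a * b) k = (a * c) k.
Proof.
move=> kN bc; rewrite !ps_coefM; apply: eq_bigr => i _; rewrite bc //; lia.
Qed.

Lemma ps_mulVr a : a 0%N != 0 -> a * ps_inv a = 1.
Proof.
move=> a0; pose u := 1 - PSeries (fun i => (a 0%N)^-1 * a i).
have u0 : ps_vanish 1 u.
  by case=> // _; rewrite ps_coefB ps_coef1 /= mulVf ?subrr.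
have uX k : ps_vanish k (u ^+ k).
  elim: k => // k IH; rewrite exprS -add1n; exact: ps_vanishM.
pose g N := \sum_(i < N) u ^+ i.
(* The partial sums stabilise coefficientwise, because [u ^+ i] vanishes below order [i]. *)
have gN N M k : (k < N <= M)%N -> g M k = g N k.
  case/andP=> kN; elim: M => [|M IH] NM; first by lia.
  have [eNM|] := eqVneq N M.+1; first by rewrite eNM.
  move=> ne; rewrite /g big_ord_recr ps_coefD -/(g M) IH; last lia.
  by rewrite uX /= ?addr0 //; lia.
have ga : a = PSeries (fun=> 0) + PSeries (fun i => a 0%N * (1 - u) i).
  by rewrite add0r; apply: psP => i /=; rewrite opprB addrC subrK mulVKf.
apply: psP => k; rewrite (@ps_coefM_eq k.+1 _ _ (PSeries (fun i => (a 0%N)^-1 * g k.+1 i))) //; last first.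
  by move=> i ik /=; rewrite -(gN i.+1 k.+1) // ltnS leqnn.
rewrite ps_coefM; transitivity (((1 - u) * g k.+1) k).
  rewrite ps_coefM; apply: eq_bigr => i _.
  rewrite [a i](_ : _ = a 0%N * (1 - u) i); last by rewrite {1}ga /= add0r.
  by rewrite /= mulrACA mulfV // mul1r.
rewrite /g mulrC -[1 - u]opprB mulrN mulrC -subrX1 opprB.
by rewrite ps_coefB uX // subr0.
Qed.

Definition ps_unit : pred pseries := fun a => a 0%N != 0.
Definition ps_invr a := if a 0%N != 0 then ps_inv a else a.

Lemma ps_mulVx : {in ps_unit, left_inverse 1 ps_invr *%R}.
Proof. by move=> a; rewrite unfold_in /ps_invr => a0; rewrite a0 mulrC ps_mulVr. Qed.

Lemma ps_unitPl a b : b * a = 1 -> ps_unit a.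
Proof.
move/(congr1 (fun s : pseries => s 0%N)); rewrite ps_coefM0 ps_coef1 /ps_unit.
by apply: contra_eq_neq => ->; rewrite mulr0 eq_sym oner_eq0.
Qed.

Lemma ps_invr_out : {in [predC ps_unit], ps_invr =1 id}.
Proof.
move=> a; rewrite inE /= unfold_in /ps_unit /ps_invr negbK => /eqP ->.
by rewrite eqxx.
Qed.

HB.instance Definition _ :=
  GRing.ComNzRing_hasMulInverse.Build pseries ps_mulVx ps_unitPl ps_invr_out.

Definition ps_tau := PSeries (fun i => (i == 1%N)%:R).
Definition ps_shift k a := PSeries (fun i => a (i + k)%N).
Definition psC (c : K) := PSeries (fun i => if i is 0 then c else 0).

Lemma coef_tauM a i : (ps_tau * a) i = if i is j.+1 then a j else 0.
Proof.
rewrite ps_coefM; case: i => [|i]; first by rewrite big_ord1 mul0r.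
rewrite big_ord_recl mul0r add0r big_ord_recl mul1r big1 ?addr0.
  by rewrite subSS subn0.
by move=> j _; rewrite mul0r.
Qed.

Lemma coef_tauXM k a i : (ps_tau ^+ k * a) i = if (i < k)%N then 0 else a (i - k)%N.
Proof.
elim: k i => [|k IH] i; first by rewrite mul1r subn0.
by rewrite exprS -mulrA coef_tauM; case: i => [|i] //; rewrite IH ltnS subSS.
Qed.

Lemma ps_shiftK k a : ps_vanish k a -> a = ps_tau ^+ k * ps_shift k a.
Proof.
move=> va; apply: psP => i; rewrite coef_tauXM /=.
by case: ltnP => ki; [rewrite va | rewrite subnK].
Qed.

Lemma coef_tauX k i : (ps_tau ^+ k) i = (i == k)%:R.
Proof.
rewrite -[_ ^+ _]mulr1 coef_tauXM ps_coef1.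
by case: ltngtP => // [ki|->]; [rewrite subn_eq0 leqNgt ki | rewrite subnn].
Qed.

Lemma ps_neq0P a : a != 0 -> exists k s, a = ps_tau ^+ k * s /\ s 0%N != 0.
Proof.
move=> a0; have ex : exists k, a k != 0.
  apply: contrapT => /forallNP all0; move/eqP: a0; apply; apply: psP => i.
  by apply: contrapT => ai; apply: (all0 i); apply/eqP.
case: (ex_minnP ex) => k ak mk; exists k, (ps_shift k a); split; last by rewrite /= add0n.
apply: ps_shiftK => i ik; apply/eqP; apply: contraTT ik => ai.
by rewrite -leqNgt mk.
Qed.

Lemma tauX_lreg k : GRing.lreg (ps_tau ^+ k).
Proof.
move=> a b ab; apply: psP => i.
by have := congr1 (fun s : pseries => s (i + k)%N) ab; rewrite !coef_tauXM ltnNge leq_addl /= addnK.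
Qed.

Lemma ps_integral : GRing.integral_domain_axiom pseries.
Proof.
move=> a b ab0; apply: contraT; rewrite negb_or.
case/andP=> /ps_neq0P[k [s [ea s0]]] /ps_neq0P[l [r [eb r0]]].
move: ab0; rewrite ea eb mulrACA -exprD => e0.
have := congr1 (fun s : pseries => s (k + l)%N) e0.
rewrite coef_tauXM ltnn subnn ps_coefM0 ps_coef0 => /eqP.
by rewrite mulf_eq0 (negbTE s0) (negbTE r0).
Qed.

HB.instance Definition _ :=
  GRing.ComUnitRing_isIntegral.Build pseries ps_integral.

Lemma psC_is_zmod_morphism : zmod_morphism psC.
Proof. by move=> a b; apply: psP => -[|i] //=; rewrite ?subrr // oppr0 addr0. Qed.
Lemma psC_is_monoid_morphism : monoid_morphism psC.
Proof.
split=> [|a b]; first by apply: psP => -[].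
apply: psP => -[|i]; first by rewrite ps_coefM0.
rewrite ps_coefM big_ord_recl /= mulr0 add0r big1 // => j _.
by rewrite mul0r.
Qed.
HB.instance Definition _ :=
  GRing.isZmodMorphism.Build K pseries psC psC_is_zmod_morphism.
HB.instance Definition _ :=
  GRing.isMonoidMorphism.Build K pseries psC psC_is_monoid_morphism.

Definition ev0 (a : pseries) : K := a 0%N.
Lemma ev0_is_zmod_morphism : zmod_morphism ev0. Proof. by []. Qed.
Lemma ev0_is_monoid_morphism : monoid_morphism ev0.
Proof. by split=> // a b; rewrite /ev0 ps_coefM0. Qed.
HB.instance Definition _ :=
  GRing.isZmodMorphism.Build pseries K ev0 ev0_is_zmod_morphism.
HB.instance Definition _ :=
  GRing.isMonoidMorphism.Build pseries K ev0 ev0_is_monoid_morphism.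

Lemma coef_psCM (c : K) a i : (psC c * a) i = c * a i.
Proof.
by rewrite ps_coefM big_ord_recl subn0 big1 ?addr0 // => j _; rewrite mul0r.
Qed.

Lemma tau_neq0 : ps_tau != 0.
Proof.
apply/eqP => /(congr1 (fun s : pseries => s 1%N)) /= /eqP; by rewrite oner_eq0.
Qed.

End PowerSeriesRing.
Arguments ps_tau {K}.

Lemma size_polyB_max (R : nzRingType) (p q : {poly R}) :
  (size (p - q)%R <= maxn (size p) (size q))%N.
Proof. by rewrite -[size q]size_polyN size_polyD. Qed.

(** * The substitutions t -> w t and t -> t^(q+1), and the derivation t d/dt *)

Section Substitutions.
Variable K : fieldType.
Implicit Types a b : pseries K.

Definition dil q a := PSeries (fun i => if (q %| i)%N then a (i %/ q)%N else 0).
Definition rot (w : K) a := PSeries (fun i => w ^+ i * a i).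
(* t d/dt *)
Definition theta a := PSeries (fun i => a i *+ i).

Lemma rot_is_zmod_morphism w : zmod_morphism (rot w).
Proof. by move=> a b; apply: psP => i /=; rewrite mulrBr. Qed.
Lemma rot_is_monoid_morphism w : monoid_morphism (rot w).
Proof.
split=> [|a b].
  by apply: psP => -[|i]; rewrite /= ?mul1r ?mulr0.
apply: psP => i; rewrite ps_coefM /= mulr_sumr; apply: eq_bigr => j _.
by rewrite mulrACA -exprD subnKC // -ltnS.
Qed.
HB.instance Definition _ w :=
  GRing.isZmodMorphism.Build (pseries K) (pseries K) (rot w) (rot_is_zmod_morphism w).
HB.instance Definition _ w :=
  GRing.isMonoidMorphism.Build (pseries K) (pseries K) (rot w) (rot_is_monoid_morphism w).

Lemma rot_comp u w a : rot u (rot w a) = rot (u * w) a.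
Proof. by apply: psP => i /=; rewrite exprMn mulrA. Qed.

Lemma rot1 a : rot 1 a = a.
Proof. by apply: psP => i /=; rewrite expr1n mul1r. Qed.

Lemma theta_is_zmod_morphism : zmod_morphism theta.
Proof. by move=> a b; apply: psP => i /=; rewrite mulrnBl. Qed.
HB.instance Definition _ :=
  GRing.isZmodMorphism.Build (pseries K) (pseries K) theta theta_is_zmod_morphism.

Lemma thetaM a b : theta (a * b) = theta a * b + a * theta b.
Proof.
apply: psP => i; rewrite ps_coefD !ps_coefM /= -sumrMnl -big_split.
apply: eq_bigr => j _ /=; rewrite mulrnAl mulrnAr -mulrnDr subnKC //.
by rewrite -ltnS.
Qed.

(* Unlike [dil 0], the substitutions t -> t^(q+1) are ring morphisms for all q. *)
Definition dilq q := dil q.+1.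
Lemma dil_is_zmod_morphism q : zmod_morphism (dilq q).
Proof.
by move=> a b; apply: psP => i /=; case: ifP => _ //; rewrite subr0.
Qed.
Lemma dil_is_monoid_morphism q : monoid_morphism (dilq q).
Proof.
have tr c i j : (j <= i)%N -> dilq q c j = (ps_trunc i.+1 c \Po 'X^(q.+1))`_j.
  move=> ji; rewrite coef_comp_poly_Xn //=; case: ifP => // _.
  by rewrite coef_poly ltnS (leq_trans (leq_div _ _)).
split=> [|a b].
  apply: psP => -[|i] //=; case: ifP => // /dvdn_leq-/(_ isT) qi.
  by rewrite -leqn0 leqNgt divn_gt0 ?qi.
apply: psP => i; rewrite ps_coefM.
transitivity (((ps_trunc i.+1 a * ps_trunc i.+1 b) \Po 'X^(q.+1))`_i).
  rewrite coef_comp_poly_Xn //=; case: ifP => // _.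
  by rewrite -ps_mul_trunc // ltnS leq_div.
rewrite comp_polyM coefM; apply: eq_bigr => j _.
by rewrite -!tr ?leq_subr // -ltnS.
Qed.
HB.instance Definition _ q :=
  GRing.isZmodMorphism.Build (pseries K) (pseries K) (dilq q) (dil_is_zmod_morphism q).
HB.instance Definition _ q :=
  GRing.isMonoidMorphism.Build (pseries K) (pseries K) (dilq q) (dil_is_monoid_morphism q).

Lemma coef_dil q a i : dilq q a (q.+1 * i)%N = a i.
Proof. by rewrite /= dvdn_mulr // mulKn. Qed.

Lemma dil_inj q : injective (dilq q).
Proof. by move=> a b ab; apply: psP => i; rewrite -(coef_dil q a i) ab coef_dil. Qed.

Lemma dilP q a : (forall i, ~~ (q.+1 %| i)%N -> a i = 0) -> exists b, a = dilq q b.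
Proof.
move=> va; exists (PSeries (fun i => a (q.+1 * i)%N)); apply: psP => i /=.
by case: ifP => [/divnK <-|/negbT/va //]; rewrite mulnK // mulnC.
Qed.

Lemma dil_dil p q m a : m.+1 = (p.+1 * q.+1)%N -> dilq p (dilq q a) = dilq m a.
Proof.
move=> em; apply: psP => i; rewrite /dilq em /=.
case: ifP => pi; last first.
  by rewrite ifF //; apply: contraFF pi; apply: dvdn_trans; apply: dvdn_mulr.
by rewrite divnMA; congr (if _ then _ else _); rewrite -{2}(divnK pi) mulnC dvdn_pmul2r.
Qed.

Lemma rot_dil w q a : rot w (dilq q a) = dilq q (rot (w ^+ q.+1) a).
Proof.
apply: psP => i /=; case: ifP => [qi|_]; last by rewrite mulr0.
by rewrite -exprM mulnC divnK.
Qed.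

Lemma dil_tau q : dilq q ps_tau = ps_tau ^+ q.+1.
Proof.
apply: psP => i; rewrite coef_tauX /=; case: ifP => [/dvdnP[k ->]|qi].
  rewrite mulnK //; congr (_%:R); congr nat_of_bool.
  by rewrite -{2}[q.+1]mul1n eqn_pmul2r.
by case: eqP qi => // ->; rewrite dvdnn.
Qed.

Lemma rot_tau w : rot w ps_tau = psC w * ps_tau.
Proof. by apply: psP => -[|[|i]]; rewrite coef_psCM /= ?mulr0 // expr1. Qed.

Lemma ev0_dil q a : ev0 (dilq q a) = ev0 a.
Proof. by rewrite /ev0 /= ?dvdn0 ?div0n. Qed.

Lemma dil_psC q c : dilq q (psC c) = psC c.
Proof.
apply: psP => -[|i] //=.
case: ifP => // /dvdn_leq-/(_ isT) qi; case: (_ %/ _)%N (divn_gt0 i.+1 (ltn0Sn q)) => //.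
by rewrite qi.
Qed.

Lemma rot_psC w c : rot w (psC c) = psC c.
Proof. by apply: psP => -[|i] /=; rewrite ?mul1r ?mulr0. Qed.

End Substitutions.

(** * Hensel's lemma for monic polynomials over K[[t]] *)

Section Slices.
Variable K : fieldType.
Implicit Types P Q : {poly pseries K}.

(** Views an element of K[[t]][y] as a series in t with coefficients in K[y], the side on which the
    lifting proceeds degree by degree in t. *)
Definition slice k P : {poly K} := \poly_(j < size P) P`_j k.

Lemma coef_slice k P j : (slice k P)`_j = P`_j k.
Proof. by rewrite coef_poly; case: ltnP => // h; rewrite nth_default. Qed.

Lemma sliceP P Q : (forall k, slice k P = slice k Q) -> P = Q.
Proof.
move=> PQ; apply/polyP => j; apply: psP => k.
by have /(congr1 (fun p : {poly K} => p`_j)) := PQ k; rewrite !coef_slice.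
Qed.

Lemma sliceM k P Q : slice k (P * Q) = \sum_(i < k.+1) slice i P * slice (k - i) Q.
Proof.
apply/polyP => j; rewrite coef_slice coefM coef_sum ps_coef_sum.
under [RHS]eq_bigr do rewrite coefM.
rewrite [RHS]exchange_big; apply: eq_bigr => l _; rewrite ps_coefM.
by apply: eq_bigr => i _; rewrite !coef_slice.
Qed.

Lemma slice0 P : slice 0 P = map_poly (@ev0 K) P.
Proof. by apply/polyP => j; rewrite [LHS]coef_slice [RHS]coef_map. Qed.

Definition of_slices N (G : nat -> {poly K}) : {poly pseries K} :=
  \poly_(j < N) PSeries (fun i => (G i)`_j).

Lemma of_slicesK N (G : nat -> {poly K}) : (forall i, (size (G i) <= N)%N) ->
  forall i, slice i (of_slices N G) = G i.
Proof.
move=> sG i; apply/polyP => j; rewrite coef_slice coef_poly.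
by case: ltnP => //= Nj; rewrite nth_default // (leq_trans (sG i)).
Qed.

Lemma size_slice_monic k P : P \is monic -> (0 < k)%N -> (size (slice k P) < size P)%N.
Proof.
move=> mP k0; have sP : size P = (size P).-1.+1.
  by rewrite prednK // size_poly_gt0 monic_neq0.
rewrite sP ltnS; apply/leq_sizeP => j; rewrite leq_eqVlt coef_slice.
case/orP=> [/eqP <-|ltj]; last by rewrite nth_default // sP.
by rewrite -lead_coefE (monicP mP) ps_coef1; case: k k0.
Qed.

Lemma monic_of_slices N (G : nat -> {poly K}) : size (G 0%N) = N.+1 -> G 0%N \is monic ->
  (forall i, (0 < i)%N -> (size (G i) <= N)%N) ->
  of_slices N.+1 G \is monic /\ size (of_slices N.+1 G) = N.+1.
Proof.
move=> s0 m0 si; have lc : PSeries (fun i => (G i)`_N) = 1.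
  apply: psP => -[|i]; rewrite ps_coef1 /=.
    by move/monicP: m0; rewrite lead_coefE s0.
  by rewrite nth_default // si.
have sz : size (of_slices N.+1 G) = N.+1 by rewrite size_poly_eq // lc oner_neq0.
by split=> //; rewrite monicE lead_coefE sz coef_poly ltnSn lc.
Qed.

(** The Bezout multiplier of [h] is reduced modulo [g] and the quotient is moved to the other term.
    The bound on [b] follows because [g * b = e - a * h] is shorter than [g * h]. *)
Lemma hensel_step (g h e : {poly K}) : g \is monic -> h \is monic -> coprimep g h ->
  (size e < size (g * h)%R)%N ->
  exists ab : {poly K} * {poly K}, [/\ e = ab.1 * h + g * ab.2,
    (size ab.1 < size g)%N & (size ab.2 < size h)%N].
Proof.
move=> mg mh /Bezout_eq1_coprimepP[[u v] /= uv] se.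
have g0 := monic_neq0 mg; have h0 := monic_neq0 mh.
have sg : (0 < size g)%N by rewrite size_poly_gt0.
have sh : (0 < size h)%N by rewrite size_poly_gt0.
pose a : {poly K} := (e * v) %% g; pose b : {poly K} := e * u + ((e * v) %/ g) * h.
have ea : e = a * h + g * b.
  transitivity (e * (u * g + v * h)); first by rewrite uv mulr1.
  have := divp_eq (e * v) g; rewrite -/a => ev; rewrite /b.
  transitivity (e * u * g + (e * v) * h); first by ring.
  by rewrite {1}ev; ring.
have sa : (size a < size g)%N by rewrite ltn_modp.
exists (a, b); split=> //=.
have eb : g * b = e - a * h by rewrite {1}ea; ring.
have : (size (g * b)%R < size (g * h)%R)%N.
  rewrite eb (leq_ltn_trans (size_polyB_max _ _)) // gtn_max se /=.
  have [->|a0] := eqVneq a 0; first by rewrite mul0r size_poly0 size_poly_gt0 mulf_neq0.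
  rewrite !size_mul //; have aux x y z : (0 < y -> x < z -> (x + y).-1 < (z + y).-1)%N by lia.
  exact: aux.
have [->|b0] := eqVneq b 0; first by rewrite mulr0 !size_poly0 !size_poly_gt0.
rewrite !size_mul //.
have aux x y z : (0 < y -> (y + x).-1 < (y + z).-1 -> x < z)%N by lia.
exact: aux.
Qed.

Lemma hensel P (g h : {poly K}) : P \is monic -> g \is monic -> h \is monic ->
  coprimep g h -> map_poly (@ev0 K) P = g * h ->
  exists G H, [/\ G \is monic, H \is monic, P = G * H, size G = size g & size H = size h].
Proof.
move=> mP mg mh cgh P0.
have sP : size P = size (g * h) .
  by rewrite -P0 size_map_poly_id0 // (monicP mP) rmorph1 oner_neq0.
have /choice[AB hAB] : forall e : {poly K}, exists ab : {poly K} * {poly K},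
    (size e < size (g * h)%R)%N -> [/\ e = ab.1 * h + g * ab.2,
    (size ab.1 < size g)%N & (size ab.2 < size h)%N].
  move=> e; have [se|_] := boolP (size e < size (g * h)%R)%N; last by exists (0, 0).
  by have [ab] := hensel_step mg mh cgh se; exists ab.
pose sq := nat -> {poly K}.
(* Both factors are built as sequences of slices. Stage [k] fills entry [k] so as to absorb the
   error in degree [k]; earlier entries are final and later ones are still zero. *)
pose err (GH : sq * sq) k := slice k P - \sum_(i < k.+1) GH.1 i * GH.2 (k - i)%N.
pose upd (G : sq) k a : sq := fun i => if i == k then a else G i.
pose step k (GH : sq * sq) : sq * sq :=
  let e := err GH k in (upd GH.1 k (AB e).1, upd GH.2 k (AB e).2).
pose fix st k : sq * sq := if k is j.+1 then step k (st j) else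
   (fun i => if i == 0%N then g else 0, fun i => if i == 0%N then h else 0).
have st_hi k i : (k < i)%N -> (st k).1 i = 0 /\ (st k).2 i = 0.
  elim: k => [|k IH] ki /=; first by case: i ki.
  rewrite /upd !ifF; [apply: IH; lia | apply/eqP; lia | apply/eqP; lia].
pose G i := (st i).1 i; pose H i := (st i).2 i.
have GS k : G k.+1 = (AB (err (st k) k.+1)).1.
  change (upd (st k).1 k.+1 (AB (err (st k) k.+1)).1 k.+1 = (AB (err (st k) k.+1)).1).
  by rewrite /upd eqxx.
have HS k : H k.+1 = (AB (err (st k) k.+1)).2.
  change (upd (st k).2 k.+1 (AB (err (st k) k.+1)).2 k.+1 = (AB (err (st k) k.+1)).2).
  by rewrite /upd eqxx.
have st_lo k i : (i <= k)%N -> (st k).1 i = G i /\ (st k).2 i = H i.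
  elim: k => [|k IH] ik; first by have -> : i = 0%N by lia.
  have [-> //|ne] := eqVneq i k.+1; have [<- <-] := IH ltac:(lia).
  by rewrite /= /upd (negbTE ne).
have main k : [/\ slice k P = \sum_(i < k.+1) G i * H (k - i)%N,
    (0 < k)%N -> (size (G k) < size g)%N & (0 < k)%N -> (size (H k) < size h)%N].
  elim/ltn_ind: k => -[|k] IH.
    by split=> //; rewrite big_ord1 slice0 P0.
  (* The two extreme products involve entries of index [k.+1], still zero at this stage, so only
     final entries remain. *)
  have eE : err (st k) k.+1 = slice k.+1 P - \sum_(i < k) G i.+1 * H (k - i)%N.
    rewrite /err big_ord_recr big_ord_recl /= subSS subn0.
    have [-> ->] := st_hi k k.+1 (ltnSn k); rewrite mulr0 mul0r addr0 add0r.
    congr (_ - _); apply: eq_bigr => i _; rewrite /bump /= add1n subSS.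
    have ik := ltn_ord i.
    have [-> _] := st_lo k i.+1 ik; have [_ -> //] := st_lo k (k - i)%N ltac:(lia).
  have se : (size (err (st k) k.+1) < size (g * h)%R)%N.
    rewrite eE (leq_ltn_trans (size_polyB_max _ _)) // gtn_max -{1}sP size_slice_monic //=.
    rewrite (leq_ltn_trans (size_sum _ _ _)) //.
    rewrite (@leq_ltn_trans (size g + size h - 2)) //; last first.
      rewrite size_mul ?monic_neq0 //.
      have aux x y : (0 < x -> 0 < y -> x + y - 2 < (x + y).-1)%N by lia.
      by apply: aux; rewrite size_poly_gt0 monic_neq0.
    apply/bigmax_leqP => i _; have ik := ltn_ord i.
    have [_ s1 _] := IH i.+1 ik; have [_ _ s2] := IH (k - i)%N ltac:(lia).
    have := s1 isT; have := s2 ltac:(lia); have := size_polyMleq (G i.+1) (H (k - i)%N); lia.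
  have [e1 e2 e3] := hAB _ se; rewrite -GS -HS in e1 e2 e3; split=> //.
  rewrite big_ord_recr big_ord_recl subnn subn0.
  rewrite -[slice _ _](subrK (\sum_(i < k) G i.+1 * H (k - i)%N)) -eE e1.
  have -> : \sum_(i < k) G (widen_ord (leqnSn k.+1) (lift ord0 i)) *
      H (k.+1 - widen_ord (leqnSn k.+1) (lift ord0 i))%N = \sum_(i < k) G i.+1 * H (k - i)%N.
    by apply: eq_bigr => i _; rewrite /= /bump add1n subSS.
  change (G k.+1 * h + g * H k.+1 + \sum_(i < k) G i.+1 * H (k - i)%N =
    g * H k.+1 + \sum_(i < k) G i.+1 * H (k - i)%N + G k.+1 * h).
  by rewrite -addrA addrC.
have sg : size g = (size g).-1.+1 by rewrite prednK // size_poly_gt0 monic_neq0.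
have sh : size h = (size h).-1.+1 by rewrite prednK // size_poly_gt0 monic_neq0.
have sG i : (0 < i)%N -> (size (G i) <= (size g).-1)%N.
  by move=> i0; rewrite -ltnS -sg; case: (main i) => _ ->.
have sH i : (0 < i)%N -> (size (H i) <= (size h).-1)%N.
  by move=> i0; rewrite -ltnS -sh; case: (main i) => _ _ ->.
have [mG zG] := @monic_of_slices (size g).-1 G sg mg sG.
have [mH zH] := @monic_of_slices (size h).-1 H sh mh sH.
exists (of_slices (size g).-1.+1 G), (of_slices (size h).-1.+1 H).
split; [exact: mG | exact: mH | | by rewrite zG -sg | by rewrite zH -sh].
apply: sliceP => k; rewrite sliceM.
have [-> _ _] := main k; apply: eq_bigr => i _.
have sG' j : (size (G j) <= (size g).-1.+1)%N.
  by case: j => [|j]; [rewrite -sg | rewrite leqW // sG].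
have sH' j : (size (H j) <= (size h).-1.+1)%N.
  by case: j => [|j]; [rewrite -sh | rewrite leqW // sH].
by rewrite !of_slicesK.
Qed.

End Slices.

(** * The substitutions y -> c y and y -> y + c in polynomials *)

Section PolySubst.
Variable R : idomainType.
Implicit Types p q : {poly R}.

Lemma coef_comp_scaleX p c i : (p \Po (c *: 'X))`_i = c ^+ i * p`_i.
Proof.
rewrite comp_polyE coef_sum.
have [si|si] := ltnP i (size p); last first.
  rewrite nth_default // mulr0 big1 // => j _.
  rewrite exprZn scalerA coefZ coefXn; case: eqP => [ij|_]; last by rewrite mulr0.
  by have := ltn_ord j; rewrite -ij ltnNge si.
rewrite (bigD1 (Ordinal si)) //= big1 ?addr0.
  by rewrite exprZn scalerA coefZ coefXn eqxx mulr1 mulrC.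
move=> j /negP ji; rewrite exprZn scalerA coefZ coefXn.
by case: eqP => [ij|_]; [case: ji; apply/eqP/val_inj | rewrite mulr0].
Qed.

Lemma comp_scaleX_inj c : c != 0 -> injective (fun p => p \Po (c *: 'X)).
Proof.
move=> c0 p q pq; apply/polyP => i; apply: (mulfI (expf_neq0 i c0)).
by rewrite -!coef_comp_scaleX pq.
Qed.

Lemma comp_XaddCK c p : (p \Po ('X + c%:P)) \Po ('X - c%:P) = p.
Proof. by rewrite -comp_polyA comp_polyD comp_polyX comp_polyC subrK comp_polyXr. Qed.

Lemma coef_XaddCXn (c : R) n : (('X + c%:P) ^+ n)`_n = 1.
Proof.
have mX : ('X + c%:P) ^+ n \is monic by rewrite monic_exp // monicXaddC.
have sX : size (('X + c%:P : {poly R}) ^+ n) = n.+1.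
  by have := size_exp_XsubC n (- c); rewrite polyCN opprK.
by have := monicP mX; rewrite lead_coefE sX.
Qed.

Lemma coef_XaddCX (c : R) n : (('X + c%:P) ^+ n.+1)`_n = c *+ n.+1.
Proof.
elim: n => [|n IH]; first by rewrite expr1 coefD coefX coefC add0r.
by rewrite exprS mulrDl coefD coefXM coefCM /= IH coef_XaddCXn mulr1 -mulrSr.
Qed.

Lemma monic_comp_XaddC c p : p \is monic ->
  p \Po ('X + c%:P) \is monic /\ size (p \Po ('X + c%:P)) = size p.
Proof.
move=> mp; have s2 : size ('X + c%:P : {poly R}) = 2 by rewrite size_XaddC.
have sz : size (p \Po ('X + c%:P)) = size p by rewrite size_comp_poly2.
split=> //; rewrite monicE lead_coef_comp ?s2 //.
by rewrite lead_coefXaddC expr1n mulr1.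
Qed.

Lemma comp_prod_XsubC (ss : seq R) (r : {poly R}) :
  (\prod_(s <- ss) ('X - s%:P)) \Po r = \prod_(s <- ss) (r - s%:P).
Proof.
elim: ss => [|s ss IH]; first by rewrite !big_nil comp_polyC.
by rewrite !big_cons comp_polyM IH comp_polyB comp_polyX comp_polyC.
Qed.

End PolySubst.

Lemma map_prod_XsubC_seq (R S : nzRingType) (phi : {rmorphism R -> S}) (ss : seq R) :
  map_poly phi (\prod_(s <- ss) ('X - s%:P)) = \prod_(s <- map phi ss) ('X - s%:P).
Proof. by rewrite rmorph_prod big_map; apply: eq_bigr => s _; rewrite /= map_polyXsubC. Qed.

(** * The Newton-Puiseux theorem *)

Section Puiseux.
Variable K : closedFieldType.
Hypothesis charK0 : [pchar K] =i pred0.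
Implicit Types P Q : {poly pseries K}.

Lemma natK_neq0 k : (0 < k)%N -> k%:R != 0 :> K.
Proof. by move: charK0 => /pcharf0P ->; rewrite -lt0n. Qed.

(** The ramification index is [q.+1], so that every [q] denotes a genuine substitution. *)
Definition ps_split q P := exists ss, map_poly (dilq q) P = \prod_(s <- ss) ('X - s%:P).

Lemma ps_split_dil q r P : ps_split q P -> ps_split (r.+1 * q.+1).-1 P.
Proof.
case=> ss e; exists (map (@dilq K r) ss).
rewrite -map_prod_XsubC_seq -e; apply/polyP => i; rewrite !coef_map /=.
by rewrite (@dil_dil _ r q (r.+1 * q.+1).-1).
Qed.

Lemma ps_split_of_dil q r P : ps_split q (map_poly (dilq r) P) ->
  ps_split (q.+1 * r.+1).-1 P.
Proof.
case=> ss e; exists ss; rewrite -e; apply/polyP => i; rewrite !coef_map /=.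
by rewrite (@dil_dil _ q r (q.+1 * r.+1).-1).
Qed.

Lemma ps_splitM q P Q : ps_split q P -> ps_split q Q -> ps_split q (P * Q).
Proof.
case=> ss es [rr er]; exists (ss ++ rr).
by rewrite big_cat /= -es -er rmorphM.
Qed.

Lemma ps_split_shift q c P : ps_split q (P \Po ('X + c%:P)) -> ps_split q P.
Proof.
case=> ss es; exists (map (fun s => s + dilq q c) ss).
rewrite -(comp_XaddCK c P) map_comp_poly es comp_prod_XsubC big_map.
apply: eq_bigr => s _; rewrite rmorphB /= map_polyX map_polyC /=.
by rewrite rmorphD /= opprD addrA addrAC.
Qed.

Lemma ps_split_scale q c n P Q : c != 0 -> size Q = n.+1 ->
  P \Po (c *: 'X) = c ^+ n *: Q -> ps_split q Q -> ps_split q P.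
Proof.
move=> c0 sQ e [ss es]; exists (map (fun s => dilq q c * s) ss).
have c1 : dilq q c != 0 by rewrite (raddf_eq0 _ (@dil_inj K q)).
apply: (comp_scaleX_inj c1); rewrite /= comp_prod_XsubC big_map.
have := congr1 (map_poly (dilq q)) e.
rewrite map_comp_poly map_polyZ /= map_polyX map_polyZ /= es => ->.
have sS : size ss = n.
  apply: succn_inj; rewrite -(size_prod_XsubC ss id) -es -sQ.
  by rewrite size_map_inj_poly ?rmorph0 //; apply: dil_inj.
rewrite rmorphXn /= -sS; elim: ss {es sS} => [|s ss IH].
  by rewrite !big_nil expr0 scale1r.
rewrite !big_cons -IH /= exprS -scalerA scalerAr scalerAl; congr (_ * _).
by rewrite scalerBr -[_ *: _%:P]mul_polyC -polyCM.
Qed.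

Theorem puiseux P : P \is monic -> exists q, ps_split q P.
Proof.
have [m] := ubnP (size P); elim: m P => // m IHm P0 sP0 mP0.
have [n sn] : exists n, size P0 = n.+1.
  by exists (size P0).-1; rewrite prednK // size_poly_gt0 monic_neq0.
case: n sn => [|n] sn.
  have /size_poly1P[c c0 eP] : size P0 == 1%N by rewrite sn.
  exists 0%N; exists [::]; rewrite big_nil.
  move: mP0; rewrite eP monicE lead_coefC => /eqP ->.
  by rewrite polyC1 rmorph1.
(* Tschirnhausen shift: it removes the term of degree [n], which later excludes a root of full
   multiplicity. *)
pose c := psC (- n.+1%:R^-1) * P0`_n.
have [mP sP] := monic_comp_XaddC c mP0.
suff [q] : exists q, ps_split q (P0 \Po ('X + c%:P)).
  by move/ps_split_shift; exists q.
have Pn : (P0 \Po ('X + c%:P))`_n = 0.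
  have {1}-> : P0 = 'X^(n.+1) + P0`_n *: 'X^n + \poly_(i < n) P0`_i.
    apply/polyP => i; rewrite !coefD coefZ !coefXn coef_poly.
    have [lin|] := ltnP i n; first by rewrite !ltn_eqF ?mulr0 ?add0r // ltnW.
    rewrite leq_eqVlt addr0 => /orP[/eqP <-|]; first by rewrite eqxx ltn_eqF // add0r mulr1.
    rewrite leq_eqVlt => /orP[/eqP <-|li]; last by rewrite !gtn_eqF ?mulr0 ?addr0 ?nth_default ?sn // ltnW.
    by rewrite eqxx gtn_eqF // mulr0 addr0; move/monicP: mP0; rewrite lead_coefE sn.
  set r := \poly_(i < n) _; rewrite !comp_polyD comp_polyZ !coefD coefZ.
  rewrite [X in _ + X]nth_default ?addr0; last first.
    have [->|r0] := eqVneq r 0; first by rewrite comp_poly0 size_poly0.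
    have : (size r <= n)%N by apply: size_poly.
    by rewrite size_comp_poly2 ?size_XaddC.
  by rewrite !comp_Xn_poly coef_XaddCX coef_XaddCXn mulr1 -mulr_natl [_ * c]mulrA
    -[n.+1%:R](rmorph_nat (@psC K)) -rmorphM mulrN mulfV ?natK_neq0 // rmorphN rmorph1 mulN1r addNr.
have {mP0 sP0} sPm : (size (P0 \Po ('X + c%:P)) <= m)%N by rewrite sP -ltnS.
rewrite {}sn in sP; move: Pn mP sP sPm; move: (P0 \Po _) => P {c P0} Pn mP sP sPm.
have sPn : size P = n.+2 by [].
(* Ramifying by [(n+1)!] makes the slopes of the Newton polygon integers. *)
pose D := (n.+1)`!.-1.
have DE : D.+1 = (n.+1)`! by rewrite prednK ?fact_gt0.
suff [q /ps_split_of_dil] : exists q, ps_split q (map_poly (dilq D) P) by eexists; eauto.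
set P1 := map_poly (dilq D) P.
have P1c i : P1`_i = dilq D P`_i by rewrite coef_map.
have mP1 : P1 \is monic by apply: monic_map.
have sP1 : size P1 = n.+2.
  by rewrite size_map_inj_poly ?rmorph0 //; apply: dil_inj.
(* Either all lower coefficients vanish to every order, and the polynomial is a pure power of the
   variable, or some integer slope fails; the least failing one is [o.+1]. *)
have [all0|/existsNP[o0 no0]] := pselect (forall o i, (i < n.+1)%N -> ps_vanish ((n.+1 - i) * o) P1`_i).
  exists 0%N; exists (nseq n.+2.-1 0).
  have -> : P1 = 'X^(n.+1).
    apply/polyP => i; rewrite coefXn.
    case: ltngtP => [lin|lin|->].
    - apply: psP => k; rewrite ps_coef0; apply: (all0 k.+1 i) => //.
      by rewrite (leq_trans (leq_pmull k.+1 (_ : 0 < n.+1 - i)%N)) ?subn_gt0 //.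
    - by rewrite nth_default // sP1.
    by move/monicP: mP1; rewrite lead_coefE sP1.
  by rewrite big_nseq subr0 map_polyXn iter_mulr_1.
have exo : exists o, `[< ~ forall i, (i < n.+1)%N -> ps_vanish ((n.+1 - i) * o) P1`_i >].
  by exists o0; apply/asboolP.
case: (ex_minnP exo) => -[|o] /asboolP no mino.
  by case: no => i _; rewrite muln0.
have vo i : (i < n.+1)%N -> ps_vanish ((n.+1 - i) * o) P1`_i.
  move=> lin; apply: contrapT => nv.
  suff /mino : `[< ~ forall i, (i < n.+1)%N -> ps_vanish ((n.+1 - i) * o) P1`_i >].
    by rewrite ltnn.
  by apply/asboolP => /(_ i lin).
have [i0 [lin0 ne0]] : exists i, (i < n.+1)%N /\ P1`_i ((n.+1 - i) * o)%N != 0.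
  apply: contrapT => /forallNP nex; apply: no => i lin e lte.
  have [lte'|lee] := ltnP e ((n.+1 - i) * o); first exact: vo.
  have [Dv|nDv] := boolP (D.+1 %| e)%N; last by rewrite P1c /= (negbTE nDv).
  have : (n.+1 - i %| e)%N.
    by apply: dvdn_trans Dv; rewrite DE dvdn_fact // subn_gt0 lin leq_subr.
  case/dvdnP=> k ek; have {ek} -> : e = ((n.+1 - i) * o)%N.
    have ek' : (e = (n.+1 - i) * k)%N by rewrite mulnC.
    rewrite ek' ltn_pmul2l ?subn_gt0 // in lte; rewrite ek' leq_pmul2l ?subn_gt0 // in lee.
    by rewrite ek'; congr (_ * _)%N; lia.
  by apply/eqP; apply: contra_notT (nex i) => ne.
(* [Q] is [P1] after the substitution y -> t^o y, divided by t^(o (n+1)); its reduction at t = 0 is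
   not a pure power of the variable. *)
pose Q : {poly pseries K} := \poly_(i < n.+2) ps_shift ((n.+1 - i) * o) P1`_i.
have Qc i : (i <= n.+1)%N -> P1`_i = ps_tau ^+ ((n.+1 - i) * o) * Q`_i.
  move=> lin; rewrite [Q`_i]coef_poly ltnS lin; apply: ps_shiftK.
  by move: lin; rewrite leq_eqVlt => /orP[/eqP->|/vo//]; rewrite subnn mul0n.
have Q1 : Q`_n.+1 = 1.
  have := Qc n.+1 (leqnn _); rewrite subnn mul0n expr0 mul1r => <-.
  by move/monicP: mP1; rewrite lead_coefE sP1.
have sQ : size Q = n.+2.
  apply/eqP; rewrite eqn_leq size_poly /= ltnNge; apply/negP => sQ.
  by move: Q1; rewrite nth_default // => /esym/eqP; rewrite oner_eq0.
have mQ : Q \is monic by rewrite monicE lead_coefE sQ Q1.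
have Qn : Q`_n = 0.
  apply: (@tauX_lreg _ ((n.+1 - n) * o)).
  by rewrite -Qc // P1c Pn rmorph0 mulr0.
suff [q sq] : exists q, ps_split q Q.
  exists q; apply: (@ps_split_scale q (ps_tau ^+ o) n.+1 P1 Q) => //.
    by rewrite expf_neq0 ?tau_neq0.
  apply/polyP => i; rewrite coef_comp_scaleX coefZ.
  have [lin|lin] := leqP i n.+1; last by rewrite !nth_default ?mulr0 ?sQ ?sP1.
  by rewrite Qc // mulrA -!exprM -exprD; congr (ps_tau ^+ _ * _); nia.
pose p0 : {poly K} := map_poly (@ev0 K) Q.
have mp0 : p0 \is monic by apply: monic_map.
have sp0 : size p0 = n.+2.
  by rewrite size_map_poly_id0 ?sQ // (monicP mQ) rmorph1 oner_neq0.
have [a ra] : exists a, root p0 a by apply: closed_rootP; rewrite sp0.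
have [k [h hr eh]] := multiplicity_XsubC p0 a.
rewrite (monic_neq0 mp0) /= in hr.
have h0 : h != 0 by apply: contraNneq hr => ->; rewrite root0.
have k0 : (0 < k)%N.
  by case: k eh => // eh; move: ra; rewrite eh expr0 mulr1 (negbTE hr).
have mk : ('X - a%:P) ^+ k \is monic by rewrite monic_exp // monicXsubC.
have mh : h \is monic.
  by move: mp0; rewrite eh monicE lead_coefM (monicP mk) mulr1.
have szE : (size h + k = n.+2)%N.
  by rewrite -sp0 eh size_Mmonic // size_exp_XsubC addnS.
(* Otherwise the reduction is [('X - a) ^+ n.+1]. Its coefficient of degree [n] is zero, so [a = 0]
   in characteristic zero, against the nonzero coefficient found at [i0]. *)
have sh1 : (1 < size h)%N.
  rewrite ltnNge; apply/negP => sh.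
  have h1 : h = 1.
    have /size_poly1P[c c0 hc] : size h == 1%N by rewrite eqn_leq sh size_poly_gt0.
    by move: mh; rewrite hc monicE lead_coefC => /eqP ->.
  have kn : k = n.+1 by move: szE; rewrite h1 size_poly1 add1n => -[].
  have p0n : p0`_n = 0 by rewrite coef_map Qn.
  move: p0n; rewrite eh h1 mul1r kn -[- a%:P]polyCN coef_XaddCX.
  move=> /eqP; rewrite -mulr_natl mulf_eq0 (negbTE (natK_neq0 _)) // oppr_eq0 => /eqP a0.
  have := coef_map (@ev0 K) Q i0; rewrite -/p0 eh h1 mul1r kn a0 subr0 coefXn ltn_eqF //.
  move=> /esym/eqP; rewrite coef_poly ltnS (ltnW lin0) /ev0 /= add0n.
  by rewrite (negbTE ne0).
have cop : coprimep (('X - a%:P) ^+ k) h.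
  by rewrite coprimep_expl // coprimep_sym coprimep_XsubC.
have [G [H [mG mH eQ sG sH]]] := hensel mQ mk mh cop (etrans (erefl _) (etrans eh (mulrC _ _))).
have [q1 s1] : exists q, ps_split q G.
  apply: IHm => //; rewrite sG size_exp_XsubC; apply: leq_trans sPm.
  by rewrite sPn -szE -[k.+1]add1n ltn_add2r.
have [q2 s2] : exists q, ps_split q H.
  apply: IHm => //; rewrite sH; apply: leq_trans sPm.
  by rewrite sPn -szE -[X in (X < _)%N]addn0 ltn_add2l.
exists (q1.+1 * q2.+1).-1; rewrite eQ; apply: ps_splitM; last exact: ps_split_dil.
by rewrite mulnC; apply: ps_split_dil.
Qed.

End Puiseux.

Lemma prod_roots_dvd (R : idomainType) (rs : seq R) (p : {poly R}) :
  uniq rs -> all (root p) rs -> exists q, p = q * \prod_(r <- rs) ('X - r%:P).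
Proof.
elim: rs p => [|r rs IH] p /=; first by exists p; rewrite big_nil mulr1.
case/andP=> nr urs /andP[/factor_theorem[q ->] ars].
have [|q' ->] := IH q urs; last by exists q'; rewrite big_cons mulrAC -mulrA.
apply/allP => s srs; have /allP/(_ s srs) := ars; rewrite /root hornerM mulf_eq0.
rewrite hornerXsubC subr_eq0; case/orP=> // /eqP sr.
by rewrite -sr srs in nr.
Qed.

(** In characteristic zero ['X^M - 1] is separable, so it has [M] distinct roots, enough for a
    primitive one. *)
Lemma prim_root_exists (K : closedFieldType) (charK0 : [pchar K] =i pred0) M :
  (0 < M)%N -> exists w : K, M.-primitive_root w.
Proof.
move=> M0; have nz : M%:R != 0 :> K by apply: natK_neq0.
have [rs ers] := closed_field_poly_normal ('X^M - 1 : {poly K}).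
have m1 : lead_coef ('X^M - 1 : {poly K}) = 1 by rewrite (monicP (monicXnsubC 1 M0)).
rewrite m1 scale1r in ers.
have urs : uniq rs by rewrite -separable_prod_XsubC -ers separable_Xn_sub_1.
have srs : size rs = M.
  apply: succn_inj; rewrite -(size_prod_XsubC rs id) -ers.
  by rewrite -[1]/(1%:P) size_XnsubC.
have ars : all M.-unity_root rs.
  apply/allP => r rrs; by rewrite /root_of_unity ers root_prod_XsubC.
have /hasP[w _ wp] := has_prim_root M0 ars urs (eq_leq (esym srs)).
by exists w.
Qed.

(** * From irreducibility in K[[u, y]] to a single orbit of Puiseux roots *)

Section IrreducibleParametrization.
Variable K : closedFieldType.
Hypothesis charK0 : [pchar K] =i pred0.

Definition series2_of (P : {poly pseries K}) : series2 K := fun i j => P`_j i.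

Lemma series2_ofM P Q : series2_of (P * Q) = series2_mul (series2_of P) (series2_of Q).
Proof.
apply: funext => i; apply: funext => j; rewrite /series2_of /series2_mul coefM.
by rewrite ps_coef_sum [RHS]exchange_big; apply: eq_bigr => l _; rewrite ps_coefM.
Qed.

Lemma series2_unit_coef0 P : series2_unit (series2_of P) -> P`_0 0%N != 0.
Proof.
case=> G /(congr1 (fun s : series2 K => s 0%N 0%N)).
rewrite /series2_mul /series2_one !big_ord1 /= /series2_of => e.
by apply: contra_eq_neq e => ->; rewrite mul0r eq_sym oner_eq0.
Qed.

(** A unit has nonzero constant coefficient, so its reduction at u = 0 is prime to ['X^n], which it
    divides: a monic such factor is 1. This carries irreducibility from K[[u, y]] over to monic
    factors in K[[u]][y]. *)
Lemma series2_nonunit P n Q : P \is monic -> slice 0 (P * Q) = 'X^n ->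
  series2_unit (series2_of P) -> P = 1.
Proof.
move=> mP; rewrite sliceM big_ord1 => e /series2_unit_coef0 P0.
have s0 : size (slice 0 P) = size P.
  by rewrite slice0 size_map_poly_id0 // (monicP mP) rmorph1 oner_neq0.
have cp : coprimep (slice 0 P) 'X^n.
  by rewrite coprimep_expr // -['X]subr0 coprimep_XsubC rootE horner_coef0 coef_slice.
have : size (slice 0 P) == 1%N.
  have := dvdp_mulIl (slice 0 P) (slice 0 Q); rewrite e => d.
  by rewrite -(eqp_size (dvdp_gcd_idl d)).
rewrite s0 => /size_poly1P[c _ eP].
by move: mP; rewrite eP monicE lead_coefC => /eqP ->.
Qed.

Lemma rot_fixed q (w : K) a : q.+1.-primitive_root w -> rot w a = a ->
  exists b, a = dilq q b.
Proof.
move=> pw ra; apply: dilP => i ni; apply/eqP; move: ni; apply: contraNT => ai.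
rewrite (prim_order_dvd pw); have := congr1 (fun s : pseries K => s i) ra.
by move=> /= /(canRL (mulfK ai)) ->; rewrite mulfV.
Qed.

Lemma rot_fixed_poly q (w : K) (Q : {poly pseries K}) : q.+1.-primitive_root w ->
  map_poly (rot w) Q = Q -> exists Q', Q = map_poly (dilq q) Q'.
Proof.
move=> pw rQ; have /choice[b hb] : forall i, exists b, Q`_i = dilq q b.
  by move=> i; apply: rot_fixed pw _; rewrite -coef_map rQ.
exists (\poly_(i < size Q) b i); apply/polyP => i; rewrite coef_map coef_poly.
by case: ltnP => h; [apply: hb | rewrite nth_default // raddf0].
Qed.

Lemma dil_map_inj q : injective (map_poly (@dilq K q)).
Proof. by apply: map_inj_poly; [apply: dil_inj | rewrite rmorph0]. Qed.

Lemma dil_map_monic q (P : {poly pseries K}) : map_poly (dilq q) P \is monic -> P \is monic.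
Proof.
rewrite !monicE; have -> : lead_coef (map_poly (dilq q) P) = dilq q (lead_coef P).
  by rewrite lead_coef_map_inj ?rmorph0 //; apply: dil_inj.
by move/eqP=> e; apply/eqP/(@dil_inj K q); rewrite e rmorph1.
Qed.

(** The orbit of one Puiseux root under rotation by roots of unity gives an invariant factor, which
    descends to K[[u]]. Irreducibility makes it all of [P], so the roots form one orbit with exactly
    [n] elements. *)
Theorem irreducible_parametrization n (P : {poly pseries K}) :
  (0 < n)%N -> P \is monic -> size P = n.+1 -> slice 0 P = 'X^n ->
  series2_irreducible (series2_of P) ->
  exists w s, [/\ n.-primitive_root w,
    map_poly (dilq n.-1) P = \prod_(k < n) ('X - (rot (w ^+ k) s)%:P) &
    forall k, (0 < k < n)%N -> rot (w ^+ k) s != s].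
Proof.
move=> n0 mP sP P0 [_ irrP].
have [q [ss ess]] := puiseux charK0 mP.
have [w pw] := prim_root_exists charK0 (ltn0Sn q).
have dP r : root (map_poly (dilq q) P) r -> root (map_poly (dilq q) P) (rot w r).
  rewrite /root => /eqP hr; apply/eqP; rewrite -(rmorph0 (@rot K w)) -hr -horner_map /=.
  congr (_.[_]); apply/polyP => i; rewrite !coef_map /= rot_dil.
  by rewrite (prim_expr_order pw) rot1.
have [s0 rs0] : exists s, root (map_poly (dilq q) P) s.
  case: ss ess => [|s ss] ess; last by exists s; rewrite ess root_prod_XsubC mem_head.
  move: ess; rewrite big_nil => /(congr1 (fun p : {poly pseries K} => size p)).
  rewrite size_poly1 size_map_inj_poly ?rmorph0 //; last exact: dil_inj.
  by rewrite sP => -[n0']; rewrite n0' in n0.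
have rsk k : root (map_poly (dilq q) P) (rot (w ^+ k) s0).
  by elim: k => [|k IH]; rewrite ?rot1 // exprS -rot_comp dP.
have exk : exists k, (0 < k)%N && (rot (w ^+ k) s0 == s0).
  by exists q.+1; rewrite (prim_expr_order pw) rot1 eqxx.
(* [k0] is the length of the orbit of [s0]. *)
have [k0 /andP[k00 /eqP rk0] mink] := ex_minnP exk.
have perk k : rot (w ^+ k) s0 = s0 -> (k0 %| k)%N.
  move=> rk; rewrite /dvdn -leqn0 leqNgt; apply/negP => km.
  have := mink (k %% k0)%N; rewrite km leqNgt ltn_pmod //= => /(_ _)/negP; apply=> //.
  apply/eqP; rewrite -{2}rk {2}(divn_eq k k0) addnC exprD -rot_comp.
  have -> : rot (w ^+ (k %/ k0 * k0)) s0 = s0; last by [].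
  by elim: (k %/ k0)%N => [|j IH]; rewrite ?rot1 // mulSn exprD -rot_comp IH.
have w0 : w != 0.
  by apply/eqP => w0; have := prim_expr_order pw; rewrite w0 expr0n => /eqP; rewrite eq_sym oner_eq0.
have rinj k a b : rot (w ^+ k) a = rot (w ^+ k) b -> a = b.
  move/(congr1 (rot (w ^- k))); rewrite !rot_comp mulVf ?expf_neq0 //.
  by rewrite !rot1.
have rlt k l : (k < l < k0)%N -> rot (w ^+ k) s0 != rot (w ^+ l) s0.
  case/andP=> kl lk0; apply/eqP => e.
  have : (k0 %| l - k)%N.
    apply: perk; apply: (@rinj k); rewrite rot_comp -exprD subnKC // ltnW //.
  by move/dvdn_leq; rewrite subn_gt0 kl => /(_ isT); lia.
pose rs := [seq rot (w ^+ k) s0 | k <- iota 0 k0].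
have urs : uniq rs.
  rewrite map_inj_in_uniq ?iota_uniq // => k l; rewrite !mem_iota !add0n /= => lk ll e.
  by case: (ltngtP k l) => // h; [have := @rlt k l|have := @rlt l k]; rewrite h e ?lk ?ll eqxx => /(_ isT).
have ars : all (root (map_poly (dilq q) P)) rs by apply/allP => r /mapP[k _ ->].
have [RR eR] := prod_roots_dvd urs ars.
set QQ := \prod_(r <- rs) _ in eR.
have QQE : QQ = \prod_(k < k0) ('X - (rot (w ^+ k) s0)%:P).
  by rewrite /QQ big_map -[k0 in LHS]subn0 big_mkord.
have rQ : map_poly (rot w) QQ = QQ.
  rewrite QQE rmorph_prod; under eq_bigr do rewrite /= map_polyXsubC /= rot_comp -exprS.
  case: (k0) k00 rk0 => // j _ rk0; rewrite [LHS]big_ord_recr [RHS]big_ord_recl /= rk0 mulrC.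
  by rewrite rot1.
have rP : map_poly (rot w) (map_poly (dilq q) P) = map_poly (dilq q) P.
  by apply/polyP => i; rewrite !coef_map /= rot_dil (prim_expr_order pw) rot1.
have mQ : QQ \is monic by rewrite monic_prod_XsubC.
have rR : map_poly (rot w) RR = RR.
  by have := rP; rewrite eR rmorphM /= rQ; apply: (mulIf (monic_neq0 mQ)).
have mdP : map_poly (dilq q) P \is monic by apply: monic_map.
have mR : RR \is monic by move: mdP; rewrite eR monicMr.
have [Q' eQ] := rot_fixed_poly pw rQ.
have [R' eR'] := rot_fixed_poly pw rR.
have mQ' : Q' \is monic by apply: (@dil_map_monic q); rewrite -eQ.
have mR' : R' \is monic by apply: (@dil_map_monic q); rewrite -eR'.
have ePQ : P = R' * Q' by apply: (@dil_map_inj q); rewrite rmorphM /= -eQ -eR'.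
have sQ : size Q' = k0.+1.
  rewrite -(size_map_inj_poly (@dil_inj K q) (rmorph0 _)) -eQ size_prod_XsubC.
  by rewrite size_map size_iota.
(* The orbit factor has degree [k0 > 0] and cannot be 1, so the unit is the cofactor. *)
have [uR|uQ] := irrP _ _ (etrans (congr1 series2_of ePQ) (series2_ofM _ _)); last first.
  have := @series2_nonunit Q' n R' mQ' _ uQ; rewrite mulrC -ePQ => /(_ P0) Q1.
  by move: sQ; rewrite Q1 size_poly1 => -[k0E]; rewrite -k0E in k00.
have R1 : R' = 1 by apply: (@series2_nonunit R' n Q' mR' _ uR); rewrite -ePQ.
have {ePQ} ePQ : P = Q' by rewrite ePQ R1 mul1r.
have {eR R1 uR mR' eR' rR mR RR R'} eP : map_poly (dilq q) P = QQ by rewrite ePQ -eQ.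
have k0n : k0 = n by move: sQ; rewrite -ePQ sP => -[].
have /dvdnP[e qe] : (n %| q.+1)%N.
  by rewrite -k0n; apply: perk; rewrite (prim_expr_order pw) rot1.
have e0 : (0 < e)%N by case: e qe.
(* Rotation by [w ^+ n] fixes [s0], so only exponents divisible by [e = (q + 1) / n] occur, and t^e
   can be taken as the new parameter. *)
have [s es] : exists s, s0 = dilq e.-1 s.
  apply: dilP => i ni; apply/eqP; move: ni; apply: contraNT => ai.
  have := congr1 (fun s : pseries K => s i) rk0.
  move=> /= /(canRL (mulfK ai)); rewrite mulfV // -exprM k0n => /eqP.
  by rewrite -(prim_order_dvd pw) qe mulnC dvdn_pmul2l // prednK.
have ee : e.-1.+1 = e by rewrite prednK.
have rotE k : rot (w ^+ k) s0 = dilq e.-1 (rot ((w ^+ e) ^+ k) s).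
  by rewrite es rot_dil ee -!exprM mulnC.
exists (w ^+ e), s; split.
- have := dvdn_prim_root pw (_ : (n %| q.+1)%N); rewrite qe mulnK // dvdn_mull //.
  by apply.
- apply: (@dil_map_inj e.-1); rewrite rmorph_prod.
  transitivity (map_poly (dilq q) P).
    by apply/polyP => i; rewrite !coef_map /= (@dil_dil _ e.-1 n.-1 q) // ee prednK.
  rewrite eP QQE k0n; apply: eq_bigr => k _.
  by rewrite /= map_polyXsubC /= rotE.
move=> k /andP[kg kl]; have := @rlt 0%N k; rewrite kg k0n kl rot1 => /(_ isT).
by rewrite rotE {1}es eq_sym; apply: contraNneq => ->.
Qed.

End IrreducibleParametrization.

(** * Laurent series and their leading terms *)

Section LaurentField.
Variable K : fieldType.

(* K((t)) as an abstract field: computing in [{fraction pseries K}] makes conversion blow up. *)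
Record laurent := Laurent {
  lfield :> fieldType;
  emb : {rmorphism pseries K -> lfield};
  emb_inj : injective emb;
  emb_gen : forall z : lfield, exists k a, z * emb ps_tau ^+ k = emb a }.

(** In the fraction field of K[[t]] every denominator is a power of t times a unit, so a power of t
    alone clears it. *)
Lemma laurent_exists : exists L : laurent, True.
Proof.
have gen (z : {fraction pseries K}) : exists k a,
    z * FracField.tofrac (ps_tau : pseries K) ^+ k = FracField.tofrac a.
  have [a [b [b0 e]]] : exists a b, b != 0 /\ z * FracField.tofrac b = FracField.tofrac (a : pseries K).
    exists (frac (repr z)).1, (frac (repr z)).2; split; first exact: denom_ratioP.
    rewrite -[z in z * _]reprK; unlock FracField.tofrac.
    rewrite -[LHS]FracField.pi_mul; apply/eqmodP => /=.
    rewrite FracField.equivfE /FracField.mulf /= !numden_Ratio ?oner_neq0 ?mulf_neq0 ?denom_ratioP //=.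
    by rewrite !mulr1 mulrC.
    1,2: exact: oner_neq0.
  have [k [s [eb s0]]] := ps_neq0P b0.
  exists k, (a * ps_inv s); rewrite rmorphM /= -e eb rmorphM rmorphXn /=.
  by rewrite mulrA -mulrA -rmorphM ps_mulVr // rmorph1 mulr1.
have inj : injective (@FracField.tofrac (pseries K)).
  by move=> a b /eqP; rewrite tofrac_eq => /eqP.
by exists (@Laurent {fraction pseries K} (@FracField.tofrac (pseries K)) inj gen).
Qed.

Variable L : laurent.
Implicit Types (x y z : L) (c e : K) (k l : int) (a b : pseries K).

Definition tauL : L := emb L ps_tau.

Lemma tauL_neq0 : tauL != 0.
Proof. by rewrite (raddf_eq0 _ (@emb_inj L)) tau_neq0. Qed.

Definition frac_rep z a b := b != 0 /\ z * emb L b = emb L a.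

Lemma frac_repE z : exists ab, frac_rep z ab.1 ab.2.
Proof.
have [k [a e]] := emb_gen z; exists (a, ps_tau ^+ k); split=> /=.
  by rewrite expf_neq0 ?tau_neq0.
by rewrite rmorphXn.
Qed.

Lemma emb_neq0 b : b != 0 -> emb L b != 0.
Proof. by rewrite (raddf_eq0 _ (@emb_inj L)). Qed.

Lemma frac_repD z z' a b a' b' : frac_rep z a b -> frac_rep z' a' b' ->
  frac_rep (z - z') (a * b' - a' * b) (b * b').
Proof.
case=> b0 e [b0' e']; split; first by rewrite mulf_neq0.
by rewrite rmorphB !rmorphM -e -e'; ring.
Qed.

Lemma frac_repM z z' a b a' b' : frac_rep z a b -> frac_rep z' a' b' ->
  frac_rep (z * z') (a * a') (b * b').
Proof.
by case=> b0 e [b0' e']; split; [rewrite mulf_neq0 | rewrite !rmorphM -e -e'; ring].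
Qed.

Lemma frac_rep1 a : frac_rep (emb L a) a 1.
Proof. by split; rewrite ?oner_neq0 // rmorph1 mulr1. Qed.

(** Numerator and denominator are mapped separately: injectivity keeps denominators nonzero, and
    [key] gives independence of the chosen fraction. *)
Lemma laurent_lift (phi : {rmorphism pseries K -> pseries K}) : injective phi ->
  exists Phi : {rmorphism L -> L}, forall a, Phi (emb L a) = emb L (phi a).
Proof.
move=> iphi; have /choice[r hr] := frac_repE.
pose Phi z : L := emb L (phi (r z).1) / emb L (phi (r z).2).
have phi0 b : b != 0 -> emb L (phi b) != 0.
  by move=> b0; rewrite emb_neq0 // (raddf_eq0 _ iphi).
have key z a b : frac_rep z a b -> Phi z * emb L (phi b) = emb L (phi a).
  case=> b0 e; have [c0 e'] := hr z.
  rewrite mulrAC; apply: (canLR (mulfK (phi0 _ c0))); rewrite -!rmorphM.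
  congr (emb L (phi _)); apply: (@emb_inj L); rewrite !rmorphM -e -e'; ring.
have rep_inj z y a b : frac_rep z a b -> y * emb L (phi b) = emb L (phi a) -> Phi z = y.
  by move=> h e; apply: (mulIf (phi0 _ h.1)); rewrite e (key _ _ _ h).
have addP : zmod_morphism Phi.
  move=> z z'; apply: rep_inj (frac_repD (hr z) (hr z')) _.
  rewrite !(rmorphB, rmorphM) /= -(key _ _ _ (hr z)) -(key _ _ _ (hr z')); ring.
have mulP : monoid_morphism Phi.
  split=> [|z z'].
    have := @rep_inj (emb L 1) 1 1 1 (frac_rep1 1); rewrite !rmorph1 mulr1.
    exact.
  apply: rep_inj (frac_repM (hr z) (hr z')) _.
  rewrite !rmorphM /= -(key _ _ _ (hr z)) -(key _ _ _ (hr z')); ring.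
pose add := GRing.isZmodMorphism.Build L L Phi addP.
pose mul := GRing.isMonoidMorphism.Build L L Phi mulP.
pose PhiM : {rmorphism L -> L} := HB.pack Phi add mul.
exists PhiM => a; apply: rep_inj (frac_rep1 a) _.
by rewrite rmorph1 rmorph1 mulr1.
Qed.

(** The quotient rule defines the extension of [theta], and [key] makes it independent of the chosen
    fraction. *)
Lemma laurent_derivation : exists Th : {additive L -> L},
  (forall x y, Th (x * y) = Th x * y + x * Th y) /\
  (forall a, Th (emb L a) = emb L (theta a)).
Proof.
have /choice[r hr] := frac_repE.
pose Th z : L := (emb L (theta (r z).1) - z * emb L (theta (r z).2)) / emb L (r z).2.
have key z a b : frac_rep z a b -> Th z * emb L b = emb L (theta a) - z * emb L (theta b).
  case=> b0 e; have [c0 e'] := hr z.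
  rewrite mulrAC; apply: (canLR (mulfK (emb_neq0 c0))).
  have ab : (r z).1 * b = a * (r z).2.
    by apply: (@emb_inj L); rewrite !rmorphM -e -e'; ring.
  have := congr1 (fun s : pseries K => emb L (theta s)) ab.
  rewrite /= !thetaM !rmorphD !rmorphM -e -e' => E.
  apply/eqP; rewrite -subr_eq0; move/eqP: E; rewrite -subr_eq0; apply: etrans.
  by congr (_ == 0); ring.
have rep_inj z y a b : frac_rep z a b ->
    y * emb L b = emb L (theta a) - z * emb L (theta b) -> Th z = y.
  by move=> h e; apply: (mulIf (emb_neq0 h.1)); rewrite e (key _ _ _ h).
have addP : zmod_morphism Th.
  move=> z z'; apply: rep_inj (frac_repD (hr z) (hr z')) _.
  have := key _ _ _ (hr z); have := key _ _ _ (hr z').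
  have [_ e] := hr z; have [_ e'] := hr z'.
  move=> k' k; rewrite raddfB /= !thetaM rmorphB !rmorphD !rmorphM -e -e'.
  rewrite mulrBl [_ * (emb L (r z).2 * _)]mulrA k [Th z' * _]mulrCA k'; ring.
pose add := GRing.isZmodMorphism.Build L L Th addP.
pose ThM : {additive L -> L} := HB.pack Th add.
exists ThM; split=> [z z'|a].
  apply: rep_inj (frac_repM (hr z) (hr z')) _.
  have := key _ _ _ (hr z); have := key _ _ _ (hr z').
  have [_ e] := hr z; have [_ e'] := hr z'.
  move=> k' k; rewrite !thetaM !rmorphD !rmorphM -e -e' /=.
  transitivity ((Th z * emb L (r z).2) * (z' * emb L (r z').2) + (z * emb L (r z).2) * (Th z' * emb L (r z').2)); first by ring.
  by rewrite k k'; ring.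
apply: rep_inj (frac_rep1 a) _; rewrite rmorph1 mulr1.
have -> : theta (1 : pseries K) = 0 by apply: psP => -[|i]; rewrite /= ?mulr0n ?mul0rn.
by rewrite rmorph0 mulr0 subr0.
Qed.

(* x = c t^k + higher order terms; c = 0 is allowed. *)
Definition lead k x c := exists a, x = tauL ^ k * emb L a /\ a 0%N = c.

Lemma lead_emb a : lead 0 (emb L a) (a 0%N).
Proof. by exists a; rewrite expr0z mul1r. Qed.

Lemma lead_zero k : lead k 0 0.
Proof. by exists 0; rewrite rmorph0 mulr0. Qed.

Lemma leadD k x y c e : lead k x c -> lead k y e -> lead k (x + y) (c + e).
Proof. by case=> a [-> <-] [b [-> <-]]; exists (a + b); rewrite rmorphD mulrDr. Qed.

Lemma leadN k x c : lead k x c -> lead k (- x) (- c).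
Proof. by case=> a [-> <-]; exists (- a); rewrite rmorphN mulrN. Qed.

Lemma leadB k x y c e : lead k x c -> lead k y e -> lead k (x - y) (c - e).
Proof. by move=> h /leadN; apply: leadD. Qed.

Lemma leadM k l x y c e : lead k x c -> lead l y e -> lead (k + l) (x * y) (c * e).
Proof.
case=> a [-> <-] [b [-> <-]]; exists (a * b).
by rewrite rmorphM expfzDr ?tauL_neq0 // mulrACA ps_coefM0.
Qed.

Lemma lead_tau k : lead k (tauL ^ k) 1.
Proof. by exists 1; rewrite rmorph1 mulr1. Qed.

Lemma lead_one : lead 0 1 1.
Proof. exact: lead_tau. Qed.

Lemma lead_prod I (r : seq I) (P : pred I) (k : I -> int) (x : I -> L) (c : I -> K) :
  (forall i, P i -> lead (k i) (x i) (c i)) ->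
  lead (\sum_(i <- r | P i) k i) (\prod_(i <- r | P i) x i) (\prod_(i <- r | P i) c i).
Proof.
move=> h; elim: r => [|i r IH]; first by rewrite !big_nil; apply: lead_one.
by rewrite !big_cons; case: ifP => // /h hi; apply: leadM.
Qed.

Lemma leadX k x c n : lead k x c -> lead (k *+ n) (x ^+ n) (c ^+ n).
Proof.
move=> h; elim: n => [|n IH]; first exact: lead_one.
by rewrite mulrS !exprS; apply: leadM.
Qed.

Lemma lead_sum I (r : seq I) (P : pred I) k (x : I -> L) (c : I -> K) :
  (forall i, P i -> lead k (x i) (c i)) ->
  lead k (\sum_(i <- r | P i) x i) (\sum_(i <- r | P i) c i).
Proof.
move=> h; elim: r => [|i r IH]; first by rewrite !big_nil; apply: lead_zero.
by rewrite !big_cons; case: ifP => // /h hi; apply: leadD.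
Qed.

Lemma lead_weak k l x c : (l < k) -> lead k x c -> lead l x 0.
Proof.
move=> lk [a [-> _]]; have [m em] : exists m : nat, k = l + m.+1%:Z.
  by exists (`|k - l|%N).-1; lia.
exists (ps_tau ^+ m.+1 * a); split; last by rewrite coef_tauXM.
by rewrite em rmorphM rmorphXn /= expfzDr ?tauL_neq0 // mulrA.
Qed.

Lemma lead_uniq k x c e : lead k x c -> lead k x e -> c = e.
Proof.
case=> a [-> <-] [b [/(mulfI _) h <-]].
by rewrite (@emb_inj L _ _ (h _)) // expfz_neq0 ?tauL_neq0.
Qed.

Lemma lead_inj k l x c e : c != 0 -> e != 0 -> lead k x c -> lead l x e -> k = l.
Proof.
move=> c0 e0 hk hl; case: (ltgtP k l) => // h.
  by rewrite (lead_uniq hk (lead_weak h hl)) eqxx in c0.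
by rewrite (lead_uniq hl (lead_weak h hk)) eqxx in e0.
Qed.

Lemma lead_neq0 k x c : c != 0 -> lead k x c -> x != 0.
Proof.
move=> c0 h; apply: contraNneq c0 => x0; apply/eqP; rewrite x0 in h.
exact: lead_uniq h (lead_zero k).
Qed.

Lemma lead_ex x : x != 0 -> exists k c, c != 0 /\ lead k x c.
Proof.
move=> x0; have [m [a e]] := emb_gen x.
have a0 : a != 0.
  rewrite -(raddf_eq0 _ (@emb_inj L)) /= -e mulf_neq0 // expf_neq0 //.
  exact: tauL_neq0.
have [n [s [ea s0]]] := ps_neq0P a0.
exists (n%:Z - m%:Z), (s 0%N); split=> //; exists s; split=> //.
rewrite expfzDr ?tauL_neq0 // -exprnN mulrAC.
apply: (canRL (mulfK (expf_neq0 m tauL_neq0))).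
by rewrite [x * _]e ea rmorphM rmorphXn.
Qed.

Lemma leadV k x c : c != 0 -> lead k x c -> lead (- k) x^-1 c^-1.
Proof.
move=> c0 h; have x0 := lead_neq0 c0 h.
have [l [e [e0 hl]]] := lead_ex (invr_neq0 x0).
have := leadM h hl; rewrite mulfV // => h1.
have kl : k + l = 0 by apply: (lead_inj _ _ h1 lead_one); rewrite ?mulf_neq0 ?oner_neq0.
rewrite kl in h1; have ce := lead_uniq h1 lead_one.
have -> : - k = l by lia.
by rewrite -[c^-1]mulr1 -ce mulKf.
Qed.

Definition kap c : L := emb L (psC c).

Lemma lead_kap c : lead 0 (kap c) c.
Proof. exact: lead_emb. Qed.

Lemma lead_divr k l x y c e : e != 0 -> lead k x c -> lead l y e ->
  lead (k - l) (x / y) (c / e).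
Proof. by move=> e0 h /(leadV e0); apply: leadM. Qed.

Lemma lead_rot w (sg : {rmorphism L -> L}) :
  (forall a, sg (emb L a) = emb L (rot w a)) -> w != 0 ->
  forall k x c, lead k x c -> lead k (sg x) (w ^ k * c).
Proof.
move=> sgi w0 k x c [a [-> <-]]; exists (psC (w ^ k) * rot w a).
split; last by rewrite coef_psCM /= mul1r.
rewrite rmorphM fmorphXz sgi /tauL sgi rot_tau rmorphM expfzMl rmorphM mulrA.
congr (_ * _); rewrite mulrC; congr (_ * _).
case: k => k; first by rewrite -!exprnP !rmorphXn.
have wk : psC (w ^+ k.+1) * psC (w ^+ k.+1)^-1 = 1.
  by rewrite -rmorphM mulfV ?expf_neq0 // rmorph1.
rewrite !NegzE -!exprnN; apply: (mulfI (_ : emb L (psC w) ^+ k.+1 != 0)).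
  by rewrite expf_neq0 // emb_neq0 // fmorph_eq0.
rewrite mulfV ?expf_neq0 ?emb_neq0 ?fmorph_eq0 //.
by rewrite -!rmorphXn /= -rmorphM wk rmorph1.
Qed.

Lemma lead_dil q (dl : {rmorphism L -> L}) :
  (forall a, dl (emb L a) = emb L (dilq q a)) ->
  forall k x c, lead k x c -> lead (k *+ q.+1) (dl x) c.
Proof.
move=> dli k x c [a [-> <-]]; exists (dilq q a); split; last by rewrite -[RHS](ev0_dil q).
by rewrite rmorphM fmorphXz dli /tauL dli dil_tau rmorphXn -[k *+ _]mulr_natl natz -exprz_exp.
Qed.

End LaurentField.

(** * Leading forms of polynomials over K((t)) *)

Section LeadingForms.
Variables (K : fieldType) (L : laurent K).
Implicit Types (x y z : L) (c e : K) (k l : int) (P Q : {poly L}) (A B : {poly K}).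

Lemma lead_theta (Th : {additive L -> L}) :
  (forall x y, Th (x * y) = Th x * y + x * Th y) ->
  (forall a, Th (emb L a) = emb L (theta a)) ->
  forall k x c, lead k x c -> lead k (Th x) (k%:~R * c).
Proof.
move=> ThM Thi k x c [a [-> <-]].
have Th1 : Th 1 = 0.
  by have := ThM 1 1; rewrite !mul1r mulr1 -[LHS]addr0 => /addrI <-.
have ThX n : Th (tauL L ^+ n) = tauL L ^+ n *+ n.
  elim: n => [|n IH]; first by rewrite expr0 Th1.
  rewrite exprS ThM IH Thi.
  have -> : theta ps_tau = ps_tau :> pseries K by apply: psP => -[|[|i]]; rewrite /= ?mulr0n ?mul0rn.
  by rewrite mulrnAr -mulrS.
have Thz : Th (tauL L ^ k) = tauL L ^ k *~ k.
  case: k => n; first exact: ThX.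
  rewrite NegzE -exprnN; have t0 : tauL L ^+ n.+1 != 0 by rewrite expf_neq0 ?tauL_neq0.
  have := ThM (tauL L ^- n.+1) (tauL L ^+ n.+1).
  rewrite mulVf // Th1 ThX => /esym/eqP; rewrite addr_eq0 => /eqP h.
  apply: (mulIf t0); rewrite h mulrnAr mulVf // mulrNz mulNr.
  by rewrite -pmulrn mulrnAl mulVf.
exists (PSeries (fun i => k%:~R * a i) + theta a); split; last first.
  by rewrite ps_coefD /= mulr0n addr0.
have -> : PSeries (fun i => k%:~R * a i) = a *~ k.
  apply: psP => i; rewrite /= mulrzl.
  have natc (s : pseries K) m : (s *+ m) i = s i *+ m.
    by elim: m => // m IH; rewrite !mulrS ps_coefD IH.
  case: k {Thz} => m; first by rewrite -!pmulrn natc.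
  by rewrite NegzE !mulrNz -!pmulrn ps_coefN natc.
by rewrite ThM Thz Thi rmorphD mulrDr rmorphMz mulrzAr mulrzAl.
Qed.

(** One order [k] serves all coefficients and [A] may vanish, so this is a lower bound on the orders
    together with the part at order [k]. *)
Definition leadp k P A := exists P' : {poly pseries K},
  P = tauL L ^ k *: map_poly (emb L) P' /\ map_poly (@ev0 K) P' = A.

Lemma leadp_C k x c : lead k x c -> leadp k x%:P c%:P.
Proof.
case=> a [-> <-]; exists a%:P; rewrite !map_polyC /=; split=> //.
by rewrite -mul_polyC -polyCM.
Qed.

Lemma leadp_X : leadp 0 'X 'X.
Proof. by exists 'X; rewrite !map_polyX expr0z scale1r. Qed.

Lemma leadp0 k : leadp k 0 0.
Proof. by exists 0; rewrite !rmorph0 scaler0. Qed.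

Lemma leadpD k P Q A B : leadp k P A -> leadp k Q B -> leadp k (P + Q) (A + B).
Proof. by case=> P' [-> <-] [Q' [-> <-]]; exists (P' + Q'); rewrite !rmorphD scalerDr. Qed.

Lemma leadpM k l P Q A B : leadp k P A -> leadp l Q B -> leadp (k + l) (P * Q) (A * B).
Proof.
case=> P' [-> <-] [Q' [-> <-]]; exists (P' * Q'); rewrite !rmorphM.
by rewrite expfzDr ?tauL_neq0 // -scalerAl -scalerAr scalerA.
Qed.

Lemma leadpZ k l x c P A : lead k x c -> leadp l P A -> leadp (k + l) (x *: P) (c *: A).
Proof. by move=> /leadp_C h h'; rewrite -!mul_polyC; apply: leadpM. Qed.

Lemma leadp_prod I (r : seq I) (R : pred I) (k : I -> int) (P : I -> {poly L}) (A : I -> {poly K}) :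
  (forall i, R i -> leadp (k i) (P i) (A i)) ->
  leadp (\sum_(i <- r | R i) k i) (\prod_(i <- r | R i) P i) (\prod_(i <- r | R i) A i).
Proof.
move=> h; elim: r => [|i r IH]; first by rewrite !big_nil; apply/leadp_C/lead_one.
by rewrite !big_cons; case: ifP => // /h hi; apply: leadpM.
Qed.

Lemma leadpX k P A n : leadp k P A -> leadp (k *+ n) (P ^+ n) (A ^+ n).
Proof.
move=> h; elim: n => [|n IH]; first exact/leadp_C/lead_one.
by rewrite mulrS !exprS; apply: leadpM.
Qed.

Lemma leadp_sum I (r : seq I) (R : pred I) k (P : I -> {poly L}) (A : I -> {poly K}) :
  (forall i, R i -> leadp k (P i) (A i)) ->
  leadp k (\sum_(i <- r | R i) P i) (\sum_(i <- r | R i) A i).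
Proof.
move=> h; elim: r => [|i r IH]; first by rewrite !big_nil; apply: leadp0.
by rewrite !big_cons; case: ifP => // /h hi; apply: leadpD.
Qed.

Lemma leadp_coef k P A i : leadp k P A -> lead k P`_i A`_i.
Proof. by case=> P' [-> <-]; exists P'`_i; rewrite coefZ !coef_map. Qed.

Lemma leadp_uniq k P A B : leadp k P A -> leadp k P B -> A = B.
Proof.
move=> hA hB; apply/polyP => i; exact: lead_uniq (leadp_coef i hA) (leadp_coef i hB).
Qed.

Lemma leadp_weak k l P A : l < k -> leadp k P A -> leadp l P 0.
Proof.
move=> lk [P' [-> _]]; have [m em] : exists m : nat, k = l + m.+1%:Z.
  by exists (`|k - l|%N).-1; lia.
exists (ps_tau ^+ m.+1 *: P'); split.
  by rewrite em map_polyZ rmorphXn expfzDr ?tauL_neq0 // -scalerA.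
have e0 : ev0 (ps_tau ^+ m.+1 : pseries K) = 0 by rewrite /ev0 coef_tauX.
by rewrite map_polyZ /= -/(ev0 _) e0 scale0r.
Qed.

Lemma leadp_horner k P A x c : leadp k P A -> lead 0 x c -> lead k P.[x] A.[c].
Proof.
case=> P' [-> <-] [b [-> <-]]; rewrite expr0z mul1r; exists P'.[b].
by rewrite hornerZ horner_map /= -[X in _ = X.[_]]/(map_poly (@ev0 K) P') horner_map.
Qed.

End LeadingForms.

(** * Expansions in powers of a monic polynomial and approximate roots *)

Section ApproximateRoots.
Variable R : idomainType.
Implicit Types (f g p q r a : {poly R}) (m e d : nat).

Lemma monic_division g p : g \is monic ->
  exists q r, p = q * g + r /\ (size r < size g)%N.
Proof.
move=> mg; exists (Pdiv.Ring.rdivp p g), (Pdiv.Ring.rmodp p g); split.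
  exact: Pdiv.RingMonic.rdivp_eq.
by rewrite Pdiv.Ring.ltn_rmodpN0 ?monic_neq0.
Qed.

Lemma monic_division_size g q r m e : g \is monic -> size g = e.+1 ->
  (size r <= e)%N -> (size (q * g + r)%R <= m + e)%N -> (size q <= m)%N.
Proof.
move=> mg sg sr; have [->|q0] := eqVneq q 0; first by rewrite size_poly0.
have sqg : size (q * g) = (size q + e)%N by rewrite size_Mmonic // sg addnS.
have q1 : (0 < size q)%N by rewrite size_poly_gt0.
rewrite size_polyDl sqg; first by rewrite leq_add2r.
by apply: leq_ltn_trans sr _; rewrite -[X in (X < _)%N]add0n ltn_add2r.
Qed.

Lemma monic_division_uniq g q r q' r' : g \is monic ->
  (size r < size g)%N -> (size r' < size g)%N -> q * g + r = q' * g + r' ->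
  q = q' /\ r = r'.
Proof.
move=> mg sr sr' e; have e' : (q - q') * g = r' - r.
  by apply/eqP; rewrite mulrBl subr_eq addrAC -subr_eq opprK e addrC.
suff qq : q = q' by split=> //; move: e; rewrite qq => /addrI.
apply/eqP; rewrite -subr_eq0; apply/negPn/negP => d0.
have : (size ((q - q') * g)%R < size g)%N.
  by rewrite e' (leq_ltn_trans (size_polyB_max _ _)) // gtn_max sr sr'.
rewrite size_Mmonic // ltnNge.
have : (0 < size (q - q')%R)%N by rewrite size_poly_gt0.
by case: (size (q - q')%R) => // k _; rewrite addSn leq_addl.
Qed.

(** Uniqueness of division by a monic polynomial passes the invariance under [phi] on to the digits.
    With [idfun] for [phi] this is the plain expansion. *)
Lemma adic_expansion (phi : {rmorphism R -> R}) g e m p :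
  g \is monic -> size g = e.+1 -> (size p <= m * e)%N ->
  map_poly phi g = g -> map_poly phi p = p ->
  exists b : nat -> {poly R},
    [/\ forall i, (size (b i) <= e)%N, forall i, map_poly phi (b i) = b i
      & p = \sum_(i < m) b i * g ^+ i].
Proof.
move=> mg sg sp ig; elim: m p sp => [|m IH] p sp ip.
  exists (fun=> 0); rewrite size_poly0 big_ord0; split=> // [i|].
    by rewrite rmorph0.
  by apply/eqP; rewrite -size_poly_eq0 -leqn0.
have [q [r [ep sr]]] := monic_division p mg.
have [iq ir] : map_poly phi q = q /\ map_poly phi r = r.
  apply: (monic_division_uniq mg) => //.
    by apply: leq_ltn_trans (size_poly _ _) sr.
  by rewrite -ep -[RHS]ip ep rmorphD rmorphM /= ig.
rewrite sg ltnS in sr.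
have sq : (size q <= m * e)%N.
  by apply: (monic_division_size mg sg sr); rewrite -ep addnC -mulSn.
have [b [sb ib eq]] := IH q sq iq.
exists (fun i => if i is j.+1 then b j else r); split; [by case|by case|].
rewrite big_ord_recl expr0 mulr1 ep eq mulr_suml addrC; congr (_ + _).
by apply: eq_bigr => i _; rewrite /= /bump exprSr mulrA.
Qed.

(* The bound on f - g^d expresses that the coefficient alpha_1 of the g-adic expansion of f is 0. *)
Definition aroot d e f g := [/\ g \is monic, size g = e.+1 & (size (f - g ^+ d)%R <= d.-1 * e)%N].

Lemma size_monic_exp g e n : g \is monic -> size g = e.+1 -> size (g ^+ n) = (n * e).+1.
Proof.
move=> mg sg; elim: n => [|n IH]; first by rewrite expr0 size_poly1.
by rewrite exprS size_monicM ?monic_neq0 ?monic_exp // sg IH mulSn addnS addSn.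
Qed.

Lemma size_aroot_tail d e g (al : nat -> {poly R}) : g \is monic -> size g = e.+1 ->
  (forall i, (size (al i) <= e)%N) -> al 1%N = 0 ->
  (size (\sum_(1 <= i < d.+1) al i * g ^+ (d - i))%R <= d.-1 * e)%N.
Proof.
move=> mg sg sal al1; case: d => [|d]; first by rewrite big_geq // size_poly0.
rewrite big_ltn // al1 mul0r add0r big_add1 /= big_nat; apply: (leq_trans (size_sum _ _ _)).
apply/bigmax_leqP_seq => i _ /andP[i1 id].
have [->|a0] := eqVneq (al i.+1) 0; first by rewrite mul0r size_poly0.
rewrite size_Mmonic ?monic_exp // (size_monic_exp _ mg sg) addnS /=.
apply: leq_trans (_ : e + (d.+1 - i.+1) * e <= _)%N; first by rewrite leq_add2r.
by rewrite -mulSn leq_mul2r; apply/orP; right; lia.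
Qed.

(** [g ^+ d - h ^+ d] is [g - h] times a polynomial of degree exactly [(d - 1) * e], with leading
    coefficient [d]; unless [g = h], it is too long to be a difference of two admissible
    remainders. *)
Lemma aroot_uniq d e f g h : d%:R != 0 :> R -> aroot d e f g -> aroot d e f h -> g = h.
Proof.
move=> d0 [mg sg fg] [mh sh fh]; have dp : (0 < d)%N by case: d d0 {fg fh} => //; rewrite eqxx.
pose S := \sum_(i < d) g ^+ (d.-1 - i) * h ^+ i.
have eS : g ^+ d - h ^+ d = (g - h) * S.
  by rewrite -[in LHS](prednK dp) subrXX prednK //.
have cS : S`_(d.-1 * e) = d%:R.
  rewrite coef_sum (eq_bigr (fun=> 1)) => [|i _]; first by rewrite sumr_const card_ord.
  have mm : g ^+ (d.-1 - i) * h ^+ i \is monic by rewrite monicMl monic_exp.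
  have sm : size (g ^+ (d.-1 - i) * h ^+ i) = (d.-1 * e).+1.
    rewrite size_monicM ?monic_exp ?monic_neq0 ?monic_exp //.
    rewrite (size_monic_exp _ mg sg) (size_monic_exp _ mh sh) addnS /= addSn -mulnDl subnK //.
    by have := ltn_ord i; lia.
  by have /monicP := mm; rewrite lead_coefE sm.
have sS : (d.-1 * e < size S)%N.
  by rewrite ltnNge; apply/negP => s; rewrite nth_default // in cS; rewrite -cS eqxx in d0.
apply/eqP; rewrite -subr_eq0; apply/negPn/negP => gh.
have S0 : S != 0 by apply/negP => /eqP S0; rewrite S0 size_poly0 in sS.
have : (size ((g - h) * S)%R <= d.-1 * e)%N.
  rewrite -eS; have -> : g ^+ d - h ^+ d = (f - h ^+ d) - (f - g ^+ d) by ring.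
  by apply: leq_trans (size_polyB_max _ _) _; rewrite geq_max fg fh.
rewrite size_mul // leqNgt; have gh1 : (0 < size (g - h)%R)%N by rewrite size_poly_gt0.
by case: (size (g - h)%R) gh1 => // k _; rewrite addSn /= (leq_trans sS) // leq_addl.
Qed.

(* The property [Pr] is carried along the iteration g := g + alpha_1 / d. *)
Lemma tschirnhausen d e f (dl : R) (Pr : {poly R} -> Prop) :
  (0 < d)%N -> dl * d%:R = 1 -> f \is monic -> size f = (d * e).+1 ->
  (forall g a, Pr g -> g \is monic -> size g = e.+1 -> (size a <= e)%N ->
    (size (f - g ^+ d - a * g ^+ d.-1)%R <= d.-1 * e)%N -> Pr (g + dl *: a)) ->
  forall g, Pr g -> g \is monic -> size g = e.+1 -> exists h, Pr h /\ aroot d e f h.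
Proof.
move=> d0 dl1 mf sf step g0 Pg0 mg0 sg0.
(* [m] bounds the length of the part of [f - g ^+ d] above the admissible degree; each correction
   shortens it by one. *)
suff main m : (m <= e)%N -> forall g, Pr g -> g \is monic -> size g = e.+1 ->
    (size (f - g ^+ d)%R <= d.-1 * e + m)%N -> exists h, Pr h /\ aroot d e f h.
  apply: (main e (leqnn e) g0) => //; move: g0 mg0 sg0 {Pg0} => g mg sg.
  rewrite addnC -mulSn prednK //; apply/leq_sizeP => j.
  rewrite leq_eqVlt coefB => /orP[/eqP<-|jl].
    have mgd : g ^+ d \is monic by rewrite monic_exp.
    have /monicP := mf; have /monicP := mgd.
    by rewrite !lead_coefE sf (size_monic_exp _ mg sg) /= => -> ->; rewrite subrr.
  by rewrite !nth_default ?subr0 ?sf ?(size_monic_exp _ mg sg).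
elim: m => [|m IH] me g Pg mg sg sfg {g0 Pg0 mg0 sg0}.
  by exists g; split=> //; split=> //; rewrite addn0 in sfg.
have mgd : g ^+ d.-1 \is monic by rewrite monic_exp.
have sgd := size_monic_exp d.-1 mg sg.
have [a [r [ea sr]]] := monic_division (f - g ^+ d) mgd; rewrite sgd ltnS in sr.
have sa : (size a <= m.+1)%N.
  by apply: (monic_division_size mgd sgd sr); rewrite -ea addnC.
have er : f - g ^+ d - a * g ^+ d.-1 = r by rewrite ea addrC addKr.
have sda : (size (dl *: a) <= m.+1)%N by apply: leq_trans (size_scale_leq _ _) sa.
have mg' : g + dl *: a \is monic /\ size (g + dl *: a) = e.+1.
  have sl : (size (dl *: a) < size g)%N by rewrite sg ltnS (leq_trans sda).
  by rewrite monicE lead_coefDl // size_polyDl //; split=> //; exact/eqP/monicP.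
apply: (IH (ltnW me) (g + dl *: a)); [|exact: mg'.1|exact: mg'.2|].
  by apply: step => //; [exact: leq_trans sa me | rewrite er].
(* The linear term of the binomial expansion cancels [a * g ^+ d.-1], since [dl] inverts [d]. The
   other terms contain at least the square of [a], of degree at most [m < e], and are short
   enough. *)
have -> : f - (g + dl *: a) ^+ d =
    r - \sum_(i < d.-1) g ^+ (d - i.+2) * (dl *: a) ^+ i.+2 *+ 'C(d, i.+2).
  suff -> : (g + dl *: a) ^+ d = g ^+ d + a * g ^+ d.-1 +
      \sum_(i < d.-1) g ^+ (d - i.+2) * (dl *: a) ^+ i.+2 *+ 'C(d, i.+2).
    by rewrite -er !opprD !addrA.
  case: (d) d0 dl1 => // k _ dlk; rewrite exprDn big_ord_recl big_ord_recl -addrA /=.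
  rewrite subn0 expr0 mulr1 bin0 mulr1n; congr (_ + _); congr (_ + _).
  rewrite /bump /= add1n subn1 /= expr1 bin1 -scalerAr -scaler_nat scalerA.
  by rewrite mulrC dlk scale1r mulrC.
apply: leq_trans (size_polyB_max _ _) _; rewrite geq_max (leq_trans sr) ?leq_addr //=.
apply: leq_trans (size_sum _ _ _) _; apply/bigmax_leqP => i _.
have id := ltn_ord i.
rewrite -scaler_nat (leq_trans (size_scale_leq _ _)) //.
apply: leq_trans (size_polyMleq _ _) _; rewrite (size_monic_exp _ mg sg) addSn /=.
have h := size_poly_exp_leq (dl *: a) i.+2.
apply: leq_trans (_ : (d - i.+2) * e + (m * i.+2).+1 <= _)%N.
  rewrite leq_add2l; apply: leq_trans h _; rewrite ltnS leq_mul2r.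
  by apply/orP; right; case: (size _) sda.
have hk : (d.-1 = (d - i.+2) + i.+1)%N by lia.
have hm : (m.+1 * i.+1 <= e * i.+1)%N by rewrite leq_mul2r me orbT.
move: hk hm; move: (d - i.+2)%N (d.-1) (nat_of_ord i) => k c j -> hm.
by rewrite mulnDl; nia.
Qed.

End ApproximateRoots.

Lemma big_ord_blocks (R : Type) (idx : R) (op : Monoid.law idx) (m n : nat) (F : nat -> R) :
  \big[op/idx]_(k < m * n) F k =
  \big[op/idx]_(l < m) \big[op/idx]_(j < n) F (l * n + j)%N.
Proof.
elim: m F => [|m IH] F; first by rewrite !big_ord0.
rewrite mulSn big_split_ord big_ord_recl /=; congr (op _ _).
rewrite (IH (fun k => F (n + k)%N)); apply: eq_bigr => l _.
by apply: eq_bigr => j _; rewrite /bump mulSn addnA.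
Qed.

Section PrimitiveRoots.
Variables (K : fieldType) (n : nat) (w : K).
Hypothesis w_prim : n.-primitive_root w.

Lemma prim_n_gt0 : (0 < n)%N.
Proof. exact: prim_order_gt0 w_prim. Qed.

Lemma prim_neq0 : w != 0.
Proof.
apply/eqP => w0; have := prim_expr_order w_prim.
by rewrite w0 expr0n; case: n prim_n_gt0 => // k _ /eqP; rewrite eq_sym oner_eq0.
Qed.

Lemma prim_exprz k : w ^ k = 1 -> (n%:Z %| k)%Z.
Proof.
case: k => k; rewrite ?NegzE.
  by move=> e; rewrite dvdzE (prim_order_dvd w_prim) -[w ^+ _]/(w ^ k%:Z) e.
rewrite -exprnN => e; rewrite dvdzE abszN (prim_order_dvd w_prim).
by rewrite -[w ^+ _]invrK e invr1.
Qed.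

End PrimitiveRoots.

Section Lagrange.
Variable F : fieldType.

Lemma lagrange N (z : nat -> F) (P : {poly F}) :
  (forall i j, (i < N)%N -> (j < N)%N -> z i = z j -> i = j) ->
  (size P <= N)%N ->
  P = \sum_(j < N) (P.[z j] / (\prod_(i < N | i != j) (z j - z i))) *:
        \prod_(i < N | i != j) ('X - (z i)%:P).
Proof.
move=> zinj sP; set Q := \sum_(j < N) _; apply/eqP; rewrite -subr_eq0.
apply/negPn/negP => PQ0; pose rs := [seq z i | i <- iota 0 N].
have urs : uniq rs.
  rewrite map_inj_in_uniq ?iota_uniq // => i j; rewrite !mem_iota => /andP[_ iN] /andP[_ jN].
  exact: zinj.
have hQ (k : 'I_N) : Q.[z k] = P.[z k].
  rewrite horner_sum (bigD1 k) //= [X in _ + X]big1 ?addr0 => [|j jk].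
    rewrite hornerZ horner_prod.
    have -> : \prod_(i < N | i != k) ('X - (z i)%:P).[z k] = \prod_(i < N | i != k) (z k - z i).
      by apply: eq_bigr => i _; rewrite hornerXsubC.
    rewrite divfK //; apply/prodf_neq0 => i ik; rewrite subr_eq0.
    by apply: contra ik => /eqP/zinj e; apply/eqP/val_inj/esym/e.
  rewrite hornerZ [X in _ * X](_ : _ = 0) ?mulr0 //.
  by rewrite horner_prod (bigD1 k) 1?eq_sym //= hornerXsubC subrr mul0r.
have ars : all (root (P - Q)) rs.
  apply/allP => r /mapP[i]; rewrite mem_iota add0n => /andP[_ iN] ->.
  by rewrite rootE hornerD hornerN (hQ (Ordinal iN)) subrr.
have := max_poly_roots PQ0 ars urs; rewrite size_map size_iota ltnNge.
rewrite (leq_trans (size_polyB_max _ _)) // geq_max sP /=.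
apply: leq_trans (size_sum _ _ _) _; apply/bigmax_leqP => j _.
apply: leq_trans (size_scale_leq _ _) _.
apply: leq_trans (size_poly_prod_leq _ _) _.
under eq_bigr do rewrite size_XsubC.
rewrite sum_nat_const (eq_card (_ : _ =i predC1 j)) // cardC1 card_ord.
by have := ltn_ord j; lia.
Qed.

End Lagrange.

(** * Reading the orders of digits off the leading form of a sum *)

Section LowForms.
Variables (K : fieldType) (L : laurent K).
Implicit Types (Q G : {poly L}) (k e t : int) (C c : K).

(** The shape that [level_low] gives to polynomials of small degree: around a truncated branch,
    their leading form does not involve the variable. *)
Definition low_form Q := Q = 0 \/ exists k c, c != 0 /\ leadp k Q c%:P.

Lemma low_form_up Q k : low_form Q -> leadp k Q 0 -> exists c, leadp (k + 1) Q c%:P.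
Proof.
case=> [->|[k0 [c0 [c00 h0]]]] h; first by exists 0; apply: leadp0.
have kk0 : k < k0.
  rewrite ltNge; apply/negP; rewrite le_eqVlt => /orP[/eqP e|lt].
    by move: (leadp_uniq h0 (eq_ind_r (fun l => leadp l Q 0) h e)) => /eqP; rewrite polyC_eq0 (negbTE c00).
  by move: (leadp_uniq h0 (leadp_weak lt h)) => /eqP; rewrite polyC_eq0 (negbTE c00).
have [e|ne] := eqVneq (k + 1) k0; first by exists c0; rewrite e.
by exists 0; apply: leadp_weak h0; lia.
Qed.

Lemma low_form_start Q : low_form Q -> exists t, forall k, k <= t -> exists c, leadp k Q c%:P.
Proof.
case=> [->|[k0 [c0 [_ h0]]]]; first by exists 0 => k _; exists 0; apply: leadp0.
exists k0 => k; rewrite le_eqVlt => /orP[/eqP->|lt]; first by exists c0.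
by exists 0; apply: leadp_weak h0.
Qed.

(** The digits have constant forms and [G] has the form of a multiple of ['X], so distinct terms
    contribute to distinct powers of the variable and cannot cancel. *)
Lemma form_digits G C (kp e : int) m (al : nat -> {poly L}) A :
  C != 0 -> leadp kp G (C *: 'X) -> (forall i, (i < m)%N -> low_form (al i)) ->
  leadp e (\sum_(i < m) al i * G ^+ i) A ->
  forall i, (i < m)%N -> leadp (e - kp *+ i) (al i) (A`_i / C ^+ i)%:P.
Proof.
move=> C0 hG low hS.
have /choice[t ht] : forall i, exists t, (i < m)%N -> forall k, k <= t -> exists c, leadp k (al i) c%:P.
  move=> i; have [im|_] := boolP (i < m)%N; last by exists 0.
  by have [t ht] := low_form_start (low i im); exists t.
have sumform M (c : nat -> K) :
    (forall i, (i < m)%N -> leadp (e - M%:Z - kp *+ i) (al i) (c i)%:P) ->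
    leadp (e - M%:Z) (\sum_(i < m) al i * G ^+ i) (\poly_(i < m) (c i * C ^+ i)).
  move=> h; rewrite poly_def; apply: leadp_sum => i _.
  have -> : (c i * C ^+ i) *: 'X^i = (c i)%:P * (C *: 'X) ^+ i.
    by rewrite exprZn -scalerA mul_polyC.
  have := leadpM (h i (ltn_ord i)) (leadpX i hG); rewrite subrK; exact.
(* As long as the total order is below [e], the sum has zero form there, hence so has each digit,
   and all orders can be raised by one. *)
have desc M : (forall i, (i < m)%N -> exists c, leadp (e - M%:Z - kp *+ i) (al i) c%:P) ->
    forall i, (i < m)%N -> exists c, leadp (e - kp *+ i) (al i) c%:P.
  elim: M => [|M IH] h; first by move=> i im; have := h i im; rewrite subr0.
  apply: IH => i im; have /choice[c hc] : forall i, exists c, (i < m)%N -> leadp (e - M.+1%:Z - kp *+ i) (al i) c%:P.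
    move=> j; have [/h[c hc]|_] := boolP (j < m)%N; [by exists c | by exists 0].
  have h1 := sumform M.+1 c hc.
  have h2 : leadp (e - M.+1%:Z) (\sum_(i < m) al i * G ^+ i) 0 by apply: leadp_weak hS; lia.
  have := congr1 (fun p : {poly K} => p`_i) (leadp_uniq h1 h2).
  rewrite coef_poly im coef0 => /eqP; rewrite mulf_eq0 expf_eq0 (negbTE C0) andbF orbF => /eqP ci.
  have := hc i im; rewrite ci polyC0 => /(low_form_up (low i im))[c' hc']; exists c'.
  by have -> : e - M%:Z - kp *+ i = e - M.+1%:Z - kp *+ i + 1 by lia.
(* A starting point low enough for every digit; any larger number would serve as well. *)
pose M := (\sum_(i < m) absz (e - kp *+ i - t i)%R)%N.
have start i : (i < m)%N -> exists c, leadp (e - M%:Z - kp *+ i) (al i) c%:P.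
  move=> im; apply: ht => //.
  have : (absz (e - kp *+ i - t i)%R <= M)%N by rewrite /M (bigD1 (Ordinal im)) //= leq_addr.
  move: M (kp *+ i) (t i) => M' a b; lia.
have fin := desc M start.
have /choice[c hc] : forall i, exists c, (i < m)%N -> leadp (e - 0%:Z - kp *+ i) (al i) c%:P.
  move=> j; have [/fin[c hc]|_] := boolP (j < m)%N; last by exists 0.
  by exists c; rewrite subr0.
have := sumform 0%N c hc; rewrite subr0 => /(leadp_uniq hS) -> i im.
rewrite coef_poly im mulfK ?expf_neq0 //.
by have := hc i im; rewrite subr0.
Qed.

End LowForms.

(** * Leading forms around the branch truncated at a characteristic exponent *)

Section Level.
Variables (K : closedFieldType) (L : laurent K).
Hypothesis charK0 : [pchar K] =i pred0.
Variables (n : nat) (w : K) (sg : {rmorphism L -> L}) (s : pseries K).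
Hypothesis w_prim : n.-primitive_root w.
Hypothesis sgE : forall a, sg (emb L a) = emb L (rot w a).

(* sg is t -> w t, which fixes x = t^-n; Sk k is the k-th conjugate of y = x s(t). *)
Definition xL : L := tauL L ^ (- n%:Z).
Definition Sk k : L := iter k sg (xL * emb L s).

Lemma sg_xL : sg xL = xL.
Proof.
rewrite fmorphXz /tauL sgE rot_tau rmorphM expfzMl -exprnN -rmorphXn -rmorphXn /=.
by rewrite (prim_expr_order w_prim) !rmorph1 invr1 mul1r.
Qed.

Lemma iter_sg k a : iter k sg (xL * emb L a) = xL * emb L (rot (w ^+ k) a).
Proof.
elim: k => [|k IH] /=; first by rewrite rot1.
by rewrite IH rmorphM sg_xL sgE rot_comp exprS.
Qed.

Lemma lead_iter_sg j k z c : lead k z c -> lead k (iter j sg z) ((w ^ k) ^+ j * c).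
Proof.
move=> h; elim: j => [|j IH]; first by rewrite mul1r.
by rewrite exprS -mulrA; apply: (lead_rot sgE (prim_neq0 w_prim)).
Qed.

Lemma lead_xL a b : ps_vanish b a -> lead (b%:Z - n%:Z) (xL * emb L a) (a b).
Proof.
move=> va; exists (ps_shift b a); split; last by rewrite /= add0n.
rewrite {1}(ps_shiftK va) rmorphM rmorphXn /= mulrA addrC expfzDr ?tauL_neq0 //.
Qed.

Lemma horner_iter_sg P j z : map_poly sg P = P -> P.[iter j sg z] = iter j sg P.[z].
Proof. by move=> iP; elim: j => //= j IH; rewrite -IH -{1}iP horner_map. Qed.

Variables (b d N : nat).
Hypothesis d_gt0 : (0 < d)%N.
Hypothesis nE : n = (d * N)%N.
Hypothesis supp_lt : forall i, (i < b)%N -> s i != 0 -> (d %| i)%N.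
Hypothesis s_b : s b != 0.
Hypothesis d_ndvd_b : ~~ (d %| b)%N.
Hypothesis supp_gen : forall j, (forall i, (i < b)%N -> s i != 0 -> (n %| i * j)%N) -> (N %| j)%N.

Let N_gt0 : (0 < N)%N.
Proof. by have := prim_n_gt0 w_prim; rewrite nE muln_gt0 => /andP[]. Qed.

Definition beta : int := b%:Z - n%:Z.
(** Its exponents are multiples of [d], so the truncated branch has [N = n / d] distinct conjugates,
    each shared by [d] conjugates of the full branch. *)
Definition eta0 : pseries K := PSeries (fun i => if (i < b)%N then s i else 0).
Definition etaj j : L := iter j sg (xL * emb L eta0).

Lemma eta_period j : (N %| j)%N -> etaj j = etaj 0.
Proof.
case/dvdnP=> q ->; rewrite /etaj !iter_sg rot1; congr (_ * emb L _).
apply: psP => i /=; case: ifP => [ib|_]; last by rewrite mulr0.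
have [->|si] := eqVneq (s i) 0; first by rewrite mulr0.
have /dvdnP[l ->] := supp_lt ib si.
rewrite -exprM -mulnA [(l * d)%N]mulnC [(N * _)%N]mulnA [(N * d)%N]mulnC -nE mulnCA.
by rewrite exprM (prim_expr_order w_prim) expr1n mul1r.
Qed.

Lemma eta_mod j : etaj j = etaj (j %% N).
Proof.
rewrite {1}(divn_eq j N) addnC /etaj iterD; congr (iter _ _ _).
by apply: eta_period; rewrite dvdn_mull.
Qed.

(** By [supp_gen] the rotation moves some coefficient below [b]; the first exponent where it does
    gives the contact order. That exponent lies in the support, hence is divisible by [d]. *)
Lemma eta_sep j : ~~ (N %| j)%N ->
  exists k c, [/\ k < beta, c != 0, (d %| k)%Z & lead k (etaj 0 - etaj j) c].
Proof.
move=> nNj; pose u := eta0 - rot (w ^+ j) eta0.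
have eu : etaj 0 - etaj j = xL * emb L u by rewrite /etaj !iter_sg rot1 rmorphB mulrBr.
have [i [ib si ni]] : exists i, [/\ (i < b)%N, s i != 0 & ~~ (n %| i * j)%N].
  apply: contrapT => h; case/negP: nNj; apply: supp_gen => i ib si.
  by have [//|ni] := boolP (n %| i * j)%N; case: h; exists i.
have ui : u i != 0.
  rewrite /u ps_coefB /= ib -{1}[s i]mul1r -mulrBl mulf_neq0 // subr_eq0 eq_sym.
  by rewrite -exprM mulnC -(prim_order_dvd w_prim).
have u0 : u != 0 by apply: contraNneq ui => ->.
have [m [v [ev v0]]] := ps_neq0P u0.
have um : u m = v 0%N by rewrite ev coef_tauXM ltnn subnn.
have vm : ps_vanish m u by move=> l lm; rewrite ev coef_tauXM lm.
have um0 : u m != 0 by rewrite um.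
have mb : (m < b)%N.
  by apply: contraNT um0; rewrite /u ps_coefB /= => /negbTE ->; rewrite mulr0 subrr.
have dm : (d %| m)%N.
  apply: supp_lt => //; apply: contraNneq um0; rewrite /u ps_coefB /= mb => ->.
  by rewrite mulr0 subrr.
exists (m%:Z - n%:Z), (u m); split=> //; last by rewrite eu; apply: lead_xL.
  by rewrite /beta ltrD2r.
by rewrite rpredB //= ?dvdzE //= nE dvdn_mulr.
Qed.

Lemma Sk_eta k : lead beta (Sk k - etaj k) ((w ^+ (k * b)) * s b).
Proof.
have -> : Sk k - etaj k = iter k sg (xL * emb L (s - eta0)).
  by rewrite /Sk /etaj !iter_sg !rmorphB mulrBr.
rewrite iter_sg; have -> : w ^+ (k * b) * s b = rot (w ^+ k) (s - eta0) b.
  by rewrite /= ltnn subr0 exprM.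
by apply: lead_xL => i ib; rewrite /= ib subrr mulr0.
Qed.

Lemma eta_choice : exists kk : nat -> int, exists cc : nat -> K,
  forall j, ~~ (N %| j)%N ->
  [/\ kk j < beta, cc j != 0, (d %| kk j)%Z & lead (kk j) (etaj 0 - etaj j) (cc j)].
Proof.
have /choice[kc hkc] : forall j, exists kc : int * K, ~~ (N %| j)%N ->
  [/\ kc.1 < beta, kc.2 != 0, (d %| kc.1)%Z & lead kc.1 (etaj 0 - etaj j) kc.2].
  move=> j; have [Nj|/eta_sep[k [c h]]] := boolP (N %| j)%N; first by exists (0, 0).
  by exists (k, c).
by exists (fst \o kc), (snd \o kc).
Qed.

Variables (kk : nat -> int) (cc : nat -> K).
Hypothesis kcP : forall j, ~~ (N %| j)%N ->
  [/\ kk j < beta, cc j != 0, (d %| kk j)%Z & lead (kk j) (etaj 0 - etaj j) (cc j)].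

Lemma kcP' (j : 'I_N) : j != 0%N :> nat ->
  [/\ kk j < beta, cc j != 0, (d %| kk j)%Z & lead (kk j) (etaj 0 - etaj j) (cc j)].
Proof. by move=> j0; apply: kcP; rewrite gtnNdvd // lt0n. Qed.

(* Leading forms are taken around the truncation etaj 0 of the branch y at the exponent b. *)
Definition frm P := P \Po (tauL L ^ beta *: 'X + (etaj 0)%:P).

Lemma frm_XsubC z : frm ('X - z%:P) = tauL L ^ beta *: 'X + (etaj 0 - z)%:P.
Proof. by rewrite /frm comp_polyB comp_polyX comp_polyC polyCB addrA. Qed.

Lemma frm_prod I (r : seq I) (R : pred I) (P : I -> {poly L}) :
  frm (\prod_(i <- r | R i) P i) = \prod_(i <- r | R i) frm (P i).
Proof. exact: (big_morph frm (fun p q => comp_polyM p q _) (comp_polyC _ _)). Qed.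

Lemma frm_near z e : lead beta (etaj 0 - z) (- e) ->
  leadp beta (frm ('X - z%:P)) ('X - e%:P).
Proof.
move=> /leadp_C h; rewrite frm_XsubC -polyCN; apply: leadpD h.
by have := leadpZ (lead_tau L beta) (leadp_X L); rewrite addr0 scale1r.
Qed.

Lemma frm_far k z c : k < beta -> lead k (etaj 0 - z) c -> leadp k (frm ('X - z%:P)) c%:P.
Proof.
move=> kb /leadp_C h; rewrite frm_XsubC -[c%:P]add0r; apply: leadpD h.
apply: (@leadp_weak _ _ _ _ _ 'X kb).
by have := leadpZ (lead_tau L beta) (leadp_X L); rewrite addr0 scale1r.
Qed.

(** The order at which the form of a block of [N] conjugates lives: one factor at order [beta], the
    others at their contact orders with the truncation. *)
Definition kappa : int := beta + \sum_(j < N | j != 0%N :> nat) kk j.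
Definition cst : K := \prod_(j < N | j != 0%N :> nat) cc j.

Lemma cst_neq0 : cst != 0.
Proof. by apply/prodf_neq0 => j /kcP'[]. Qed.

Lemma frm_block (z : nat -> L) e : lead beta (etaj 0 - z 0%N) (- e) ->
  (forall j : 'I_N, j != 0%N :> nat -> lead (kk j) (etaj 0 - z j) (cc j)) ->
  leadp kappa (frm (\prod_(j < N) ('X - (z j)%:P))) (cst *: ('X - e%:P)).
Proof.
move=> h0 hj; rewrite frm_prod (bigD1 (Ordinal N_gt0)) //= -mul_polyC [cst%:P * _]mulrC.
apply: leadpM; first exact: frm_near.
rewrite /cst rmorph_prod; apply: leadp_prod => j j0.
by apply: frm_far; [case: (kcP' j0) | apply: hj].
Qed.

(** The minimal polynomial of the truncated branch over the Laurent series in [x^-1]; the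
    Tschirnhausen iteration starts from it. *)
Definition Phat : {poly L} := \prod_(j < N) ('X - (etaj j)%:P).

Lemma frm_Phat : leadp kappa (frm Phat) (cst *: 'X).
Proof.
rewrite -['X]subr0 -polyC0; apply: (@frm_block etaj); last by move=> j /kcP'[].
by rewrite subrr oppr0; apply: lead_zero.
Qed.

Lemma Sk_far k : ~~ (N %| k)%N -> lead (kk (k %% N)) (etaj 0 - Sk k) (cc (k %% N)).
Proof.
move=> nk; have nk' : ~~ (N %| k %% N)%N.
  by rewrite /dvdn modn_mod.
have [kb _ _ h] := kcP nk'; rewrite -eta_mod in h.
have -> : etaj 0 - Sk k = (etaj 0 - etaj k) - (Sk k - etaj k) by ring.
by rewrite -[cc _]subr0; apply: leadB h (lead_weak kb (Sk_eta k)).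
Qed.

Lemma Sk_near k : (N %| k)%N -> lead beta (etaj 0 - Sk k) (- (w ^+ (k * b) * s b)).
Proof. by move=> Nk; rewrite -opprB -(eta_period Nk); apply/leadN/Sk_eta. Qed.

(** The factor by which the coefficient at exponent [b] changes when the branch is conjugated [N]
    times, an operation that fixes its truncation. *)
Definition omega := w ^+ (N * b).
Definition Fform : {poly K} := \prod_(l < d) ('X - (omega ^+ l * s b)%:P).

(** The [n] conjugates fall into [d] consecutive blocks of length [N]; in each, one factor is near
    the truncation and the others contribute the constant [cst]. *)
Lemma frm_F : leadp (kappa *+ d) (frm (\prod_(k < n) ('X - (Sk k)%:P))) (cst ^+ d *: Fform).
Proof.
rewrite nE (big_ord_blocks _ d N (fun k => 'X - (Sk k)%:P)) frm_prod.
have -> : cst ^+ d *: Fform = \prod_(l < d) (cst *: ('X - (omega ^+ l * s b)%:P)).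
  by rewrite scaler_prod prodr_const card_ord.
have -> : kappa *+ d = \sum_(l < d) kappa by rewrite sumr_const card_ord.
apply: leadp_prod => l _; apply: (@frm_block (fun j => Sk (l * N + j)%N)).
  rewrite addn0 /omega -exprM mulnAC [(N * l)%N]mulnC.
  by apply: Sk_near; rewrite dvdn_mull.
move=> j j0; have := @Sk_far (l * N + j)%N.
rewrite modnMDl modn_small //; apply; rewrite dvdn_addr ?dvdn_mull //.
by rewrite gtnNdvd // lt0n.
Qed.

Lemma d_gt1 : (1 < d)%N.
Proof. by case: d d_gt0 d_ndvd_b => [|[|]] //; rewrite dvd1n. Qed.

Definition Froots := [seq omega ^+ l * s b | l <- iota 0 d].

Lemma Fform_seq : Fform = \prod_(p <- Froots) ('X - p%:P).
Proof. by rewrite big_map -[d in iota 0 d]subn0 big_mkord. Qed.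

(** [omega] differs from 1 because [d] does not divide [b], while its [d]-th power is 1; so its
    powers sum to zero. This keeps the Tschirnhausen corrections from touching the leading form. *)
Lemma Fform_coef : Fform`_d.-1 = 0.
Proof.
rewrite Fform_seq; set ps := Froots.
have sps : size ps = d by rewrite size_map size_iota.
rewrite -{1}sps coefPn_prod_XsubC ?sps -?lt0n // big_map -[d in iota 0 d]subn0 big_mkord.
rewrite -mulr_suml; apply/eqP; rewrite oppr_eq0 mulf_eq0 (negbTE s_b) orbF.
have o1 : omega - 1 != 0.
  rewrite subr_eq0 -(prim_order_dvd w_prim) nE mulnC dvdn_pmul2l //.
rewrite -(mulrI_eq0 _ (mulfI o1)) -subrX1 /omega -exprM.
have -> : (N * b * d = n * b)%N by rewrite nE; lia.
by rewrite exprM (prim_expr_order w_prim) expr1n subrr.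
Qed.

Lemma frmD P Q : frm (P + Q) = frm P + frm Q.
Proof. exact: comp_polyD. Qed.

Lemma frmM P Q : frm (P * Q) = frm P * frm Q.
Proof. exact: comp_polyM. Qed.

Lemma frmZ c P : frm (c *: P) = c *: frm P.
Proof. exact: comp_polyZ. Qed.

Lemma frm_sum I (r : seq I) (R : pred I) (P : I -> {poly L}) :
  frm (\sum_(i <- r | R i) P i) = \sum_(i <- r | R i) frm (P i).
Proof. exact: (big_morph frm frmD (comp_polyC _ _)). Qed.

Lemma frmX P k : frm (P ^+ k) = frm P ^+ k.
Proof. by elim: k => [|k IH]; rewrite ?exprS ?frmM ?IH // /frm comp_polyC. Qed.

Lemma Phat_inv : map_poly sg Phat = Phat.
Proof.
rewrite /Phat rmorph_prod.
under eq_bigr => j _ do rewrite /= map_polyXsubC /= -[sg (etaj j)]/(etaj j.+1).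
rewrite -(prednK N_gt0) big_ord_recr [RHS]big_ord_recl [LHS]mulrC; congr (_ * _).
by congr ('X - _%:P); rewrite [etaj _](@eta_period N.-1.+1) // prednK // dvdnn.
Qed.

Lemma Phat_monic : Phat \is monic /\ size Phat = N.+1.
Proof.
have -> : Phat = \prod_(p <- [seq etaj j | j <- iota 0 N]) ('X - p%:P).
  by rewrite big_map -[N in iota 0 N]subn0 big_mkord.
by rewrite monic_prod_XsubC size_prod_XsubC size_map size_iota.
Qed.

Lemma etaj_inj i j : (i < N)%N -> (j < N)%N -> etaj i = etaj j -> i = j.
Proof.
have aux k l : (k < l < N)%N -> etaj k <> etaj l.
  case/andP=> kl lN e; have : etaj 0 = etaj (l - k).
    have iinj m : injective (iter m sg) by elim: m => // m IH x y /fmorph_inj/IH.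
    apply: (iinj k); rewrite [LHS]e -[in LHS](subnKC (ltnW kl)).
    by rewrite /etaj iterD.
  have /eta_sep[m [c [_ c0 _ h]]] : ~~ (N %| l - k)%N.
    by rewrite gtnNdvd ?subn_gt0 //; apply: leq_ltn_trans (leq_subr _ _) lN.
  by move=> e'; have := lead_neq0 c0 h; rewrite -e' subrr eqxx.
move=> iN jN e; case: (ltngtP i j) => // h.
  by case: (aux i j) => //; rewrite h.
by case: (aux j i) => //; rewrite h.
Qed.

Let kap' : int := \sum_(j < N | j != 0%N :> nat) kk j.

(** The denominators of the interpolation are values of the derivative of [Phat], which [sg] fixes;
    they are conjugate and share one order. *)
Lemma lead_den (j : 'I_N) : exists c, c != 0 /\
  lead kap' (\prod_(i < N | i != j) (etaj j - etaj i)) c.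
Proof.
have den (i : 'I_N) : \prod_(l < N | l != i) (etaj i - etaj l) = Phat^`().[etaj i].
  rewrite /Phat [in RHS](bigD1 i) //= derivM hornerD !hornerM derivXsubC hornerXsubC subrr.
  rewrite mul0r addr0 hornerC mul1r horner_prod.
  by apply: eq_bigr => l _; rewrite hornerXsubC.
rewrite den; have iP : map_poly sg Phat^`() = Phat^`() by rewrite -deriv_map Phat_inv.
rewrite (horner_iter_sg _ _ iP); have := den (Ordinal N_gt0); rewrite /= => <-.
exists ((w ^ kap') ^+ j * cst); split.
  by rewrite mulf_neq0 ?cst_neq0 // expf_neq0 // expfz_neq0 // (prim_neq0 w_prim).
by apply: lead_iter_sg; apply: lead_prod => i i0; case: (kcP' i0).
Qed.

(** For [j] other than 0 the numerator contains the factor of index 0, of order [beta], in place of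
    the factor of index [j], of order [kk j < beta]; so nothing is left at order [kap']. *)
Lemma leadp_numer (j : 'I_N) :
  leadp kap' (frm (\prod_(i < N | i != j) ('X - (etaj i)%:P)))
    (if j == 0%N :> nat then cst%:P else 0).
Proof.
rewrite frm_prod; case: eqP => [j0|/eqP j0].
  have -> : \prod_(i < N | i != j) frm ('X - (etaj i)%:P) =
            \prod_(i < N | i != 0%N :> nat) frm ('X - (etaj i)%:P).
    by apply: eq_bigl => i; rewrite -j0.
  rewrite /cst rmorph_prod; apply: leadp_prod => i i0.
  by have [kb _ _ h] := kcP' i0; apply: frm_far.
have j0' : Ordinal N_gt0 != j by apply: contraNneq j0 => <-.
rewrite (bigD1 (Ordinal N_gt0)) //=.
have h0 : leadp beta (frm ('X - (etaj 0)%:P)) ('X - 0%:P).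
  by apply: frm_near; rewrite subrr oppr0; apply: lead_zero.
have h1 : leadp (\sum_(i < N | (i != j) && (i != Ordinal N_gt0)) kk i)
    (\prod_(i < N | (i != j) && (i != Ordinal N_gt0)) frm ('X - (etaj i)%:P))
    (\prod_(i < N | (i != j) && (i != Ordinal N_gt0)) (cc i)%:P).
  apply: leadp_prod => i /andP[_ i0]; have {}i0 : i != 0%N :> nat by [].
  by have [kb _ _ h] := kcP' i0; apply: frm_far.
apply: leadp_weak (leadpM h0 h1).
rewrite /kap' (bigD1 j) //=; have [kb _ _ _] := kcP' j0.
rewrite [X in _ + X](eq_bigl (fun i : 'I_N => (i != j) && (i != Ordinal N_gt0))).
  by rewrite ltrD2r.
by move=> i; rewrite andbC.
Qed.

(** Interpolation at the conjugates of the truncation: the values of [P] there are conjugate, hence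
    of one order [k], and only the term of index 0 survives in the leading form. As [etaj 0] has
    period [N], [w ^ (k * N) = 1], which with [n = d * N] gives that [d] divides [k]. *)
Lemma level_low P : map_poly sg P = P -> (size P <= N)%N -> P != 0 ->
  exists k c, [/\ c != 0, (d %| k)%Z & leadp k (frm P) c%:P].
Proof.
move=> iP sP P0; have := lagrange etaj_inj sP; set p := P.[etaj 0].
have ep j : P.[etaj j] = iter j sg p by rewrite -horner_iter_sg.
move=> eP; have p0 : p != 0.
  apply: contraNneq P0 => p0; rewrite eP big1 // => j _.
  rewrite ep p0; have -> : iter j sg 0 = 0 :> L by elim: (nat_of_ord j) => //= k ->; rewrite rmorph0.
  by rewrite mul0r scale0r.
have [k [c [c0 hk]]] := lead_ex p0; exists k, c; split=> //.
  have h := lead_iter_sg N hk; rewrite -ep eta_period ?dvdnn // -/p in h.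
  have e := lead_uniq hk h; have wk : w ^ (k * N%:Z) = 1.
    by rewrite -exprz_exp; apply: (mulIf c0); rewrite mul1r; exact: esym e.
  have /dvdzP[q] := prim_exprz w_prim wk.
  rewrite nE PoszM mulrA => /mulIf kq; apply/dvdzP; exists q; apply: kq.
  by rewrite eqz_nat -lt0n.
have -> : frm P = \sum_(j < N) (P.[etaj j] / \prod_(i < N | i != j) (etaj j - etaj i)) *:
    frm (\prod_(i < N | i != j) ('X - (etaj i)%:P)).
  by rewrite {1}eP frm_sum; apply: eq_bigr => j _; rewrite frmZ.
have -> : c%:P = \sum_(j < N) (if j == 0%N :> nat then c%:P else 0).
  rewrite (bigD1 (Ordinal N_gt0)) //= big1 ?addr0 // => j j0.
  by rewrite ifF //; apply: contraNF j0 => /eqP j0; apply/eqP/val_inj.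
apply: leadp_sum => j _; have [e [e0 he]] := lead_den j.
have := leadpZ (lead_divr e0 (lead_iter_sg j hk) he) (leadp_numer j).
rewrite subrK -ep; case: eqP => [j0|_]; last by rewrite scaler0.
rewrite j0 expr0 mul1r; suff -> : (c / e) *: cst%:P = c%:P by [].
have h0 : lead kap' (\prod_(i < N | i != j) (etaj j - etaj i)) cst.
  rewrite j0; rewrite (eq_bigl (fun i : 'I_N => i != 0%N :> nat)); last by move=> i; rewrite -j0.
  by apply: lead_prod => i i0; case: (kcP' i0).
by rewrite (lead_uniq he h0) -mul_polyC -polyCM divfK ?cst_neq0.
Qed.

Definition conj_prod : {poly L} := \prod_(k < n) ('X - (Sk k)%:P).

Lemma conj_prod_monic : conj_prod \is monic /\ size conj_prod = n.+1.
Proof.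
have -> : conj_prod = \prod_(p <- [seq Sk j | j <- iota 0 n]) ('X - p%:P).
  by rewrite big_map -[n in iota 0 n]subn0 big_mkord.
by rewrite monic_prod_XsubC size_prod_XsubC size_map size_iota.
Qed.

Lemma conj_prod_inv : map_poly sg conj_prod = conj_prod.
Proof.
rewrite /conj_prod rmorph_prod.
under eq_bigr => j _ do rewrite /= map_polyXsubC /= -[sg (Sk j)]/(Sk j.+1).
rewrite -(prednK (prim_n_gt0 w_prim)) big_ord_recr [RHS]big_ord_recl [LHS]mulrC; congr (_ * _).
congr ('X - _%:P); rewrite [Sk _](_ : _ = Sk n); last by congr Sk; rewrite -[RHS](prednK (prim_n_gt0 w_prim)).
by rewrite /Sk !iter_sg (prim_expr_order w_prim).
Qed.

Let good G := map_poly sg G = G /\ leadp kappa (frm G) (cst *: 'X).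
Let dl : L := kap L (d%:R^-1).

Let dlE : dl * d%:R = 1.
Proof.
rewrite -(rmorph_nat (emb L)) -(rmorph_nat (@psC K)) -rmorphM -rmorphM /=.
by rewrite mulVf ?natK_neq0 // rmorph1 rmorph1.
Qed.

(** In the expansion of [conj_prod] in powers of [g] the digit of index [d - 1] is [a]. By
    [form_digits] its form at order [kappa] comes from the coefficient of degree [d - 1] of [Fform],
    which is zero, so adding [a / d] leaves the form of [g] unchanged. *)
Lemma good_step (g a : {poly L}) : good g -> g \is monic -> size g = N.+1 -> (size a <= N)%N ->
  (size (conj_prod - g ^+ d - a * g ^+ d.-1)%R <= d.-1 * N)%N -> good (g + dl *: a).
Proof.
case=> ig hg mg sg' sa; set r := _ - _ - _ => sr.
have er : conj_prod - g ^+ d = a * g ^+ d.-1 + r by rewrite /r [RHS]addrC subrK.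
have mgd : g ^+ d.-1 \is monic by rewrite monic_exp.
have sgd := size_monic_exp d.-1 mg sg'.
have igX m : map_poly sg (g ^+ m) = g ^+ m by rewrite rmorphXn /= ig.
have [ia ir] : map_poly sg a = a /\ map_poly sg r = r.
  apply: (monic_division_uniq mgd); rewrite ?sgd ?ltnS //.
    exact: leq_trans (size_poly _ _) sr.
  by rewrite -{1}(igX d.-1) -rmorphM -rmorphD -er rmorphB /= conj_prod_inv igX.
have [b' [sb ib eb]] := adic_expansion mg sg' sr ig ir.
have d1 := d_gt1; have [d' ed] : exists d', d = d'.+2 by exists d.-2; lia.
(* The [d + 1] digits of [conj_prod]: those of the remainder [r], then [a], then 1. *)
pose al i := if (i < d'.+1)%N then b' i else if i == d'.+1 then a else 1.
have eF : conj_prod = \sum_(i < d.+1) al i * g ^+ i.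
  rewrite ed big_ord_recr big_ord_recr /= /al ltnn eqxx ltnNge leqnSn /= gtn_eqF //.
  rewrite mul1r; apply/eqP; rewrite -subr_eq -{1}ed er eb ed /= addrC; apply/eqP.
  by congr (_ + _); apply: eq_bigr => i _; rewrite ltn_ord.
have lowal i : (i < d.+1)%N -> low_form (frm (al i)).
  move=> _; have gen P : map_poly sg P = P -> (size P <= N)%N -> low_form (frm P).
    move=> iP sP; have [->|P0] := eqVneq P 0; first by left; rewrite /frm comp_poly0.
    by have [k [c [c0 _ h]]] := level_low iP sP P0; right; exists k, c.
  rewrite /al; case: ifP => _; first exact: gen.
  case: ifP => _; first exact: gen.
  apply: gen; [exact: rmorph1 | by rewrite size_poly1].
have := frm_F; rewrite -/conj_prod eF frm_sum.
under eq_bigr do rewrite frmM frmX.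
move=> hF; have lt : (d'.+1 < d.+1)%N by rewrite ed ltnS.
have cF : Fform`_d'.+1 = 0.
  by have := Fform_coef; have -> : d.-1 = d'.+1 by rewrite ed.
have := form_digits cst_neq0 hg lowal hF lt.
rewrite /al ltnn eqxx coefZ cF mulr0 mul0r polyC0 => ha0.
have ha : leadp kappa (frm a) 0.
  by move: ha0; have -> : kappa *+ d - kappa *+ d'.+1 = kappa by rewrite ed mulrS addrK.
have idl : sg dl = dl by rewrite /dl /kap sgE rot_psC.
split; first by rewrite rmorphD /= map_polyZ /= ig ia idl.
rewrite frmD frmZ -[cst *: 'X]addr0; apply: leadpD hg _.
by have := leadpZ (lead_kap L d%:R^-1) ha; rewrite add0r scaler0.
Qed.

Lemma level_aroot : exists h, good h /\ aroot d N conj_prod h.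
Proof.
have [mF sF] := conj_prod_monic; have {}sF : size conj_prod = (d * N).+1 by rewrite sF nE.
have [mP sP] := Phat_monic.
apply: (tschirnhausen d_gt0 dlE mF sF good_step _ mP sP).
by split; [exact: Phat_inv | exact: frm_Phat].
Qed.

Let d_neq0L : d%:R != 0 :> L.
Proof. by apply: contra_eq_neq dlE => ->; rewrite mulr0 eq_sym oner_neq0. Qed.

(** The value of the form variable at which the truncation is completed to the actual branch
    [Sk 0]. *)
Let X0 : L := (Sk 0 - etaj 0) * tauL L ^ (- beta).

Let lead_X0 : lead 0 X0 (s b).
Proof.
have := leadM (Sk_eta 0) (lead_tau L (- beta)).
by rewrite subrr mul0n expr0 mul1r mulr1.
Qed.

Let frm_X0 P : (frm P).[X0] = P.[Sk 0].
Proof.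
rewrite /frm horner_comp hornerD hornerZ hornerX hornerC; congr (_.[_]).
by rewrite /X0 mulrC -mulrA -expfzDr ?tauL_neq0 // addNr expr0z mulr1 subrK.
Qed.

Lemma level_value G : aroot d N conj_prod G -> exists c, c != 0 /\ lead kappa G.[Sk 0] c.
Proof.
have [h [[ih hh] ah]] := level_aroot => aG; rewrite (aroot_uniq d_neq0L aG ah).
exists (cst * s b); split; first by rewrite mulf_neq0 ?cst_neq0.
by have := leadp_horner hh lead_X0; rewrite frm_X0 !hornerE.
Qed.

Lemma level_low_value P : map_poly sg P = P -> (size P <= N)%N -> P != 0 ->
  exists k c, [/\ c != 0, (d %| k)%Z & lead k P.[Sk 0] c].
Proof.
move=> iP sP P0; have [k [c [c0 dk h]]] := level_low iP sP P0.
by exists k, c; split=> //; have := leadp_horner h lead_X0; rewrite frm_X0 hornerC.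
Qed.

Lemma kappa_mod : (d %| kappa - b%:Z)%Z.
Proof.
have -> : kappa - b%:Z = \sum_(j < N | j != 0%N :> nat) kk j - n%:Z.
  by rewrite /kappa /beta; lia.
rewrite rpredB //=; last by rewrite dvdzE /= nE dvdn_mulr.
by apply: rpred_sum => j /kcP'[].
Qed.

(** For conjugates with the same truncation only the bound [beta] is recorded, with a coefficient
    that may vanish, as it does for [k = 0]. Each of the [d] blocks contributes [kappa]. *)
Lemma level_contact : exists oi : nat -> int,
  \sum_(k < n) oi k = kappa *+ d /\
  forall k, (oi k < beta /\ exists c, c != 0 /\ lead (oi k) (Sk 0 - Sk k) c) \/
    (oi k = beta /\ exists c, lead beta (Sk 0 - Sk k) c).
Proof.
exists (fun k => if (N %| k)%N then beta else kk (k %% N)); split.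
  rewrite nE (big_ord_blocks _ d N (fun k => if (N %| k)%N then beta else kk (k %% N))).
  rewrite (eq_bigr (fun=> kappa)) ?sumr_const ?card_ord // => l _.
  rewrite (bigD1 (Ordinal N_gt0)) //= addn0 dvdn_mull //; congr (_ + _).
  apply: eq_big => [j|j j0]; first by [].
  rewrite dvdn_addr ?dvdn_mull // gtnNdvd // ?lt0n //.
  by rewrite modnMDl modn_small.
move=> k; have S0 := Sk_eta 0; case: (boolP (N %| k)%N) => Nk.
  right; split=> //; exists (w ^+ (0 * b) * s b + - (w ^+ (k * b) * s b)).
  have -> : Sk 0 - Sk k = (Sk 0 - etaj 0) + (etaj 0 - Sk k) by ring.
  by apply: leadD S0 (Sk_near Nk).
left; have Nk' : ~~ (N %| k %% N)%N by rewrite /dvdn modn_mod.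
have [kb c0 _ _] := kcP Nk'; split=> //; exists (cc (k %% N)); split=> //.
have -> : Sk 0 - Sk k = (Sk 0 - etaj 0) + (etaj 0 - Sk k) by ring.
by rewrite -[cc _]add0r; apply: leadD (lead_weak kb S0) (Sk_far Nk).
Qed.

End Level.

(** * Norms as determinants of multiplication modulo a monic polynomial *)

Section Norm.

Definition mulmod_mx (R : idomainType) n (g p : {poly R}) : 'M[R]_n :=
  \matrix_(i, j) (Pdiv.Ring.rmodp (p * 'X^i) g)`_j.

Lemma mulmod_row (R : idomainType) n (g p : {poly R}) i : g \is monic -> size g = n.+1 ->
  exists v, \sum_(j < n) (Pdiv.Ring.rmodp (p * 'X^i) g)`_j *: 'X^j = p * 'X^i - v * g.
Proof.
move=> mg sg; exists (Pdiv.Ring.rdivp (p * 'X^i) g).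
rewrite {2}(Pdiv.RingMonic.rdivp_eq mg (p * 'X^i)) addrC addKr.
have sr : (size (Pdiv.Ring.rmodp (p * 'X^i) g) <= n)%N.
  by rewrite -ltnS -sg Pdiv.Ring.ltn_rmodpN0 ?monic_neq0.
rewrite -poly_def; apply/polyP => j; rewrite coef_poly.
by case: ltnP => // nj; rewrite nth_default // (leq_trans sr).
Qed.

(** Cramer's rule: the first row of [\adj M *m M] writes the determinant as a combination of the
    residues of the [p * 'X^i]. *)
Lemma det_mulmod_ideal (R : idomainType) n (g p : {poly R}) : (0 < n)%N ->
  g \is monic -> size g = n.+1 ->
  exists u v, (\det (mulmod_mx n g p))%:P = u * p + v * g.
Proof.
move=> n0 mg sg; set M := mulmod_mx n g p; pose o := Ordinal n0.
have /choice[v hv] : forall i : 'I_n, exists v, \sum_(j < n) M i j *: 'X^j = p * 'X^i - v * g.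
  move=> i; have [v hv] := mulmod_row p i mg sg; exists v; rewrite -hv.
  by apply: eq_bigr => j _; rewrite mxE.
exists (\sum_i (\adj M) o i *: 'X^i), (- \sum_i (\adj M) o i *: v i).
have : \sum_(j < n) (\adj M *m M) o j *: 'X^j = (\det M)%:P.
  rewrite mul_adj_mx (bigD1 o) //= big1 ?addr0 => [|j jo].
    by rewrite mxE eqxx expr0 alg_polyC.
  by rewrite mxE eq_sym (negbTE jo) scale0r.
move=> <-; under eq_bigr do rewrite mxE scaler_suml.
rewrite exchange_big /= mulr_suml mulNr mulr_suml -sumrB; apply: eq_bigr => i _.
under eq_bigr do rewrite -scalerA.
by rewrite -scaler_sumr hv scalerBr -!scalerAl [p * _]mulrC.
Qed.

(** In the Newton basis multiplication by [q] is triangular with the values of [q] at the nodes on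
    the diagonal; repeated nodes cause no trouble. *)
Lemma newton_expansion (F : fieldType) n (z : nat -> F) (q : {poly F}) j : (j <= n)%N ->
  let u k := \prod_(l < k) ('X - (z l)%:P) in
  exists (t : nat -> F) (v : {poly F}), [/\ q * u j = \sum_(l < n) t l *: u l + v * u n,
    forall l, (l < j)%N -> t l = 0 & (j < n)%N -> t j = q.[z j]].
Proof.
move=> jn u; have [m em] : exists m, n = (j + m)%N by exists (n - j)%N; rewrite subnKC.
elim: m j em {jn} q => [|m IH] j em q.
  exists (fun=> 0), q; rewrite em addn0 ltnn; split=> //.
  by rewrite big1 ?add0r // => l _; rewrite scale0r.
have [q' eq'] : exists q', q - (q.[z j])%:P = q' * ('X - (z j)%:P).
  by apply/factor_theorem; rewrite rootE !hornerE subrr.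
have [t [v [e t0 tj]]] := IH j.+1 (etrans em (addnS _ _)) q'.
have jn : (j < n)%N by rewrite em -addSnnS leq_addr.
exists (fun l => if l == j then q.[z j] else t l), v; split.
- have -> : q = (q.[z j])%:P + q' * ('X - (z j)%:P) by rewrite -eq' addrC subrK.
  rewrite hornerD hornerC hornerM hornerXsubC subrr mulr0 addr0.
  have uS : u j.+1 = u j * ('X - (z j)%:P) by rewrite /u big_ord_recr.
  rewrite mulrDl -mulrA [('X - _) * u j]mulrC -uS e (bigD1 (Ordinal jn)) //=.
  rewrite [in RHS](bigD1 (Ordinal jn)) //= eqxx t0 // scale0r add0r mul_polyC -addrA.
  congr (_ + (_ + _)); apply: eq_bigr => l lj; rewrite ifF //.
  by apply: contraNF lj => /eqP h; apply/eqP/val_inj.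
- by move=> l lj; rewrite ltn_eqF // t0 // (ltn_trans lj).
by rewrite eqxx.
Qed.

(** Monomials and Newton basis differ by a unitriangular matrix, so the determinant is that of the
    triangular matrix of [newton_expansion]. *)
Lemma det_mulmod_split (F : fieldType) n (z : nat -> F) (p : {poly F}) :
  \det (mulmod_mx n (\prod_(k < n) ('X - (z k)%:P)) p) = \prod_(k < n) p.[z k].
Proof.
pose u k := \prod_(l < k) ('X - (z l)%:P); rewrite -/(u n).
have hu k : u k \is monic /\ size (u k) = k.+1.
  have -> : u k = \prod_(r <- [seq z j | j <- iota 0 k]) ('X - r%:P).
    by rewrite big_map -[k in iota 0 k]subn0 big_mkord.
  by rewrite monic_prod_XsubC size_prod_XsubC size_map size_iota.
have [mn sn] := hu n; set M := mulmod_mx n (u n) p.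
have /choice[tv htv] : forall i : 'I_n, exists tv : (nat -> F) * {poly F},
    [/\ p * u i = \sum_(l < n) tv.1 l *: u l + tv.2 * u n,
    forall l, (l < i)%N -> tv.1 l = 0 & tv.1 i = p.[z i]].
  move=> i; have [t [v [e t0 ti]]] := newton_expansion z p (ltnW (ltn_ord i)).
  by exists (t, v); split=> //; apply: ti.
pose T : 'M[F]_n := \matrix_(i, l) (tv i).1 l.
pose U : 'M[F]_n := \matrix_(i, j) (u i)`_j.
have szU (c : 'I_n -> F) : (size (\sum_(l < n) c l *: u l)%R < size (u n))%N.
  rewrite sn ltnS; apply: leq_trans (size_sum _ _ _) _; apply/bigmax_leqP => l _.
  by apply: leq_trans (size_scale_leq _ _) _; have [_ ->] := hu l.
have UM : U *m M = T *m U.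
  apply/matrixP => i j; rewrite !mxE.
  have -> : \sum_k U i k * M k j = (\sum_(k < n) (u i)`_k *: Pdiv.Ring.rmodp (p * 'X^k) (u n))`_j.
    by rewrite coef_sum; apply: eq_bigr => k _; rewrite !mxE coefZ.
  have -> : \sum_l T i l * U l j = (\sum_(l < n) (tv i).1 l *: u l)`_j.
    by rewrite coef_sum; apply: eq_bigr => k _; rewrite !mxE coefZ.
  congr (_`_j); have [e _ _] := htv i.
  pose V := \sum_(k < n) (u i)`_k *: Pdiv.Ring.rdivp (p * 'X^k) (u n).
  set rho := \sum_(k < n) _.
  have srho : (size rho < size (u n))%N.
    rewrite sn ltnS; apply: leq_trans (size_sum _ _ _) _; apply/bigmax_leqP => l _.
    apply: leq_trans (size_scale_leq _ _) _.
    by rewrite -ltnS -sn Pdiv.Ring.ltn_rmodpN0 ?monic_neq0.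
  have E : V * u n + rho = (tv i).2 * u n + \sum_(l < n) (tv i).1 l *: u l.
    rewrite [RHS]addrC -e mulr_suml -big_split /=.
    have eu : u i = \sum_(k < n) (u i)`_k *: 'X^k.
      rewrite -poly_def; apply/polyP => k; rewrite coef_poly; case: ltnP => // nk.
      by rewrite nth_default //; have [_ ->] := hu i; apply: leq_trans (ltn_ord i) nk.
    rewrite [in RHS]eu mulr_sumr; apply: eq_bigr => k _.
    by rewrite -scalerAl -scalerDr -Pdiv.RingMonic.rdivp_eq // scalerAr.
  by have [_ ->] := monic_division_uniq mn srho (szU _) E.
have dU : \det U = 1.
  rewrite det_trig; last first.
    apply/is_trig_mxP => i j ij; rewrite mxE nth_default //.
    by have [_ ->] := hu i.
  rewrite big1 // => i _; rewrite mxE.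
  by have [/monicP + si] := hu i; rewrite lead_coefE si.
have dT : \det T = \prod_(k < n) p.[z k].
  rewrite -det_tr det_trig; last first.
    by apply/is_trig_mxP => i j ij; rewrite !mxE; have [_ h _] := htv j; apply: h.
  by apply: eq_bigr => i _; rewrite !mxE; have [_ _ ->] := htv i.
by have := congr1 (fun A => \det A) UM; rewrite /= !det_mulmx dU mul1r mulr1 dT.
Qed.

Lemma norm_in_ideal (R : idomainType) (F : fieldType) (phi : {rmorphism R -> F}) n
    (g p : {poly R}) (z : nat -> F) : (0 < n)%N -> g \is monic -> size g = n.+1 ->
  map_poly phi g = \prod_(k < n) ('X - (z k)%:P) ->
  exists q u v, q%:P = u * p + v * g /\ phi q = \prod_(k < n) (map_poly phi p).[z k].
Proof.
move=> n0 mg sg eg; have [u [v e]] := det_mulmod_ideal p n0 mg sg.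
exists (\det (mulmod_mx n g p)), u, v; split=> //.
rewrite -det_map_mx -det_mulmod_split -eg; congr (\det _).
apply/matrixP => i j; rewrite !mxE -coef_map; congr (_`_j).
have mg' : map_poly phi g \is monic by apply: monic_map.
have sg' : size (map_poly phi g) = n.+1.
  by rewrite size_map_poly_id0 ?sg // (monicP mg) rmorph1 oner_neq0.
have s1 : (size (map_poly phi (Pdiv.Ring.rmodp (p * 'X^i) g)) < size (map_poly phi g))%N.
  rewrite sg' -sg; apply: leq_ltn_trans (size_poly _ _) _.
  by rewrite Pdiv.Ring.ltn_rmodpN0 ?monic_neq0.
have s2 : (size (Pdiv.Ring.rmodp (map_poly phi p * 'X^i) (map_poly phi g)) < size (map_poly phi g))%N.
  by rewrite Pdiv.Ring.ltn_rmodpN0 ?monic_neq0.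
have E : map_poly phi (Pdiv.Ring.rdivp (p * 'X^i) g) * map_poly phi g +
    map_poly phi (Pdiv.Ring.rmodp (p * 'X^i) g) =
    Pdiv.Ring.rdivp (map_poly phi p * 'X^i) (map_poly phi g) * map_poly phi g +
    Pdiv.Ring.rmodp (map_poly phi p * 'X^i) (map_poly phi g).
  rewrite -Pdiv.RingMonic.rdivp_eq // -rmorphM -rmorphD /= -Pdiv.RingMonic.rdivp_eq //.
  by rewrite rmorphM /= map_polyXn.
by case: (monic_division_uniq mg' s1 s2 E) => _ ->.
Qed.

End Norm.

(** * The characteristic exponents of the branch *)

Section Levels.
Variables (K : closedFieldType) (L : laurent K).
Hypothesis charK0 : [pchar K] =i pred0.
Variables (n : nat) (w : K) (sg : {rmorphism L -> L}) (s : pseries K).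
Hypothesis w_prim : n.-primitive_root w.
Hypothesis sgE : forall a, sg (emb L a) = emb L (rot w a).
Hypothesis s_dist : forall k, (0 < k < n)%N -> rot (w ^+ k) s != s.

(* The last condition says in dual form that the gcd of n and of the exponents of s
   below b divides d. *)
Definition level d b := [/\ (0 < d)%N, (d %| n)%N,
  forall i, (i < b)%N -> s i != 0 -> (d %| i)%N &
  forall j, (forall i, (i < b)%N -> s i != 0 -> (n %| i * j)%N) -> (n %/ d %| j)%N].

Let n_gt0 : (0 < n)%N := prim_n_gt0 w_prim.

Lemma level0 : level n 0.
Proof. by split=> // j _; rewrite divnn n_gt0 dvd1n. Qed.

Lemma level_next d b : level d b -> s b != 0 -> level (gcdn d b) b.+1.
Proof.
case=> d0 dn lt gen sb; have g0 : (0 < gcdn d b)%N by rewrite gcdn_gt0 d0.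
have gn : (gcdn d b %| n)%N by apply: dvdn_trans (dvdn_gcdl _ _) dn.
split=> // [i|j h].
  rewrite ltnS leq_eqVlt => /orP[/eqP -> _|ib si]; first exact: dvdn_gcdr.
  by apply: dvdn_trans (dvdn_gcdl _ _) (lt i ib si).
have /dvdnP[l jl] := gen j (fun i ib => h i (ltnW ib)).
have h1 : (n %| d * j)%N by rewrite jl mulnCA -{1}(divnK dn) mulnC [(d * _)%N]mulnC dvdn_mull.
have h2 : (n %| b * j)%N by apply: h.
have : (n %| gcdn d b * j)%N by rewrite muln_gcdl dvdn_gcd h1 h2.
by rewrite -{1}(divnK gn) mulnC dvdn_pmul2l.
Qed.

Lemma level_ge d b b' : level d b -> (b <= b')%N ->
  (forall i, (i < b')%N -> s i != 0 -> (d %| i)%N) -> level d b'.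
Proof.
case=> d0 dn lt gen bb' lt'; split=> // j h; apply: gen => i ib; apply: h.
exact: leq_trans ib bb'.
Qed.

Lemma level_exists b : exists d, level d b.
Proof.
elim: b => [|b [d lv]]; first by exists n; apply: level0.
have [sb|sb] := eqVneq (s b) 0; last by exists (gcdn d b); apply: level_next.
have [_ _ lt _] := lv; exists d; apply: level_ge lv _ _ => // i; rewrite ltnS leq_eqVlt => /orP[/eqP->|ib].
  by rewrite sb eqxx.
exact: lt.
Qed.

(** If all exponents were multiples of [d > 1], rotation by [w ^+ (n %/ d)] would fix [s], against
    the distinctness of the conjugates. *)
Lemma level_break d b : level d b -> (1 < d)%N ->
  exists b', [/\ level d b', s b' != 0 & ~~ (d %| b')%N].
Proof.
move=> lv d1; have [d0 dn lt gen] := lv.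
have ex : exists i, (s i != 0) && ~~ (d %| i)%N.
  apply: contrapT => /forallNP h.
  have := @s_dist (n %/ d); rewrite divn_gt0 // dvdn_leq // ltn_Pdiv // => /(_ isT)/negP; apply.
  apply/eqP/psP => i /=; have [->|si] := eqVneq (s i) 0; first by rewrite mulr0.
  have /dvdnP[l ->] : (d %| i)%N by move/negP: (h i); rewrite si negbK.
  rewrite -exprM mulnCA divnK // mulnC exprM (prim_expr_order w_prim).
  by rewrite expr1n mul1r.
have [b' /andP[sb' db'] minb] := ex_minnP ex; exists b'; split=> //.
have lt' i : (i < b')%N -> s i != 0 -> (d %| i)%N.
  by move=> ib si; apply: contraLR ib => di; rewrite -leqNgt minb // si.
apply: level_ge lv _ lt'; rewrite leqNgt; apply: contra db' => lb.
exact: lt.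
Qed.

Local Notation F := (conj_prod n sg s).
Local Notation S0 := (Sk n sg s 0).

(** The contact orders are chosen once, so that one [kp] serves both the value of the approximate
    root and the sum of contacts. *)
Theorem level_theorem d b : level d b -> s b != 0 -> ~~ (d %| b)%N ->
  exists kp : int, [/\ (d %| kp - b%:Z)%Z,
    forall G, aroot d (n %/ d) F G -> exists c, c != 0 /\ lead kp G.[S0] c,
    forall P, map_poly sg P = P -> (size P <= n %/ d)%N -> P != 0 ->
      exists k c, [/\ c != 0, (d %| k)%Z & lead k P.[S0] c] &
    exists oi : nat -> int, \sum_(k < n) oi k = kp *+ d /\
      forall k, (oi k < b%:Z - n%:Z /\ exists c, c != 0 /\ lead (oi k) (S0 - Sk n sg s k) c) \/
        (oi k = b%:Z - n%:Z /\ exists c, lead (b%:Z - n%:Z) (S0 - Sk n sg s k) c)].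
Proof.
case=> d0 dn lt gen sb db; have nE : n = (d * (n %/ d))%N by rewrite mulnC divnK.
have [kk [cc kcP]] := eta_choice w_prim sgE nE lt gen.
exists (kappa n b (n %/ d) kk); split.
- exact: (kappa_mod charK0 w_prim d0 nE sb db kcP).
- by move=> G; apply: (level_value charK0 w_prim sgE d0 nE lt sb db gen kcP).
- by move=> P; apply: (level_low_value w_prim sgE nE lt gen kcP).
exact: (level_contact w_prim sgE nE lt kcP).
Qed.

End Levels.

(** * Evaluation of polynomials in x at t^-n *)

Section Evaluation.
Variables (K : closedFieldType) (L : laurent K) (n : nat).

Lemma kap_is_zmod_morphism : zmod_morphism (kap L).
Proof. by move=> a b; rewrite /kap !rmorphB. Qed.
Lemma kap_is_monoid_morphism : monoid_morphism (kap L).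
Proof. by split=> [|a b]; rewrite /kap ?rmorph1 // !rmorphM. Qed.
HB.instance Definition _ := GRing.isZmodMorphism.Build K L (kap L) kap_is_zmod_morphism.
HB.instance Definition _ := GRing.isMonoidMorphism.Build K L (kap L) kap_is_monoid_morphism.

Definition evx (p : {poly K}) : L := (map_poly (kap L) p).[xL L n].

Lemma evx_is_zmod_morphism : zmod_morphism evx.
Proof. by move=> p q; rewrite /evx rmorphB hornerD hornerN. Qed.
Lemma evx_is_monoid_morphism : monoid_morphism evx.
Proof. by split=> [|p q]; rewrite /evx ?rmorph1 ?hornerC // rmorphM hornerM. Qed.
HB.instance Definition _ := GRing.isZmodMorphism.Build {poly K} L evx evx_is_zmod_morphism.
HB.instance Definition _ := GRing.isMonoidMorphism.Build {poly K} L evx evx_is_monoid_morphism.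

Lemma evxC c : evx c%:P = kap L c.
Proof. by rewrite /evx map_polyC hornerC. Qed.

Lemma lead_evx (p : {poly K}) : (0 < n)%N -> p != 0 ->
  lead (- (n * (size p).-1)%N%:Z) (evx p) (lead_coef p).
Proof.
move=> n0 p0; have sp : size p = (size p).-1.+1 by rewrite prednK // size_poly_gt0.
rewrite /evx lead_coefE; set m := (size p).-1.
have -> : (map_poly (kap L) p).[xL L n] = \sum_(i < m.+1) kap L p`_i * xL L n ^+ i.
  rewrite (@horner_coef_wide _ m.+1) ?size_map_inj_poly ?rmorph0 -?sp //.
    by apply: eq_bigr => i _; rewrite coef_map.
  exact: fmorph_inj.
have xi c i : lead (- (n * i)%N%:Z) (kap L c * xL L n ^+ i) c.
  have := leadM (lead_kap L c) (leadX i (lead_tau L (- n%:Z))); rewrite expr1n mulr1 add0r.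
  by have -> : - n%:Z *+ i = - (n * i)%N%:Z by rewrite PoszM; lia.
have h0 : lead (- (n * m)%N%:Z) (\sum_(i < m) kap L p`_i * xL L n ^+ i) 0.
  have -> : 0 = \sum_(i < m) 0 :> K by rewrite big1.
  apply: lead_sum => i _; apply: lead_weak (xi _ _).
  by rewrite ltrN2 ltz_nat ltn_pmul2l //= ltn_ord.
by have := leadD h0 (xi p`_m m); rewrite add0r big_ord_recr.
Qed.

Lemma evx_inj : (0 < n)%N -> injective evx.
Proof.
move=> n0 p q pq; apply/eqP; rewrite -subr_eq0; apply/negPn/negP => d0.
have := lead_neq0 _ (lead_evx n0 d0); rewrite lead_coef_eq0 => /(_ d0).
by rewrite rmorphB /= pq subrr eqxx.
Qed.

End Evaluation.

Lemma sum_rev_from2 (V : nmodType) (F : nat -> V) d : (0 < d)%N ->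
  \sum_(i < d.-1) F i = \sum_(2 <= i < d.+1) F (d - i)%N.
Proof.
case: d => // d _; rewrite big_add1 /= [RHS]big_nat_rev big_add1 /= big_mkord.
by apply: eq_bigr => i _; have id := ltn_ord i; congr F; lia.
Qed.

(** * Approximate roots in K[x][y] *)

Section ApproximateRootsXY.
Variable K : fieldType.
Hypothesis charK0 : [pchar K] =i pred0.
Implicit Types (f G : {poly {poly K}}) (d e : nat).

Lemma natP_neq0 d : (0 < d)%N -> d%:R != 0 :> {poly K}.
Proof.
by move=> d0; rewrite -polyC_natr polyC_eq0; move: charK0 => /pcharf0P ->; rewrite -lt0n.
Qed.

Lemma approx_root_aroot d f G : (0 < d)%N -> is_approx_root d f G <->
  aroot d (degy f %/ d)%N f G.
Proof.
move=> d0; rewrite /is_approx_root; set e := (_ %/ _)%N; split.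
  case=> mG sG [al [sal ef al1]]; split=> //.
  by rewrite {1}ef addrC addKr; apply: size_aroot_tail.
case=> mG sG sf; split=> //.
have [b [sb _ eb]] := @adic_expansion _ idfun G e d.-1 (f - G ^+ d) mG sG sf
  (map_poly_id (fun _ _ => erefl)) (map_poly_id (fun _ _ => erefl)).
(* Digits are indexed by the power of [G], the alpha's by [d] minus it. The size bound stops the
   digits at index [d - 2], which is the condition on the first alpha. *)
exists (fun i => if (1 < i)%N then b (d - i)%N else 0); split=> //.
  by move=> i; case: ifP => // _; rewrite size_poly0.
rewrite -[f in LHS](subrK (G ^+ d)) addrC eb; congr (_ + _).
rewrite big_ltn // mul0r add0r (sum_rev_from2 (fun i => b i * G ^+ i) d0); apply: eq_big_nat => i /andP[i1 _].
by rewrite i1.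
Qed.

Lemma aroot_exists d e f : (0 < d)%N -> f \is monic -> size f = (d * e).+1 ->
  exists G, aroot d e f G.
Proof.
move=> d0 mf sf; have dl1 : (d%:R^-1 : K)%:P * d%:R = 1.
  rewrite -polyC_natr -polyCM mulVf //.
  by move: charK0 => /pcharf0P ->; rewrite -lt0n.
have [] := @tschirnhausen _ d e f _ (fun=> True) d0 dl1 mf sf (fun _ _ _ _ _ _ _ => I) 'X^e I.
- exact: monicXn.
- by rewrite size_polyXn.
by move=> G [_ aG]; exists G.
Qed.

Lemma App_aroot d f : (0 < d)%N -> (d %| degy f)%N -> f \is monic ->
  aroot d (degy f %/ d) f (App d f).
Proof.
move=> d0 df mf; apply/approx_root_aroot => //; apply: xgetPex.
have sf : size f = (d * (degy f %/ d)).+1.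
  by rewrite mulnC divnK // /degy prednK // size_poly_gt0 monic_neq0.
by have [G aG] := aroot_exists d0 mf sf; exists G; apply/approx_root_aroot.
Qed.

End ApproximateRootsXY.

Lemma gcdn_dvd_add d v b : (d %| v + b)%N -> gcdn d v = gcdn d b.
Proof.
move=> h; apply/eqP; rewrite eqn_dvd !dvdn_gcd !dvdn_gcdl /=; apply/andP; split.
  by rewrite -(dvdn_addr _ (dvdn_gcdr d v)) (dvdn_trans (dvdn_gcdl _ _)).
by rewrite -(dvdn_addl _ (dvdn_gcdr d b)) (dvdn_trans (dvdn_gcdl _ _)).
Qed.

(** * The valuation of a curve with one place at infinity *)

Section Curve.
Variables (K : closedFieldType) (L : laurent K).
Hypothesis charK0 : [pchar K] =i pred0.
Variables (n : nat) (w : K) (sg : {rmorphism L -> L}) (s : pseries K).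
Hypothesis w_prim : n.-primitive_root w.
Hypothesis sgE : forall a, sg (emb L a) = emb L (rot w a).
Hypothesis s_dist : forall k, (0 < k < n)%N -> rot (w ^+ k) s != s.
Variable f : {poly {poly K}}.
Hypothesis f_monic : f \is monic.
Hypothesis f_size : size f = n.+1.
Hypothesis f_conj : map_poly (evx L n) f = conj_prod n sg s.
Implicit Types p q u v : {poly {poly K}}.

Let n_gt0 : (0 < n)%N := prim_n_gt0 w_prim.
Local Notation S k := (Sk n sg s k).

Definition ev p : L := (map_poly (evx L n) p).[S 0].

Lemma ev_is_zmod_morphism : zmod_morphism ev.
Proof. by move=> p q; rewrite /ev rmorphB hornerD hornerN. Qed.
Lemma ev_is_monoid_morphism : monoid_morphism ev.
Proof. by split=> [|p q]; rewrite /ev ?rmorph1 ?hornerC // rmorphM hornerM. Qed.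
HB.instance Definition _ := GRing.isZmodMorphism.Build {poly {poly K}} L ev ev_is_zmod_morphism.
HB.instance Definition _ := GRing.isMonoidMorphism.Build {poly {poly K}} L ev ev_is_monoid_morphism.

Lemma evC (p : {poly K}) : ev p%:P = evx L n p.
Proof. by rewrite /ev map_polyC hornerC. Qed.

Lemma evX : ev 'X = S 0.
Proof. by rewrite /ev map_polyX hornerX. Qed.

Lemma sg_evx (p : {poly K}) : sg (evx L n p) = evx L n p.
Proof.
rewrite /evx -horner_map /= (sg_xL w_prim sgE) -map_poly_comp; congr (_.[_]).
by apply: eq_map_poly => c /=; rewrite /kap sgE rot_psC.
Qed.

Lemma sg_map_evx p : map_poly sg (map_poly (evx L n) p) = map_poly (evx L n) p.
Proof. by rewrite -map_poly_comp; apply: eq_map_poly => c /=; rewrite sg_evx. Qed.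

Lemma ev_conj p k : (map_poly (evx L n) p).[S k] = iter k sg (ev p).
Proof. exact: (horner_iter_sg k (S 0) (sg_map_evx p)). Qed.

Lemma iter_sg0 k : iter k sg 0 = 0.
Proof. by elim: k => //= k ->; rewrite rmorph0. Qed.

Lemma iter_sg_inj k : injective (iter k sg).
Proof. by elim: k => // k IH x y /fmorph_inj/IH. Qed.

Lemma S_inj i j : (i < n)%N -> (j < n)%N -> S i = S j -> i = j.
Proof.
have aux k l : (k < l < n)%N -> S k <> S l.
  case/andP=> kl ln e; have : S 0 = S (l - k)%N.
    apply: (@iter_sg_inj k); rewrite [LHS]e -[in LHS](subnKC (ltnW kl)).
    by rewrite /Sk iterD.
  rewrite /Sk !(iter_sg w_prim sgE) rot1 => /mulfI/(@emb_inj _ L) e'.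
  have := @s_dist (l - k); rewrite subn_gt0 kl (leq_ltn_trans (leq_subr _ _) ln).
  by move=> /(_ isT)/eqP; apply; rewrite -e' // expfz_neq0 // tauL_neq0.
move=> iN jN e; case: (ltngtP i j) => // h.
  by case: (aux i j) => //; rewrite h.
by case: (aux j i) => //; rewrite h.
Qed.

Lemma map_evx_inj : injective (map_poly (evx L n)).
Proof. by apply: map_inj_poly; [apply: evx_inj | rewrite rmorph0]. Qed.

Lemma ev_f : ev f = 0.
Proof. by rewrite /ev f_conj horner_prod (bigD1 (Ordinal n_gt0)) //= hornerXsubC subrr mul0r. Qed.

(** Vanishing at one conjugate forces vanishing at all [n] of them, which are distinct. *)
Lemma ev_small p : (size p <= n)%N -> p != 0 -> ev p != 0.
Proof.
move=> sp; apply: contraNneq => e; apply/eqP/map_evx_inj; rewrite rmorph0.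
have sp' : (size (map_poly (evx L n) p) <= n)%N by apply: leq_trans (size_poly _ _) sp.
rewrite (lagrange S_inj sp') big1 // => j _.
by rewrite ev_conj e iter_sg0 mul0r scale0r.
Qed.

Lemma ev0P p : ev p = 0 <-> exists u, p = u * f.
Proof.
split=> [e|[u ->]]; last by rewrite rmorphM /= ev_f mulr0.
have [q [r [ep sr]]] := monic_division p f_monic; exists q.
rewrite f_size ltnS in sr; have [r0|r0] := eqVneq r 0; first by rewrite ep r0 addr0.
move: e; rewrite ep rmorphD rmorphM /= ev_f mulr0 add0r => e.
by have := ev_small sr r0; rewrite e eqxx.
Qed.

Lemma norm_ev p : exists (q : {poly K}) u v, q%:P = u * p + v * f /\
  evx L n q = \prod_(k < n) iter k sg (ev p).
Proof.
have [q [u [v [e h]]]] := @norm_in_ideal _ L (evx L n) n f p (fun k => S k) n_gt0 f_monic f_size f_conj.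
exists q, u, v; split=> //; rewrite [LHS]h; apply: eq_bigr => k _; exact: ev_conj.
Qed.

(** The [n] conjugates of [ev p] have one order [k], so the norm [q] has order [n * k]; as a
    polynomial in x it has order [-n] times its degree. *)
Lemma norm_lead p : ev p != 0 -> exists (q : {poly K}) u v, [/\ q%:P = u * p + v * f, q != 0 &
  exists c, c != 0 /\ lead (- (size q).-1%:Z) (ev p) c].
Proof.
move=> p0; have [q [u [v [e h]]]] := norm_ev p; exists q, u, v.
have [k [c [c0 hk]]] := lead_ex p0.
have hN : lead (\sum_(i < n) k) (\prod_(i < n) iter i sg (ev p)) (\prod_(i < n) ((w ^ k) ^+ i * c)).
  by apply: lead_prod => i _; apply: (lead_iter_sg w_prim sgE).
have nz : \prod_(i < n) ((w ^ k) ^+ i * c) != 0.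
  apply/prodf_neq0 => i _; rewrite mulf_neq0 // expf_neq0 // expfz_neq0 //.
  exact: (prim_neq0 w_prim).
have q0 : q != 0.
  by have := lead_neq0 nz hN; rewrite -h; apply: contraNneq => ->; rewrite rmorph0.
split=> //; exists c; split=> //; rewrite -h in hN.
have := lead_inj nz _ hN (lead_evx L n_gt0 q0); rewrite lead_coef_eq0 => /(_ q0).
rewrite sumr_const card_ord => ek; have -> : - (size q).-1%:Z = k; last by [].
move: ek n_gt0; move: (size q).-1 => m; rewrite PoszM -mulr_natl natz -mulrN.
by move=> + n0; move=> /mulfI ->; rewrite // eqz_nat -lt0n.
Qed.

(** A natural number suffices by [norm_lead]; 0 is the default where [ev p] vanishes. *)
Definition val p : nat := xget 0%N [set m | exists c, c != 0 /\ lead (- m%:Z) (ev p) c]%classic.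

Lemma valP p : ev p != 0 -> exists c, c != 0 /\ lead (- (val p)%:Z) (ev p) c.
Proof.
move=> p0; have [q [u [v [_ _ h]]]] := norm_lead p0.
by apply: (@xgetPex _ 0%N [set m | exists c, c != 0 /\ lead (- m%:Z) (ev p) c]%classic); exists (size q).-1.
Qed.

Lemma val_eq p m c : c != 0 -> lead (- m%:Z) (ev p) c -> val p = m.
Proof.
move=> c0 h; have [e [e0 he]] := valP (lead_neq0 c0 h).
by have := lead_inj e0 c0 he h; lia.
Qed.

Lemma val_norm p : ev p != 0 -> exists (q : {poly K}) u v, [/\ q%:P = u * p + v * f, q != 0 & val p = (size q).-1].
Proof.
move=> /norm_lead[q [u [v [e q0 [c [c0 h]]]]]]; exists q, u, v; split=> //.
exact: val_eq c0 h.
Qed.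

Lemma evM_neq0 p q : ev p != 0 -> ev q != 0 -> ev (p * q) != 0.
Proof. by move=> p0 q0; rewrite rmorphM mulf_neq0. Qed.

Lemma valM p q : ev p != 0 -> ev q != 0 -> val (p * q) = (val p + val q)%N.
Proof.
move=> /valP[c [c0 hc]] /valP[e [e0 he]]; apply: (@val_eq _ _ (c * e)).
  exact: mulf_neq0.
by rewrite rmorphM /= PoszD opprD; apply: leadM.
Qed.

Lemma evCC_neq0 (c : K) : c != 0 -> ev c%:P%:P != 0.
Proof. by move=> c0; rewrite evC evxC fmorph_eq0. Qed.

Lemma valCC (c : K) : c != 0 -> val c%:P%:P = 0%N.
Proof. by move=> c0; apply: val_eq c0 _; rewrite evC evxC; apply: lead_kap. Qed.

Lemma valZ (c : K) p : c != 0 -> ev p != 0 -> ev (c%:P *: p) != 0 /\ val (c%:P *: p) = val p.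
Proof.
move=> c0 p0; rewrite -mul_polyC evM_neq0 ?evCC_neq0 // valM ?evCC_neq0 // valCC //.
Qed.

Lemma valD_lt p q : ev p != 0 -> ev q != 0 -> (val p < val q)%N ->
  ev (p + q) != 0 /\ val (p + q) = val q.
Proof.
move=> /valP[c [c0 hc]] /valP[e [e0 he]] lt.
have h : lead (- (val q)%:Z) (ev (p + q)) e.
  rewrite rmorphD -[e]add0r; apply: leadD he; apply: lead_weak hc.
  by rewrite ltrN2 ltz_nat.
by split; [apply: lead_neq0 e0 h | apply: val_eq e0 h].
Qed.

Lemma val_sub p q : ev p != 0 -> ev q != 0 -> val p = val q ->
  exists c, c != 0 /\ (ev (p - c%:P *: q) != 0 -> (val (p - c%:P *: q) < val p)%N).
Proof.
move=> /valP[c [c0 hc]] /valP[e [e0 he]] ve; exists (c / e).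
split; first by rewrite mulf_neq0 ?invr_eq0.
move=> nz; have [g [g0 hg]] := valP nz; set r := p - _ in nz hg *.
have h0 : lead (- (val p)%:Z) (ev r) 0.
  rewrite /r rmorphB -mul_polyC rmorphM /= evC evxC -[0](subrr c).
  apply: leadB hc _; rewrite ve -[- _]add0r -[X in lead _ _ X](divfK e0).
  by apply: leadM he; apply: lead_kap.
rewrite ltnNge; apply/negP; rewrite leq_eqVlt => /orP[/eqP e1|lt].
  by rewrite e1 in h0; rewrite (lead_uniq hg h0) eqxx in g0.
have h1 : lead (- (val p)%:Z) (ev r) 0 := h0.
have lt' : - (val r)%:Z < - (val p)%:Z by rewrite ltrN2 ltz_nat.
by rewrite (lead_uniq hg (lead_weak lt' h0)) eqxx in g0.
Qed.

Lemma val_polyC (p : {poly K}) : p != 0 -> ev p%:P != 0 /\ val p%:P = (n * (size p).-1)%N.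
Proof.
move=> p0; have h := lead_evx L n_gt0 p0; have c0 : lead_coef p != 0 by rewrite lead_coef_eq0.
by split; [rewrite evC (lead_neq0 c0 h) | apply: val_eq c0 _; rewrite evC].
Qed.

Lemma val_x : ev 'X%:P != 0 /\ val 'X%:P = n.
Proof.
have X0 : 'X != 0 :> {poly K} by rewrite -size_poly_eq0 size_polyX.
have := val_polyC X0; rewrite size_polyX /= muln1; exact.
Qed.

(** Up to sign, the norm of y is the constant coefficient of [f]. *)
Lemma val_y : (1 < n)%N -> [/\ f`_0 != 0, ev 'X != 0 & val 'X = (size f`_0).-1].
Proof.
move=> n1; have X0 : ev 'X != 0 by apply: ev_small; rewrite -?size_poly_eq0 size_polyX.
have [c [c0 h]] := valP X0.
have e0 : evx L n f`_0 = \prod_(k < n) (- S k).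
  rewrite -coef_map f_conj -horner_coef0 horner_prod.
  by apply: eq_bigr => k _; rewrite hornerXsubC sub0r.
have hN : lead (\sum_(i < n) - (val 'X)%:Z) (\prod_(i < n) (- S i)) (\prod_(i < n) (- ((w ^ (- (val 'X)%:Z)) ^+ i * c))).
  apply: lead_prod => i _; apply: leadN; rewrite evX in h.
  exact: (lead_iter_sg w_prim sgE i h).
have nz : \prod_(i < n) (- ((w ^ (- (val 'X)%:Z)) ^+ i * c)) != 0.
  apply/prodf_neq0 => i _; rewrite oppr_eq0 mulf_neq0 // expf_neq0 // expfz_neq0 //.
  exact: (prim_neq0 w_prim).
rewrite -e0 in hN; have f0 : f`_0 != 0.
  by have := lead_neq0 nz hN; apply: contraNneq => ->; rewrite rmorph0.
split=> //; have := lead_inj nz _ hN (lead_evx L n_gt0 f0); rewrite lead_coef_eq0 => /(_ f0).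
rewrite sumr_const card_ord mulNrn => /oppr_inj.
rewrite -mulr_natl natz -PoszM => /eqP; rewrite eqz_nat eqn_pmul2l // => /eqP.
by [].
Qed.

Definition good d := exists b, level n s d b.

Lemma good_n : good n.
Proof. by exists 0%N; apply: level0 w_prim. Qed.

Lemma degy_f : degy f = n.
Proof. by rewrite /degy f_size. Qed.

Lemma aroot_map d e G : aroot d e f G -> aroot d e (conj_prod n sg s) (map_poly (evx L n) G).
Proof.
case=> mG sG sf; rewrite -f_conj; split; first exact: monic_map.
  by rewrite size_map_inj_poly ?rmorph0 //; apply: evx_inj.
by rewrite -rmorphXn -rmorphB /=; apply: leq_trans (size_poly _ _) sf.
Qed.

(** The order of the approximate root is congruent to [b] modulo [d], so its value has the same gcd
    with [d] as [b] has: the sequence [d_k] follows the levels of the branch. *)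
Lemma good_App d : good d -> (1 < d)%N ->
  [/\ aroot d (n %/ d) f (App d f), ev (App d f) != 0, ~~ (d %| val (App d f))%N,
    good (gcdn d (val (App d f))) &
    forall p, (size p <= n %/ d)%N -> p != 0 -> ev p != 0 /\ (d %| val p)%N].
Proof.
case=> b0 lv0 d1; have [b [lv sb db]] := level_break w_prim s_dist lv0 d1.
have [d0 dn _ _] := lv.
have [kp [kb hG hlow _]] := level_theorem charK0 w_prim sgE lv sb db.
have aG : aroot d (n %/ d) f (App d f).
  by rewrite -degy_f; apply: App_aroot; rewrite ?degy_f.
have [c [c0 hc]] := hG _ (aroot_map aG); rewrite -/(ev _) in hc.
have nz := lead_neq0 c0 hc; have [e [e0 he]] := valP nz.
have ek := lead_inj e0 c0 he hc.
have dvb : (d %| val (App d f) + b)%N.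
  by move: kb; rewrite -ek -opprD dvdzE abszN -PoszD.
split=> //.
- by apply: contra db => dv; rewrite -(dvdn_addr _ dv).
- by exists b.+1; rewrite (gcdn_dvd_add dvb); apply: level_next.
move=> p sp p0; have sp' : (size (map_poly (evx L n) p) <= n %/ d)%N by apply: leq_trans (size_poly _ _) sp.
have p0' : map_poly (evx L n) p != 0 by rewrite (raddf_eq0 _ map_evx_inj).
have [k [g [g0 dk hk]]] := hlow _ (sg_map_evx p) sp' p0'; rewrite -/(ev _) in hk.
have nzp := lead_neq0 g0 hk; split=> //; have [h [h0 hh]] := valP nzp.
by move: dk; rewrite -(lead_inj h0 g0 hh hk) dvdzE abszN.
Qed.

Variable Th : {additive L -> L}.
Hypothesis ThM : forall x y, Th (x * y) = Th x * y + x * Th y.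
Hypothesis ThE : forall a, Th (emb L a) = emb L (theta a).

Lemma Th_kap c : Th (kap L c) = 0.
Proof.
rewrite /kap ThE; have -> : theta (psC c) = 0; last by rewrite rmorph0.
by apply: psP => -[|i]; rewrite /= ?mulr0n ?mul0rn.
Qed.

Lemma Th_horner (R : nzRingType) (phi : {rmorphism R -> L}) (p : {poly R}) y :
  Th (map_poly phi p).[y] = (map_poly (Th \o phi) p).[y] + (map_poly phi p^`()).[y] * Th y.
Proof.
elim/poly_ind: p => [|p c IH].
  by rewrite deriv0 !raddf0 !horner0 mul0r addr0 raddf0.
have mX : map_poly (Th \o phi) (p * 'X + c%:P) = map_poly (Th \o phi) p * 'X + (Th (phi c))%:P.
  apply/polyP => i; rewrite coef_map !coefD !coefMX coef_map !coefC.
  by case: i => [|i] /=; rewrite ?add0r ?addr0.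
rewrite derivD derivM derivX derivC mulr1 addr0 mX.
rewrite !(rmorphD, rmorphM) /= map_polyX map_polyC !(hornerD, hornerM, hornerX, hornerC) /=.
by rewrite raddfD /= ThM IH; ring.
Qed.

Lemma Th_evx (p : {poly K}) : Th (evx L n p) = evx L n p^`() * Th (xL L n).
Proof.
rewrite /evx (@Th_horner K (kap L)) [map_poly (Th \o _) p](_ : _ = 0) ?horner0 ?add0r //.
by apply/polyP => i; rewrite coef_map coef0 /= Th_kap.
Qed.

Lemma Th_ev p : Th (ev p) = ev (dfdx p) * Th (xL L n) + ev (dfdy p) * Th (S 0).
Proof.
rewrite {1}/ev (@Th_horner {poly K} (evx L n)); congr (_ + _).
rewrite /ev [in RHS]mulrC -hornerZ; congr (_.[_]).
by apply/polyP => i; rewrite coefZ coef_map /= Th_evx coef_map /dfdx coef_map /= mulrC.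
Qed.

Lemma dfdy_f_neq0 : ev (dfdy f) != 0.
Proof.
apply: ev_small; first by rewrite -ltnS -f_size lt_size_deriv ?monic_neq0.
apply/eqP => /(congr1 (fun p : {poly {poly K}} => p`_n.-1)).
rewrite coef_deriv coef0 (prednK n_gt0).
have -> : f`_n = 1 by have /monicP := f_monic; rewrite lead_coefE f_size.
by move/eqP; rewrite (negbTE (natP_neq0 charK0 n_gt0)).
Qed.

(* Differentiating f(x, y) = 0 along the curve turns t d/dt into a multiple of this derivation. *)
Definition jac p := dfdy f * dfdx p - dfdx f * dfdy p.

Lemma Th_jac p : Th (ev p) * ev (dfdy f) = Th (xL L n) * ev (jac p).
Proof.
have := Th_ev f; rewrite ev_f raddf0 => /esym/eqP; rewrite addrC addr_eq0 => /eqP h.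
rewrite Th_ev mulrDl -mulrA -[ev (dfdy p) * _ * _]mulrA [Th (S 0) * _]mulrC h.
by rewrite /jac rmorphB !rmorphM /=; ring.
Qed.

Lemma lead_Th_xL : lead (- n%:Z) (Th (xL L n)) (- n%:R).
Proof.
have := lead_theta ThM ThE (lead_tau L (- n%:Z)).
by rewrite mulr1 mulrNz pmulrn.
Qed.

(** The derivation multiplies the leading coefficient by minus the value, which is nonzero for a
    positive value in characteristic zero. The shift by [n] comes from the order of
    [Th (xL L n)]. *)
Lemma val_jac p : ev p != 0 -> (0 < val p)%N ->
  ev (jac p) != 0 /\ (val (jac p) + n = val (dfdy f) + val p)%N.
Proof.
move=> p0 vp; have [c [c0 hc]] := valP p0; have [e [e0 he]] := valP dfdy_f_neq0.
have h1 := leadM (lead_theta ThM ThE hc) he; rewrite Th_jac in h1.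
have nzl : (- (val p)%:Z)%:~R * c * e != 0.
  by rewrite !mulf_neq0 // mulrNz oppr_eq0 -pmulrn natK_neq0.
have J0 : ev (jac p) != 0.
  by have := lead_neq0 nzl h1; rewrite mulf_eq0 negb_or => /andP[].
split=> //; have [g [g0 hg]] := valP J0.
have h2 := leadM lead_Th_xL hg.
have nz2 : - n%:R * g != 0 by rewrite mulf_neq0 // oppr_eq0 natK_neq0.
by have := lead_inj nzl nz2 h1 h2; lia.
Qed.

End Curve.

Lemma deriv_prod_XsubC (F : fieldType) n (r : nat -> F) z :
  (forall i, (i < n)%N -> z != r i) ->
  (\prod_(i < n) ('X - (r i)%:P))^`().[z] =
  \prod_(i < n) (z - r i) * \sum_(i < n) (z - r i)^-1.
Proof.
elim: n => [|n IH] h; first by rewrite !big_ord0 derivC horner0 mulr0.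
rewrite !big_ord_recr /= derivM hornerD !hornerM derivXsubC hornerXsubC hornerC mulr1.
rewrite IH => [|i ni]; last by apply: h; apply: ltnW.
have -> : (\prod_(i < n) ('X - (r i)%:P)).[z] = \prod_(i < n) (z - r i).
  by rewrite horner_prod; apply: eq_bigr => i _; rewrite hornerXsubC.
by rewrite [RHS]mulrDr mulfK ?subr_eq0 ?h // mulrAC.
Qed.

Lemma sum_mod_shift (V : nmodType) n (F : nat -> V) c :
  \sum_(k < n) F ((k + c) %% n)%N = \sum_(k < n) F k.
Proof.
case: n => [|n]; first by rewrite !big_ord0.
elim: c => [|c IH]; first by apply: eq_bigr => k _; rewrite addn0 modn_small.
rewrite -IH big_ord_recr [RHS]big_ord_recl addrC.
congr (_ + _); last by rewrite /= addnC addSnnS modnDr.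
by apply: eq_bigr => i _; rewrite /= /bump add1n addSnnS.
Qed.

(** * Puiseux factorisation over K((t)) *)

Section PuiseuxLaurent.
Variables (K : closedFieldType) (L : laurent K).
Hypothesis charK0 : [pchar K] =i pred0.

(** Multiplying the roots by a power of t clears the denominators. [D] is quantified after [q],
    since the extension of the substitution can only be formed once [q] is known. *)
Lemma puiseux_laurent (P : {poly L}) : P \is monic ->
  exists q, forall D : {rmorphism L -> L}, (forall a, D (emb L a) = emb L (dilq q a)) ->
  exists zs : seq L, map_poly D P = \prod_(z <- zs) ('X - z%:P).
Proof.
move=> mP; pose m := (size P).-1.
have sP : size P = m.+1 by rewrite prednK // size_poly_gt0 monic_neq0.
have /choice[ki hki] : forall i, exists k, exists a, P`_i * tauL L ^+ k = emb L a.
  by move=> i; have [k [a e]] := emb_gen P`_i; exists k, a.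
pose k := (\sum_(i < m.+1) ki i)%N.
have /choice[a ha] : forall i, exists a, (i < m)%N -> tauL L ^+ (k * (m - i)) * P`_i = emb L a.
  move=> i; have [im|_] := boolP (i < m)%N; last by exists 0.
  have [b eb] := hki i.
  have le : (ki i <= k * (m - i))%N.
    apply: leq_trans (_ : k <= _)%N; last by rewrite leq_pmulr // subn_gt0.
    by rewrite /k (bigD1 (Ordinal (ltnW im : i < m.+1)%N)) //= leq_addr.
  exists (b * ps_tau ^+ (k * (m - i) - ki i)) => _.
  by rewrite rmorphM rmorphXn /= -eb -mulrA -exprD subnKC // mulrC.
pose Q : {poly pseries K} := \poly_(i < m.+1) (if i == m then 1 else a i).
have Qc i : (i <= m)%N -> emb L Q`_i = tauL L ^+ (k * (m - i)) * P`_i.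
  move=> im; rewrite coef_poly ltnS im; case: eqP => [->|/eqP ne].
    by rewrite subnn muln0 mul1r rmorph1; have /monicP := mP; rewrite lead_coefE sP.
  by rewrite ha // ltn_neqAle ne.
have sQ : size Q = m.+1 by rewrite size_poly_eq // eqxx oner_neq0.
have mQ : Q \is monic by rewrite monicE lead_coefE sQ coef_poly ltnSn eqxx.
have [q [ss ess]] := puiseux charK0 mQ; exists q => D hD.
pose c := D (tauL L ^+ k).
have c0 : c != 0 by rewrite fmorph_eq0 expf_neq0 ?tauL_neq0.
have eQ : map_poly D (map_poly (emb L) Q) \Po (c *: 'X) = c ^+ m *: map_poly D P.
  apply/polyP => i; rewrite coef_comp_scaleX coefZ !coef_map /=.
  have [im|im] := leqP i m; last by rewrite !nth_default ?rmorph0 ?mulr0 ?sQ ?sP.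
  rewrite Qc // rmorphM mulrA !rmorphXn /= /c rmorphXn /= -!exprM -exprD.
  by congr (_ ^+ _ * _); nia.
have eD : map_poly D (map_poly (emb L) Q) = \prod_(z <- [seq emb L r | r <- ss]) ('X - z%:P).
  rewrite -map_prod_XsubC_seq -ess; apply/polyP => i; rewrite !coef_map /=.
  exact: hD.
exists [seq z / c | z <- [seq emb L r | r <- ss]].
have szs : size ss = m.
  apply: succn_inj; rewrite -sQ -(size_prod_XsubC ss id) -ess.
  by rewrite size_map_inj_poly ?rmorph0 //; apply: dil_inj.
apply: (scalerI (expf_neq0 m c0)); rewrite -eQ eD comp_prod_XsubC !big_map -szs.
elim: (ss) => [|r rs IH]; first by rewrite !big_nil scale1r.
rewrite !big_cons IH /= exprS -scalerA scalerAr scalerAl; congr (_ * _).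
by rewrite scalerBr -[_ *: _%:P]mul_polyC -polyCM mulrC divfK.
Qed.

End PuiseuxLaurent.

Lemma prod_sub_swap (R : comNzRingType) n m (a b : nat -> R) :
  \prod_(k < m) \prod_(i < n) (a k - b i) =
  ((-1) ^+ n) ^+ m * \prod_(i < n) \prod_(k < m) (b i - a k).
Proof.
rewrite [X in _ * X]exchange_big /=.
have -> : ((-1) ^+ n) ^+ m = \prod_(k < m) (-1) ^+ n :> R by rewrite prodr_const card_ord.
rewrite -big_split; apply: eq_bigr => k _ /=; rewrite -[n in _ ^+ n]card_ord -prodrN.
by apply: eq_bigr => i _; rewrite opprB.
Qed.

(** * Zeros of f_y and the norm of f_x modulo f_y *)

Section Milnor.
Variables (K : closedFieldType) (L : laurent K).
Hypothesis charK0 : [pchar K] =i pred0.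
Variables (n : nat) (w : K) (sg : {rmorphism L -> L}) (s : pseries K).
Hypothesis w_prim : n.-primitive_root w.
Hypothesis sgE : forall a, sg (emb L a) = emb L (rot w a).
Hypothesis s_dist : forall k, (0 < k < n)%N -> rot (w ^+ k) s != s.
Variable f : {poly {poly K}}.
Hypothesis f_monic : f \is monic.
Hypothesis f_size : size f = n.+1.
Hypothesis f_conj : map_poly (evx L n) f = conj_prod n sg s.
Hypothesis n_gt1 : (1 < n)%N.

Let n_gt0 : (0 < n)%N := prim_n_gt0 w_prim.
Local Notation S k := (Sk n sg s k).
Local Notation ev := (ev n sg s).
Local Notation val := (val n sg s).

Lemma S_mod k : S k = S (k %% n).
Proof.
rewrite /Sk !(iter_sg w_prim sgE); congr (_ * emb L (rot _ _)).
by rewrite (prim_expr_mod w_prim).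
Qed.

(** A contact order of two branches is [b - n] for a characteristic exponent [b]. The sum is [d]
    times the order of [App d f], which is at most 0 because values are nonnegative and is not 0
    because [d] does not divide it. *)
Lemma contact_sum0 i c e : e != 0 -> lead c (S 0 - S i) e ->
  exists oi : nat -> int, \sum_(k < n) oi k < 0 /\
  forall k, (oi k < c /\ exists e, e != 0 /\ lead (oi k) (S 0 - S k) e) \/
    (oi k = c /\ exists e, lead c (S 0 - S k) e).
Proof.
move=> e0 he; pose u := s - rot (w ^+ i) s.
have eS : S 0 - S i = xL L n * emb L u.
  by rewrite /Sk !(iter_sg w_prim sgE) rot1 rmorphB mulrBr.
have u0 : u != 0 by apply: contraNneq (lead_neq0 e0 he) => u0; rewrite eS u0 rmorph0 mulr0.
have [b [v [ev0 v0]]] := ps_neq0P u0.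
have ub : u b != 0 by rewrite ev0 coef_tauXM ltnn subnn.
have ul j : (j < b)%N -> u j = 0 by move=> jb; rewrite ev0 coef_tauXM jb.
have uE j : u j = (1 - w ^+ (i * j)) * s j by rewrite /= exprM mulrBl mul1r.
have cb : c = b%:Z - n%:Z.
  by apply: (lead_inj e0 ub he); rewrite eS; apply: lead_xL.
have sb : s b != 0 by apply: contraNneq ub => sb; rewrite uE sb mulr0.
have [d lv] := @level_exists K n w s w_prim b.
have [d0 dn lt gen] := lv.
have Ni : (n %/ d %| i)%N.
  apply: gen => j jb sj; have := ul j jb; rewrite uE => /eqP.
  rewrite mulf_eq0 (negbTE sj) orbF subr_eq0 eq_sym mulnC.
  by rewrite (prim_order_dvd w_prim).
have db : ~~ (d %| b)%N.
  apply: contra ub => db; rewrite uE mulf_eq0 subr_eq0 eq_sym.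
  by rewrite -(prim_order_dvd w_prim) -(divnK dn) dvdn_mul.
have [kp [kb hG _ [oi [soi hoi]]]] := level_theorem charK0 w_prim sgE lv sb db.
exists oi; split; last by rewrite cb.
have dI : (d %| degy f)%N by rewrite (degy_f f_size).
have aG := App_aroot charK0 d0 dI f_monic; rewrite (degy_f f_size) in aG.
have [g [g0 hg]] := hG _ (aroot_map w_prim f_conj aG).
have nz : ev (App d f) != 0 := lead_neq0 g0 hg.
have [nq [_ [_ [_ _ [h [h0 hh]]]]]] := norm_lead w_prim sgE f_monic f_size f_conj nz.
have ek := lead_inj h0 g0 hh hg.
have dk : ~~ (d %| kp)%Z.
  apply: contra db => dk; have : (d %| b%:Z)%Z; last by rewrite dvdzE.
  by rewrite -[b%:Z](subKr kp) rpredB.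
have kp0 : kp < 0.
  rewrite lt_neqAle; apply/andP; split.
    by apply: contraNneq dk => ->; rewrite dvdz0.
  by rewrite -ek oppr_le0.
by rewrite soi pmulrn_llt0.
Qed.

Lemma iter_sg_lead a z k c : c != 0 -> lead k (iter a sg z) c -> exists e, e != 0 /\ lead k z e.
Proof.
move=> c0 h; have z0 : z != 0.
  by apply: contraNneq (lead_neq0 c0 h) => ->; rewrite iter_sg0.
have [l [e [e0 he]]] := lead_ex z0; exists e; split=> //.
have h' := lead_iter_sg w_prim sgE a he.
have nz : (w ^ l) ^+ a * e != 0.
  by rewrite mulf_neq0 // expf_neq0 // expfz_neq0 // (prim_neq0 w_prim).
by rewrite (lead_inj c0 nz h h').
Qed.

(** Conjugation carries branch 0 to branch [a] and permutes the others cyclically. *)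
Lemma contact_sum a i c e : (a < n)%N -> e != 0 -> lead c (S a - S i) e ->
  exists oi : nat -> int, \sum_(k < n) oi k < 0 /\
  forall k, (oi k < c /\ exists e, e != 0 /\ lead (oi k) (S a - S k) e) \/
    (oi k = c /\ exists e, lead c (S a - S k) e).
Proof.
move=> an e0 he; have eS k : S a - S k = iter a sg (S 0 - S ((k + (n - a)) %% n)).
  have iB x y : iter a sg (x - y) = iter a sg x - iter a sg y.
    by elim: (a) => //= m ->; rewrite rmorphB.
  rewrite iB; congr (_ - _); rewrite -S_mod /Sk -iterD -!/(Sk _ _ _ _) S_mod [RHS]S_mod.
  by rewrite addnCA subnKC ?(ltnW an) // modnDr.
rewrite eS in he; have [e' [e0' he']] := iter_sg_lead e0 he.
have [oi [soi hoi]] := contact_sum0 e0' he'.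
exists (fun k => oi ((k + (n - a)) %% n)%N); split; first by rewrite (sum_mod_shift n oi).
move=> k; rewrite eS; have h := hoi ((k + (n - a)) %% n)%N.
have wn (l : int) (g : K) : g != 0 -> (w ^ l) ^+ a * g != 0.
  by move=> g0; rewrite mulf_neq0 // expf_neq0 // expfz_neq0 // (prim_neq0 w_prim).
case: h => [[lt [g [g0 hg]]]|[eq [g hg]]].
  left; split=> //; eexists; split; last exact: (lead_iter_sg w_prim sgE a hg).
  exact: wn.
by right; split=> //; eexists; exact: (lead_iter_sg w_prim sgE a hg).
Qed.

Variables (q : nat) (D : {rmorphism L -> L}).
Hypothesis DE : forall a, D (emb L a) = emb L (dilq q a).
Local Notation phi := (evx L (n * q.+1)).

Lemma D_evx (a : {poly K}) : D (evx L n a) = phi a.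
Proof.
rewrite /evx -horner_map -map_poly_comp /=.
have -> : D (xL L n) = xL L (n * q.+1).
  rewrite /xL fmorphXz /tauL DE dil_tau rmorphXn exprnP exprz_exp.
  by rewrite mulrN -PoszM mulnC.
congr (_.[_]); apply: eq_map_poly => c /=.
by rewrite /kap DE dil_psC.
Qed.

Lemma D_map_evx p : map_poly D (map_poly (evx L n) p) = map_poly phi p.
Proof. by rewrite -map_poly_comp; apply: eq_map_poly => c /=; apply: D_evx. Qed.

Lemma phi_f : map_poly phi f = \prod_(i < n) ('X - (D (S i))%:P).
Proof.
rewrite -D_map_evx f_conj /conj_prod rmorph_prod.
by apply: eq_bigr => i _; rewrite /= map_polyXsubC.
Qed.

Lemma phi_dfdy p : map_poly phi (dfdy p) = (map_poly phi p)^`().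
Proof. by rewrite deriv_map. Qed.

Lemma D_lead k z c : lead k z c -> lead (k *+ q.+1) (D z) c.
Proof. exact: lead_dil DE _ _ _. Qed.

(* At a zero of f_y the sum of the 1 / (z - S_i) vanishes, so the contact of z with
   its nearest branches is also a contact between two branches, i.e. it occurs at a level. *)
Lemma critical_value_lead z : (map_poly phi (dfdy f)).[z] = 0 ->
  exists o c, [/\ o < 0, c != 0 & lead o (map_poly phi f).[z] c].
Proof.
rewrite phi_dfdy phi_f => fz0.
have zS i : (i < n)%N -> z != D (S i).
  move=> ni; apply/eqP => zi; move: fz0; rewrite -phi_f -phi_dfdy -D_map_evx zi horner_map /=.
  rewrite (ev_conj s w_prim sgE) => /eqP; rewrite fmorph_eq0 => /eqP h.
  have := dfdy_f_neq0 charK0 w_prim sgE s_dist f_monic f_size.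
  by move/eqP; apply; apply: (@iter_sg_inj _ _ sg i); rewrite h iter_sg0.
have := deriv_prod_XsubC zS; rewrite fz0 => /esym/eqP; rewrite mulf_eq0.
rewrite (negbTE (_ : \prod_(i < n) (z - D (S i)) != 0)); last first.
  by apply/prodf_neq0 => i _; rewrite subr_eq0 zS.
move=> /= /eqP sum0.
have /choice[ce hce] : forall i, exists ce : int * K, (i < n)%N -> ce.2 != 0 /\ lead ce.1 (z - D (S i)) ce.2.
  move=> i; have [ni|_] := boolP (i < n)%N; last by exists (0, 0).
  have zi : z - D (S i) != 0 by rewrite subr_eq0 zS.
  by have [k [c h]] := lead_ex zi; exists (k, c).
pose c i := (ce i).1; pose e i := (ce i).2.
have e0 i : (i < n)%N -> e i != 0 by move=> /hce[].
have hc i : (i < n)%N -> lead (c i) (z - D (S i)) (e i) by move=> /hce[].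
(* A branch nearest to [z]: closeness is a large order of the difference. *)
pose a := [arg max_(i > Ordinal n_gt0) c i]%O.
have amax (i : 'I_n) : c i <= c a.
  by rewrite /a; case: arg_maxP => // j _ h; apply: h.
set M := c a in amax.
(* The part at order [- M] of the vanishing sum of inverses; only the nearest branches
   contribute. *)
have sumB : \sum_(i < n) (if c i == M then (e i)^-1 else 0) = 0.
  apply: (@lead_uniq _ L (- M) 0); last exact: lead_zero.
  rewrite -sum0; apply: lead_sum => i _; have hi := leadV (e0 i (ltn_ord i)) (hc i (ltn_ord i)).
  case: eqP => [<- //|/eqP ne]; apply: lead_weak hi.
  by rewrite ltrN2 lt_neqAle ne amax.
(* If all nearest branches had the same coefficient, the sum would be their number over that
   coefficient, nonzero in characteristic zero. Two different coefficients make [M] the exact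
   contact of two branches. *)
have [i0 ei0] : exists i0 : 'I_n, c i0 = M /\ e i0 != e a.
  apply: contrapT => /forallNP h; move: sumB.
  rewrite (eq_bigr (fun i : 'I_n => if c i == M then (e a)^-1 else 0)); last first.
    move=> i _; case: eqP => // ci; congr (_^-1); apply: contrapT => ne.
    by apply: (h i); split=> //; apply/eqP.
  rewrite -big_mkcond sumr_const -mulr_natl => /eqP; rewrite mulf_eq0 invr_eq0 (negbTE (e0 a (ltn_ord a))) orbF.
  apply/negP; rewrite natK_neq0 //; apply/card_gt0P; exists a.
  exact: (eqxx M).
case: ei0 => ci0 ei0.
have hD : lead M (D (S a - S i0)) (e i0 - e a).
  have -> : D (S a - S i0) = (z - D (S i0)) - (z - D (S a)) by rewrite rmorphB; ring.
  by apply: leadB; [rewrite -ci0; apply: hc | apply: hc].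
have d0 : e i0 - e a != 0 by rewrite subr_eq0.
have Si0 : S a - S i0 != 0.
  by apply: contraNneq (lead_neq0 d0 hD) => ->; rewrite rmorph0.
have [c' [g [g0 hg]]] := lead_ex Si0.
have Mc : M = c' *+ q.+1 := lead_inj d0 g0 hD (D_lead hg).
have [oi [soi hoi]] := contact_sum (ltn_ord a) g0 hg.
(* Where the contact with [S a] is below [M] after ramification, [z] has the same contact, being at
   order [M] from [S a]. Elsewhere the order is at least [M], and maximality makes it equal. *)
have cE (i : 'I_n) : c i = oi i *+ q.+1.
  have zi : z - D (S i) = (z - D (S a)) + D (S a - S i) by rewrite rmorphB; ring.
  have := hc i (ltn_ord i); case: (hoi i) => [[lt [h [h0 hh]]]|[eq [h hh]]] hi.
    have h1 : lead (oi i *+ q.+1) (z - D (S i)) h.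
      rewrite zi -[h]add0r; apply: leadD (D_lead hh).
      by apply: lead_weak (hc a (ltn_ord a)); rewrite -/M Mc ltr_pMn2r.
    exact: lead_inj (e0 i (ltn_ord i)) h0 hi h1.
  have h1 : lead M (z - D (S i)) (e a + h).
    by rewrite zi; apply: leadD (hc a (ltn_ord a)) _; rewrite -/M Mc; apply: D_lead.
  rewrite eq -Mc; apply/eqP; rewrite eq_le amax /= leNgt; apply/negP => lt.
  by have := lead_uniq hi (lead_weak lt h1); apply/eqP/e0.
exists (\sum_(i < n) c i), (\prod_(i < n) e i); split.
- rewrite (eq_bigr (fun i : 'I_n => oi i *+ q.+1)) // sumrMnl.
  by rewrite pmulrn_llt0.
- by apply/prodf_neq0 => i _; apply: e0.
rewrite horner_prod (eq_bigr (fun i : 'I_n => z - D (S i))) => [|i _]; last by rewrite hornerXsubC.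
by apply: lead_prod => i _; apply: hc.
Qed.

Variable Th : {additive L -> L}.
Hypothesis ThM : forall x y, Th (x * y) = Th x * y + x * Th y.
Hypothesis ThE : forall a, Th (emb L a) = emb L (theta a).

Lemma Th_critical z : (map_poly phi (dfdy f)).[z] = 0 ->
  Th (map_poly phi f).[z] = (map_poly phi (dfdx f)).[z] * Th (xL L (n * q.+1)).
Proof.
move=> z0; rewrite (@Th_horner _ _ Th ThM {poly K} phi) -[f^`()]/(dfdy f) z0 mul0r addr0.
rewrite [in RHS]mulrC -hornerZ; congr (_.[_]).
by apply/polyP => i; rewrite coefZ coef_map /= (Th_evx _ ThM ThE) coef_map /dfdx coef_map /= mulrC.
Qed.

Variable z : nat -> L.
Definition monic_dfdy : {poly {poly K}} := (n%:R^-1)%:P *: dfdy f.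
Hypothesis z_roots : map_poly phi monic_dfdy = \prod_(k < n.-1) ('X - (z k)%:P).

Lemma dfdyE : dfdy f = (n%:R : K)%:P *: monic_dfdy.
Proof.
by rewrite /monic_dfdy scalerA -polyCM mulfV ?natK_neq0 // scale1r.
Qed.

Lemma monic_dfdyP : monic_dfdy \is monic /\ size monic_dfdy = n.-1.+1.
Proof.
have fn : f`_n = 1 by have /monicP := f_monic; rewrite lead_coefE f_size.
have c1 : monic_dfdy`_n.-1 = 1.
  rewrite coefZ coef_deriv (prednK n_gt0) fn -polyC1 -mulr_natl -polyC_natr -!polyCM.
  by rewrite mulr1 mulVf ?natK_neq0.
have sz : size monic_dfdy = n.-1.+1.
  apply/eqP; rewrite eqn_leq; apply/andP; split.
    rewrite (leq_trans (size_scale_leq _ _)) // (prednK n_gt0) -ltnS -f_size.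
    by rewrite lt_size_deriv ?monic_neq0.
  by rewrite ltnNge; apply/negP => h; move: c1; rewrite nth_default // => /esym/eqP; rewrite oner_eq0.
by split=> //; rewrite monicE lead_coefE sz c1.
Qed.

Lemma z_critical k : (k < n.-1)%N -> (map_poly phi (dfdy f)).[z k] = 0.
Proof.
move=> kn; rewrite dfdyE -mul_polyC rmorphM /= hornerM z_roots horner_prod.
by rewrite [X in _ * X](bigD1 (Ordinal kn)) //= hornerXsubC subrr mul0r mulr0.
Qed.

(** The values of [f] at the [z k] and of [monic_dfdy] at the branches multiply to the same
    resultant up to sign. At each [z k] the order of [f_x] exceeds that of [f] by [n * q.+1], and
    comparison with the order of the polynomial [Q] in x gives its degree. *)
Lemma norm_dfdx : exists (Q : {poly K}) u v, [/\ Q%:P = u * dfdx f + v * dfdy f, Q != 0,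
  ((size Q).-1 + n.-1 = val (dfdy f))%N & phi Q = \prod_(k < n.-1) (map_poly phi (dfdx f)).[z k]].
Proof.
have [mg zg] := monic_dfdyP; have n1 : (0 < n.-1)%N by rewrite -ltnS (prednK n_gt0).
have [Q [u [v [eQ hQ]]]] := norm_in_ideal (dfdx f) n1 mg zg z_roots.
have nQ : (0 < n * q.+1)%N by rewrite muln_gt0 n_gt0.
have /choice[oc hoc] : forall k, exists oc : int * K, (k < n.-1)%N ->
    [/\ oc.1 < 0, oc.2 != 0 & lead oc.1 (map_poly phi f).[z k] oc.2].
  move=> k; have [kn|_] := boolP (k < n.-1)%N; last by exists (0, 0).
  by have [o [c h]] := critical_value_lead (z_critical kn); exists (o, c).
(* The order of [f] at [z k] is negative, so the derivation does not kill the leading term, and the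
   order is that of [f_x] times [Th x]. *)
have hx (k : 'I_n.-1) : exists c, c != 0 /\
    lead ((oc k).1 + (n * q.+1)%N%:Z) (map_poly phi (dfdx f)).[z k] c.
  have [o0 c0 h] := hoc k (ltn_ord k); have hT := lead_theta ThM ThE h.
  rewrite Th_critical ?z_critical // in hT.
  have hX := lead_Th_xL (n * q.+1) ThM ThE.
  have x0 : - (n * q.+1)%:R != 0 :> K by rewrite oppr_eq0 natK_neq0.
  have := lead_divr x0 hT hX; rewrite mulfK ?opprK; last exact: lead_neq0 x0 hX.
  move=> hh; eexists; split; last exact: hh.
  rewrite mulf_neq0 ?invr_eq0 // mulf_neq0 //.
  by case: (oc k).1 o0 => // m _; rewrite NegzE mulrNz oppr_eq0 -pmulrn natK_neq0.
have /choice[cx hcx] := hx.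
have lQ : lead (\sum_(k < n.-1) ((oc k).1 + (n * q.+1)%N%:Z)) (phi Q) (\prod_k cx k).
  by rewrite hQ; apply: lead_prod => k _; have [] := hcx k.
have cx0 : \prod_k cx k != 0 by apply/prodf_neq0 => k _; have [] := hcx k.
have Q0 : Q != 0.
  by have := lead_neq0 cx0 lQ; apply: contraNneq => ->; rewrite rmorph0.
have Ql : lead_coef Q != 0 by rewrite lead_coef_eq0.
have degQ := lead_inj cx0 Ql lQ (lead_evx L nQ Q0).
(* The resultant seen from the branches; its inner products are conjugates of [ev monic_dfdy], after
   ramification. *)
pose A := \prod_(i < n) \prod_(k < n.-1) (D (S i) - z k).
have nfy := dfdy_f_neq0 charK0 w_prim sgE s_dist f_monic f_size.
have nR : (n%:R^-1 : K) != 0 by rewrite invr_eq0 natK_neq0.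
have [ng vg] := valZ w_prim sgE f_monic f_size f_conj nR nfy.
have [c [c0 hc]] := valP w_prim sgE f_monic f_size f_conj ng; rewrite vg in hc.
have lA : lead (\sum_(i < n) (- (val (dfdy f))%:Z *+ q.+1)) A
    (\prod_(i < n) ((w ^ (- (val (dfdy f))%:Z)) ^+ i * c)).
  apply: lead_prod => i _.
  have -> : \prod_(k < n.-1) (D (S i) - z k) = D (iter i sg (ev monic_dfdy)).
    rewrite -(ev_conj s w_prim sgE) -horner_map D_map_evx z_roots horner_prod.
    by apply: eq_bigr => k _; rewrite hornerXsubC.
  by apply: D_lead; apply: (lead_iter_sg w_prim sgE).
have cA : \prod_(i < n) ((w ^ (- (val (dfdy f))%:Z)) ^+ i * c) != 0.
  apply/prodf_neq0 => i _; rewrite mulf_neq0 // expf_neq0 // expfz_neq0 //.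
  exact: (prim_neq0 w_prim).
have lB : lead (\sum_(k < n.-1) (oc k).1) (\prod_(k < n.-1) (map_poly phi f).[z k])
    (\prod_(k < n.-1) (oc k).2).
  by apply: lead_prod => k _; have [] := hoc k (ltn_ord k).
have cB : \prod_(k < n.-1) (oc k).2 != 0.
  by apply/prodf_neq0 => k _; have [] := hoc k (ltn_ord k).
have AB : \prod_(k < n.-1) (map_poly phi f).[z k] = ((-1) ^+ n) ^+ n.-1 * A.
  rewrite /A -(prod_sub_swap n n.-1 z (fun i => D (S i))); apply: eq_bigr => k _; rewrite phi_f horner_prod.
  by apply: eq_bigr => i _; rewrite hornerXsubC.
have lB' : lead (0 + \sum_(i < n) (- (val (dfdy f))%:Z *+ q.+1))
    (\prod_(k < n.-1) (map_poly phi f).[z k])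
    (((-1) ^+ n) ^+ n.-1 * \prod_(i < n) ((w ^ (- (val (dfdy f))%:Z)) ^+ i * c)).
  rewrite AB; apply: leadM lA.
  by have := leadX n.-1 (leadX n (leadN (lead_one L))); rewrite !mul0rn.
have cB' : ((-1) ^+ n) ^+ n.-1 * \prod_(i < n) ((w ^ (- (val (dfdy f))%:Z)) ^+ i * c) != 0.
  by rewrite mulf_neq0 // !expf_neq0 // oppr_eq0 oner_neq0.
have sumo := lead_inj cB cB' lB lB'.
exists Q, u, ((n%:R^-1)%:P%:P * v); split=> //.
  by rewrite eQ /monic_dfdy -mul_polyC mulrCA mulrA.
move: degQ; rewrite big_split /= sumo add0r !sumr_const !card_ord.
clear -n_gt0 n1; move: (val (dfdy f)) (size Q).-1 => v m e.
have h1 : - v%:Z *+ q.+1 *+ n = - (n * q.+1 * v)%N%:Z.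
  by rewrite -mulrnA mulNrn -mulr_natl natz -PoszM [(q.+1 * n)%N]mulnC.
have h2 : (n * q.+1)%N%:Z *+ n.-1 = (n * q.+1 * n.-1)%N%:Z.
  by rewrite -mulr_natl natz -PoszM mulnC.
rewrite h1 h2 in e; have a0 : (0 < n * q.+1)%N by rewrite muln_gt0 n_gt0.
apply/eqP; rewrite -(eqn_pmul2l a0) mulnDr; move: e {h1 h2}.
move: (n * q.+1 * v)%N (n * q.+1 * n.-1)%N (n * q.+1 * m)%N => x y t; clear; lia.
Qed.

(** If [a * f_x] is 1 modulo [f_y], the norms of [a] and [f_x] multiply to 1, so the norm [Q] is
    constant. Conversely a nonzero constant [Q] is a unit lying in the ideal. *)
Lemma milnor_val_of_roots : (exists u v, 1 = u * dfdx f + v * dfdy f) <-> (val (dfdy f)).+1 = n.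
Proof.
have [Q [u [v [eQ Q0 sQ hQ]]]] := norm_dfdx; split=> [[a [b e1]]|vn].
  have [mg zg] := monic_dfdyP; have n1 : (0 < n.-1)%N by rewrite -ltnS (prednK n_gt0).
  have [R [_ [_ [_ hR]]]] := norm_in_ideal a n1 mg zg z_roots.
  have QR : Q * R = 1.
    have nQ : (0 < n * q.+1)%N by rewrite muln_gt0 n_gt0.
    apply: (@evx_inj K L (n * q.+1) nQ); rewrite rmorphM rmorph1 /= hQ hR -big_split big1 // => k _ /=.
    have := congr1 (fun p => (map_poly phi p).[z k]) e1.
    rewrite /= rmorphD !rmorphM !rmorph1 /= hornerC hornerD !hornerM (z_critical (ltn_ord k)).
    by rewrite mulr0 addr0 mulrC.
  have : size (Q * R) = 1%N by rewrite QR size_poly1.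
  have R0 : R != 0 by apply: contraNneq (oner_neq0 {poly K}) => R0; rewrite -QR R0 mulr0.
  rewrite size_mul // -sQ; have := size_poly_gt0 Q; have := size_poly_gt0 R.
  rewrite Q0 R0; move: (size Q) (size R) n_gt0; clear; lia.
have sQ1 : size Q = 1%N.
  have := size_poly_gt0 Q; rewrite Q0; move: sQ n_gt0 vn; clear; lia.
have /size_poly1P[c c0 Qc] : size Q == 1%N by rewrite sQ1.
exists (c^-1%:P%:P * u), (c^-1%:P%:P * v).
by rewrite -!mulrA -mulrDr -eQ Qc -!polyCM mulVf.
Qed.

End Milnor.

Theorem milnor_val (K : closedFieldType) (L : laurent K) (charK0 : [pchar K] =i pred0)
    n (w : K) (sg : {rmorphism L -> L}) (s : pseries K) f :
  n.-primitive_root w -> (forall a, sg (emb L a) = emb L (rot w a)) ->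
  (forall k, (0 < k < n)%N -> rot (w ^+ k) s != s) ->
  f \is monic -> size f = n.+1 -> map_poly (evx L n) f = conj_prod n sg s -> (1 < n)%N ->
  (exists u v, 1 = u * dfdx f + v * dfdy f) <-> (val n sg s (dfdy f)).+1 = n.
Proof.
move=> w_prim sgE s_dist mf sf fc n1.
have [mg zg] := monic_dfdyP charK0 w_prim mf sf.
have mg' : map_poly (evx L n) (monic_dfdy n f) \is monic by apply: monic_map.
have [q hq] := puiseux_laurent charK0 mg'.
have [D DE] := laurent_lift L (@dil_inj K q).
have [zs ezs] := hq D DE.
have [Th [ThM ThE]] := laurent_derivation L.
have szs : size zs = n.-1.
  apply: succn_inj; rewrite -zg -(size_prod_XsubC zs id) -ezs size_map_poly.
  by rewrite size_map_inj_poly ?rmorph0 //; apply: evx_inj; apply: prim_n_gt0 w_prim.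
have hz : map_poly (evx L (n * q.+1)) (monic_dfdy n f) = \prod_(k < n.-1) ('X - (nth 0 zs k)%:P).
  by rewrite -(D_map_evx _ DE) ezs (big_nth 0) big_mkord szs.
exact: (milnor_val_of_roots charK0 w_prim sgE s_dist mf sf fc n1 DE ThM ThE hz).
Qed.

(** * Dimension of a quotient by two polynomials *)

Section QuotientDimension.
Variable K : fieldType.
Implicit Types a b p : {poly {poly K}}.

Lemma in_ideal2B a b p p' : in_ideal2 a b p -> in_ideal2 a b p' -> in_ideal2 a b (p - p').
Proof. by case=> u [v ->] [u' [v' ->]]; exists (u - u'), (v - v'); ring. Qed.

Lemma in_ideal2D a b p p' : in_ideal2 a b p -> in_ideal2 a b p' -> in_ideal2 a b (p + p').
Proof. by case=> u [v ->] [u' [v' ->]]; exists (u + u'), (v + v'); ring. Qed.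

Lemma in_ideal2M a b p c : in_ideal2 a b p -> in_ideal2 a b (c * p).
Proof. by case=> u [v ->]; exists (c * u), (c * v); ring. Qed.

Lemma in_ideal2_sum a b I (r : seq I) (P : pred I) F :
  (forall i, P i -> in_ideal2 a b (F i)) -> in_ideal2 a b (\sum_(i <- r | P i) F i).
Proof.
move=> h; elim/big_ind: _ => //; first by exists 0, 0; rewrite !mul0r addr0.
exact: in_ideal2D.
Qed.

(** Expanding each family in the other gives two matrices; uniqueness of coordinates modulo the
    ideal makes their product the identity, and the rank bounds [N] by [M]. *)
Lemma quotient_dim_le a b N M : quotient_has_dim a b N -> quotient_has_dim a b M -> (N <= M)%N.
Proof.
case=> e he [e' he'].
have /choice[A hA] : forall i, exists c : {ffun 'I_M -> K}, in_ideal2 a b (e i - \sum_j (c j)%:P *: e' j).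
  by move=> i; have [c [h _]] := he' (e i); exists c.
have /choice[B hB] : forall j, exists c : {ffun 'I_N -> K}, in_ideal2 a b (e' j - \sum_i (c i)%:P *: e i).
  by move=> j; have [c [h _]] := he (e' j); exists c.
pose MA : 'M[K]_(N, M) := \matrix_(i, j) A i j; pose MB : 'M[K]_(M, N) := \matrix_(j, i) B j i.
suff AB1 : MA *m MB = 1%:M.
  rewrite -(mxrank1 K N) -AB1; apply: leq_trans (mxrankM_maxl _ _) _.
  exact: rank_leq_col.
apply/matrixP => i k.
have [c [_ uc]] := he (e i).
have h1 : c = [ffun l => (MA *m MB) i l].
  apply: uc; have hsum : in_ideal2 a b (\sum_j (A i j)%:P *: (e' j - \sum_l (B j l)%:P *: e l)).
    by apply: in_ideal2_sum => j _; rewrite -mul_polyC; apply: in_ideal2M.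
  have := in_ideal2D (hA i) hsum; congr in_ideal2.
  under [X in _ + X = _]eq_bigr do rewrite scalerBr.
  rewrite sumrB addrA subrK; congr (_ - _).
  under eq_bigr do rewrite scaler_sumr.
  rewrite exchange_big; apply: eq_bigr => l _; rewrite ffunE mxE rmorph_sum scaler_suml.
  by apply: eq_bigr => j _; rewrite !mxE scalerA -polyCM.
have h2 : c = [ffun l => (l == i)%:R].
  apply: uc; exists 0, 0; rewrite !mul0r addr0 (bigD1 i) //= ffunE eqxx scale1r.
  rewrite big1 ?addr0 ?subrr // => l li; rewrite ffunE (negbTE li) scale0r //.
by have := congr1 (fun g : {ffun 'I_N -> K} => g k) (etrans (esym h1) h2); rewrite !ffunE => ->; rewrite mxE eq_sym.
Qed.

Lemma quotient_dimP a b N : quotient_has_dim a b N -> quotient_dim a b = Some N.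
Proof.
move=> hN; rewrite /quotient_dim; case: xgetP => [o _ [M hM <-]|h].
  by congr Some; apply/eqP; rewrite eqn_leq !(@quotient_dim_le a b).
by case: (h (Some N)); exists N.
Qed.

Lemma quotient_dim0 a b : quotient_dim a b = Some 0%N <-> in_ideal2 a b 1.
Proof.
split=> [|[u [v e1]]].
  rewrite /quotient_dim; case: xgetP => [o -> [M hM <-]|_ //] [M0].
  move: hM; rewrite M0 => -[e he]; have [c [+ _]] := he 1.
  by rewrite big_ord0 subr0.
apply: quotient_dimP; exists (fun=> 0) => p; exists [ffun=> 0]; split=> [|c _].
  by rewrite big_ord0 subr0; exists (p * u), (p * v); rewrite -!mulrA -mulrDr -e1 mulr1.
by apply/ffunP => -[].
Qed.

End QuotientDimension.

(** * Values on the curve and intersection numbers *)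

Section CurveValuation.
Variables (K : closedFieldType) (f : {poly {poly K}}).
Implicit Types p q : {poly {poly K}}.

Definition on_curve0 p := exists u, p = u * f.
Local Notation nz p := (~ on_curve0 p).

(* [v] is minus the order in t along the curve and [good d] says that d is one of the d_k. *)
Record curve_valuation (n : nat) (good : nat -> Prop) (v : {poly {poly K}} -> nat) : Prop := {
  cvM : forall p q, nz p -> nz q -> nz (p * q) /\ v (p * q) = (v p + v q)%N;
  cvC : forall c : K, c != 0 -> nz c%:P%:P /\ v c%:P%:P = 0%N;
  cv_mod : forall p q, on_curve0 (p - q) -> v p = v q;
  cv_lt : forall p q, nz p -> nz q -> (v p < v q)%N -> nz (p + q) /\ v (p + q) = v q;
  cv_sub : forall p q, nz p -> nz q -> v p = v q -> exists c : K,
    c != 0 /\ (nz (p - c%:P *: q) -> (v (p - c%:P *: q)%R < v p)%N);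
  cv_norm : forall p, nz p -> exists (q : {poly K}) u w, q%:P = u * p + w * f /\ q != 0;
  cv_x : nz 'X%:P /\ v 'X%:P = n;
  cv_y : v 'X = (size f`_0).-1;
  cv_small : forall p, (size p <= n)%N -> p != 0 -> nz p;
  cv_good_gt0 : forall d, good d -> (0 < d)%N /\ (d %| n)%N;
  cv_good_n : good n;
  cv_good : forall d, good d -> (1 < d)%N ->
    [/\ aroot d (n %/ d) f (App d f), nz (App d f), ~~ (d %| v (App d f))%N,
      good (gcdn d (v (App d f))) &
      forall p, (size p <= n %/ d)%N -> p != 0 -> nz p /\ (d %| v p)%N];
  cv_jac : forall p, nz p -> (0 < v p)%N ->
    nz (jac f p) /\ (v (jac f p) + n = v (dfdy f) + v p)%N;
  cv_milnor : in_ideal2 (dfdx f) (dfdy f) 1 <-> (v (dfdy f)).+1 = n }.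

Variables (n : nat) (good : nat -> Prop) (v : {poly {poly K}} -> nat).
Hypothesis cv : curve_valuation n good v.
Hypothesis n_gt1 : (1 < n)%N.
Hypothesis f_monic : f \is monic.
Hypothesis f_size : size f = n.+1.

Lemma oc0D p q : on_curve0 p -> on_curve0 q -> on_curve0 (p + q).
Proof. by case=> a -> [b ->]; exists (a + b); rewrite mulrDl. Qed.

Lemma oc0N p : on_curve0 p -> on_curve0 (- p).
Proof. by case=> a ->; exists (- a); rewrite mulNr. Qed.

Lemma oc0M p q : on_curve0 q -> on_curve0 (p * q).
Proof. by case=> a ->; exists (p * a); rewrite mulrA. Qed.

Lemma oc00 : on_curve0 0.
Proof. by exists 0; rewrite mul0r. Qed.

Lemma oc0f : on_curve0 f.
Proof. by exists 1; rewrite mul1r. Qed.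

Lemma oc0_cong p q : on_curve0 (p - q) -> on_curve0 q -> on_curve0 p.
Proof. by move=> h hq; rewrite -(subrK q p); apply: oc0D. Qed.

Lemma nz_cong p q : on_curve0 (p - q) -> nz p -> nz q.
Proof. by move=> h np hq; apply: np; apply: oc0_cong hq. Qed.

Lemma nz1 : nz 1 /\ v 1 = 0%N.
Proof. exact: (cvC cv (oner_neq0 K)). Qed.

Lemma nzX p k : nz p -> nz (p ^+ k) /\ v (p ^+ k) = (k * v p)%N.
Proof.
move=> np; elim: k => [|k [IH1 IH2]]; first exact: nz1.
by rewrite exprS; have [h ->] := cvM cv np IH1; rewrite IH2 mulSn.
Qed.

Lemma nzZ (c : K) p : c != 0 -> nz p -> nz (c%:P *: p) /\ v (c%:P *: p) = v p.
Proof.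
move=> c0 np; have [hc vc] := cvC cv c0; rewrite -mul_polyC.
by have [h ->] := cvM cv hc np; rewrite vc.
Qed.

Lemma oc0_cancel p q : nz p -> on_curve0 (p * q) -> on_curve0 q.
Proof. by move=> np h; apply: contrapT => nq; have [] := cvM cv np nq. Qed.

Lemma cv0_const p : nz p -> v p = 0%N -> exists c : K, c != 0 /\ on_curve0 (p - c%:P%:P).
Proof.
move=> np vp; have [n1 v1] := nz1; have [c [c0 h]] := cv_sub cv np n1 (etrans vp (esym v1)).
exists c; split=> //; apply: contrapT; rewrite -alg_polyC => /h.
by rewrite vp.
Qed.

(** Terms of pairwise distinct values cannot cancel; the one of largest value decides. *)
Lemma sum_val m (F : nat -> {poly {poly K}}) :
  (forall i, (i < m)%N -> F i = 0 \/ nz (F i)) ->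
  (forall i j, (i < m)%N -> (j < m)%N -> nz (F i) -> nz (F j) -> v (F i) = v (F j) -> i = j) ->
  (forall i, (i < m)%N -> F i = 0) \/
  exists k, [/\ (k < m)%N, nz (F k), nz (\sum_(i < m) F i) & v (\sum_(i < m) F i) = v (F k)].
Proof.
elim: m => [|m IH] h0 hinj; first by left.
have h0' i : (i < m)%N -> F i = 0 \/ nz (F i) by move=> im; apply: h0; apply: ltnW.
have hinj' i j : (i < m)%N -> (j < m)%N -> nz (F i) -> nz (F j) -> v (F i) = v (F j) -> i = j.
  by move=> im jm; apply: hinj; apply: ltnW.
rewrite big_ord_recr /=; case: (IH h0' hinj') => [all0|[k [km nk ns vs]]].
  rewrite big1 => [|i _]; last exact: all0.
  rewrite add0r; case: (h0 m (ltnSn m)) => [Fm|nm]; last by right; exists m.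
  by left=> i; rewrite ltnS leq_eqVlt => /orP[/eqP->|/all0].
right; case: (h0 m (ltnSn m)) => [->|nm]; first by exists k; rewrite addr0; split=> //; apply: ltnW.
case: (ltngtP (v (\sum_(i < m) F i)) (v (F m))) => lt.
- by exists m; have [? ?] := cv_lt cv ns nm lt.
- by rewrite addrC; exists k; have [? ->] := cv_lt cv nm ns lt; rewrite -vs; split=> //; apply: ltnW.
have := hinj k m (ltnW km) (ltnSn m) nk nm (etrans (esym vs) lt).
by move=> e; rewrite e ltnn in km.
Qed.

Definition values : set nat := [set t | exists p, nz p /\ v p = t]%classic.

Lemma values_add i j : values i -> values j -> values (i + j)%N.
Proof. by case=> p [np <-] [q [nq <-]]; have [h e] := cvM cv np nq; exists (p * q). Qed.

Lemma values_mul k i : values i -> values (k * i)%N.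
Proof. by case=> p [np <-]; have [h e] := nzX k np; exists (p ^+ k). Qed.

(** Induction along the [d_k]: classes of [d] and of the value [r] of [App d f] yield the class of
    their gcd, strictly smaller than [d], until 1 is reached. So values meet every residue class. *)
Lemma values_one_mod N : (0 < N)%N -> exists t, values t /\ t = 1 %[mod N].
Proof.
move=> N0; suff main d : good d -> (exists t, values t /\ t = d %[mod N]) ->
    exists t, values t /\ t = 1 %[mod N].
  by apply: (main n); [exact: cv_good_n cv | exists n; split=> //; have [? ?] := cv_x cv; exists 'X%:P].
elim/ltn_ind: d => d IH gd [t [vt td]].
have [d0 _] := cv_good_gt0 cv gd.
case: (ltngtP d 1) => [|d1|d1]; first by rewrite ltnNge d0.
  have [_ nG dG gG _] := cv_good cv gd d1; set r := v _ in dG gG.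
  apply: (IH (gcdn d r)) => //.
    rewrite ltn_neqAle dvdn_leq ?dvdn_gcdl // andbT.
    by apply: contra dG => /eqP <-; apply: dvdn_gcdr.
  have [km kn e _] := egcdnP r d0.
  have vr : values r by exists (App d f).
  (* The factor [N.-1] stands for -1 modulo [N], turning the Bezout difference into a sum of
     values. *)
  exists (km * t + kn * (N.-1) * r)%N; split.
    by apply: values_add; [apply: values_mul | rewrite -mulnA mulnCA; apply: values_mul; apply: values_mul].
  rewrite -modnDm -modnMmr td modnMmr e modnDm.
  have -> : (kn * r + gcdn d r + kn * N.-1 * r = kn * r * N + gcdn d r)%N.
    by rewrite -[N in RHS](prednK N0) mulnS [(kn * N.-1 * r)%N]mulnAC addnAC.
  by rewrite modnMDl.
by exists t; rewrite td d1.
Qed.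

Lemma values_mod N i : (0 < N)%N -> exists t, values t /\ t = i %[mod N].
Proof.
move=> N0; have [t [vt t1]] := values_one_mod N0; exists (i * t)%N; split.
  exact: values_mul.
by rewrite -modnMmr t1 modnMmr muln1.
Qed.

(* The elements of least value in each residue class modulo v p (an Apery set) form a basis. *)
Lemma intersection_dim p : nz p -> quotient_has_dim f p (v p).
Proof.
(* For value 0, [p] is a nonzero constant modulo [f] and the quotient is zero; otherwise residues
   modulo [N] make sense. *)
move=> np; set N := v p; have [N0|N0] := posnP N.
  have [c [c0 [u eu]]] := cv0_const np N0; rewrite N0.
  have e1 : 1 = - (c^-1%:P%:P * u) * f + c^-1%:P%:P * p.
    rewrite mulNr -mulrA -eu mulrBr opprB subrK.
    by rewrite -!polyCM mulVf.
  exists (fun=> 0) => q; exists [ffun=> 0]; split=> [|c' _]; last by apply/ffunP => -[].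
  rewrite big_ord0 subr0; exists (q * - (c^-1%:P%:P * u)), (q * c^-1%:P%:P).
  by rewrite -!mulrA -mulrDr -e1 mulr1.
have /choice[q hq] : forall i, exists q, [/\ nz q, v q = i %[mod N] &
    forall q', nz q' -> v q' = i %[mod N] -> (v q <= v q')%N].
  move=> i; have ex : exists t, `[< values t /\ t = i %[mod N] >].
    by have [t h] := values_mod i N0; exists t; apply/asboolP.
  have [t /asboolP[[q [nq vq]] ti] mint] := ex_minnP ex.
  exists q; rewrite vq; split=> // q' nq' vq'.
  by apply: mint; apply/asboolP; split=> //; exists q'.
have span P : exists c : 'I_N -> K, in_ideal2 f p (P - \sum_(i < N) (c i)%:P *: q i).
  have triv Q : on_curve0 Q -> exists c : 'I_N -> K, in_ideal2 f p (Q - \sum_(i < N) (c i)%:P *: q i).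
    case=> u ->; exists (fun=> 0); exists u, 0.
    by rewrite big1 ?subr0 ?mul0r ?addr0 // => i _; rewrite polyC0 scale0r.
  have [/triv//|nP] := pselect (on_curve0 P).
  move eqm : (v P) => m; elim/ltn_ind: m P nP eqm => m IH P nP vP.
  pose i := Ordinal (ltn_pmod (v P) N0).
  have [nqi vqi minq] := hq i.
  have vi : v P = i %[mod N] by rewrite /= modn_mod.
  have le : (v (q i) <= v P)%N by apply: minq.
  have /dvdnP[j ej] : (N %| v P - v (q i))%N.
    by rewrite -eqn_mod_dvd // vqi vi.
  have [npj vpj] := nzX j np; have [nqp vqp] := cvM cv nqi npj.
  have vE : v P = v (q i * p ^+ j) by rewrite vqp vpj -/N -ej subnKC.
  have [c [c0 hc]] := cv_sub cv nP nqp vE; set P' := P - _ in hc.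
  have [c' hc'] : exists c : 'I_N -> K, in_ideal2 f p (P' - \sum_(i < N) (c i)%:P *: q i).
    have [/triv//|nP'] := pselect (on_curve0 P').
    by apply: (IH (v P')) => //; rewrite -vP; apply: hc.
  (* The subtracted term is [c * q_i * p^j]: for [j = 0] it changes the coordinate on [q i], for
     [j > 0] it lies in the ideal. *)
  case: j {ej vpj vE} npj nqp vqp @P' hc hc' => [|j] npj nqp vqp P' hc hc'.
    exists (fun l => c' l + (if l == i then c else 0)).
    move: hc'; congr in_ideal2; rewrite /P' expr0 mulr1 -addrA -opprD; congr (_ - _).
    under [RHS]eq_bigr do rewrite polyCD scalerDl.
    rewrite big_split /= addrC; congr (_ + _); rewrite (bigD1 i) //= eqxx big1 ?addr0 // => l li.
    by rewrite (negbTE li) polyC0 scale0r.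
  exists c'; have [u [w e]] := hc'; exists u, (w + c%:P *: (q i * p ^+ j)).
  have -> : P = P' + c%:P *: (q i * p ^+ j.+1) by rewrite /P' subrK.
  rewrite addrAC e mulrDl addrA; congr (_ + _).
  by rewrite exprSr -scalerAl mulrA.
exists (fun i => q i) => P; have [c hc] := span P.
exists [ffun i => c i]; split.
  by under eq_bigr do rewrite ffunE.
move=> c' hc'; apply/ffunP => i; rewrite ffunE; apply/eqP; rewrite -subr_eq0; apply/eqP.
have [u [w e]] := in_ideal2B hc' hc.
pose g k := if insub k is Some l then c l - c' l else 0 : K.
have gE (l : 'I_N) : g l = c l - c' l by rewrite /g valK.
have e' : \sum_(k < N) (g k)%:P *: q k = u * f + w * p.
  rewrite -e opprB addrC subrKA -sumrB; apply: eq_bigr => k _.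
  by rewrite gE polyCB scalerBl.
have := @sum_val N (fun k => (g k)%:P *: q k).
case=> [k kN|k l kN lN|all0|[k [kN nk ns vs]]].
- have [nq _ _] := hq k; have [->|g0] := eqVneq (g k) 0; first by left; rewrite polyC0 scale0r.
  by right; have [] := nzZ g0 nq.
- have gnz t : nz ((g t)%:P *: q t) -> g t != 0.
    by move=> nt; apply: contra_notN nt => /eqP ->; rewrite polyC0 scale0r; apply: oc00.
  move=> /gnz gk /gnz gl; have [nqk vk _] := hq k; have [nql vl _] := hq l.
  have [_ ->] := nzZ gk nqk; have [_ ->] := nzZ gl nql => vkl.
  by move: vk; rewrite vkl vl !modn_small.
- have gi : g i = 0.
    apply/eqP; apply: contrapT => /negP gi; have [nq _ _] := hq i.
    by have [] := nzZ gi nq; rewrite all0 // => h _; apply: h; apply: oc00.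
  by rewrite -gE.
have gk : g k != 0.
  by apply: contra_notN nk => /eqP ->; rewrite polyC0 scale0r; apply: oc00.
have [nqk vk mink] := hq k; have [_ vgk] := nzZ gk nqk.
(* The sum has the value of some [q k]. Being congruent to [w * p], this value is [v w + N], so [w]
   lies in the same class with a smaller value, against the choice of [q k]. *)
have wpz : on_curve0 (\sum_(i < N) (g i)%:P *: q i - w * p) by rewrite e' addrK; exists u.
have nwp := nz_cong wpz ns.
have nw : nz w by move=> h; apply: nwp; rewrite mulrC; apply: oc0M.
have [_ vwp] := cvM cv nw np.
have vw : (v w + N = v (q k))%N by rewrite -vgk -vs (cv_mod cv wpz) vwp.
have := mink w nw; rewrite -vw modnDr in vk.
by move=> /(_ vk); rewrite -vw -{2}[v w]addn0 leq_add2l leqNgt N0.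
Qed.

Lemma intersectionE p : nz p -> intersection f p = Some (v p).
Proof. by move=> np; apply: quotient_dimP; apply: intersection_dim. Qed.

Lemma GammaE t : Gamma f t <-> values t.
Proof.
split=> [[p [np e]]|[p [np <-]]]; last by exists p; split=> //; apply: intersectionE.
by exists p; split=> //; move: e; rewrite intersectionE // => -[].
Qed.

End CurveValuation.

Lemma modn_mul_gcd d r i l : (0 < d)%N -> (i < d %/ gcdn d r)%N -> (l < d %/ gcdn d r)%N ->
  (i * r = l * r %[mod d])%N -> i = l.
Proof.
move=> d0; wlog le : i l / (l <= i)%N => [H|] im lm e.
  by case: (leqP l i) => h; [apply: H | apply/esym; apply: H => //; apply: ltnW].
have g0 : (0 < gcdn d r)%N by rewrite gcdn_gt0 d0.
have h1 : (d %| (i - l) * r)%N.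
  by rewrite mulnBl -eqn_mod_dvd ?leq_mul2r ?le ?orbT //; apply/eqP.
have : (d %| (i - l) * gcdn d r)%N by rewrite muln_gcdr dvdn_gcd h1 dvdn_mull.
rewrite -{1}(divnK (dvdn_gcdl d r)) dvdn_pmul2r // => h2.
have : (i - l == 0)%N.
  by apply: contraTT h2 => il; rewrite gtnNdvd ?lt0n // (leq_ltn_trans (leq_subr _ _) im).
by rewrite subn_eq0 => il; apply/eqP; rewrite eqn_leq il le.
Qed.

(** * The characteristic sequences, the values and the conductor *)

Section CharacteristicSequences.
Variables (K : closedFieldType) (f : {poly {poly K}}).
Hypothesis charK0 : [pchar K] =i pred0.
Variables (n : nat) (good : nat -> Prop) (v : {poly {poly K}} -> nat).
Hypothesis cv : curve_valuation f n good v.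
Hypothesis n_gt1 : (1 < n)%N.
Hypothesis f_monic : f \is monic.
Hypothesis f_size : size f = n.+1.
Hypothesis f_tsch : f`_n.-1 = 0.
Implicit Types p b : {poly {poly K}}.
Local Notation nz p := (~ on_curve0 f p).

(** As [f] has no term of degree [n - 1] in y, the convention [g_1 = y] agrees with the approximate
    root for [d_1 = n], so that [k = 1] fits the general case. *)
Lemma App_degy : App n f = 'X.
Proof.
have n0 : (0 < n)%N by apply: ltnW.
have [aG _ _ _ _] := cv_good cv (cv_good_n cv) n_gt1.
rewrite divnn n0 in aG; apply: aroot_uniq aG _; first exact: natP_neq0.
split; rewrite ?monicX ?size_polyX // muln1; apply/leq_sizeP => j nj.
rewrite coefB coefXn; have fn : f`_n = 1 by have /monicP := f_monic; rewrite lead_coefE f_size.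
have [->|j1] := eqVneq j n.-1; first by rewrite f_tsch ltn_eqF ?subr0 // prednK.
have [->|j2] := eqVneq j n; first by rewrite fn subrr.
by rewrite nth_default ?subr0 // f_size; lia.
Qed.

Lemma char_d1 : char_d f 1 = n.
Proof. by rewrite /= /degy f_size. Qed.

Lemma char_dS k : char_d f k.+2 = gcdn (char_d f k.+1) (char_r f k.+1).
Proof. by []. Qed.

Lemma char_rE k : good (char_d f k.+1) -> (1 < char_d f k.+1)%N ->
  char_r f k.+1 = v (App (char_d f k.+1) f).
Proof.
move=> g d1; case: k g d1 => [|k] g d1.
  by rewrite char_d1 App_degy (cv_y cv).
have [_ nG _ _ _] := cv_good cv g d1.
by rewrite /char_r /char_r_from /char_g_from (intersectionE cv nG).
Qed.

Lemma char_good k : (forall j, (j < k)%N -> char_d f j.+1 <> 1%N) -> good (char_d f k.+1).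
Proof.
elim: k => [|k IH] h; first by rewrite char_d1; apply: cv_good_n cv.
have g : good (char_d f k.+1) by apply: IH => j jk; apply: h; apply: ltnW.
have [d0 _] := cv_good_gt0 cv g.
have d1 : (1 < char_d f k.+1)%N.
  by rewrite ltn_neqAle d0 andbT eq_sym; apply/eqP; apply: h.
by rewrite char_dS char_rE //; have [] := cv_good cv g d1.
Qed.

Lemma char_gt1 k : (forall j, (j <= k)%N -> char_d f j.+1 <> 1%N) -> (1 < char_d f k.+1)%N.
Proof.
move=> h; have g : good (char_d f k.+1) by apply: char_good => j jk; apply: h; apply: ltnW.
have [d0 _] := cv_good_gt0 cv g.
by rewrite ltn_neqAle d0 andbT eq_sym; apply/eqP; apply: h.
Qed.

Lemma char_lt k : (forall j, (j <= k)%N -> char_d f j.+1 <> 1%N) ->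
  (char_d f k.+2 < char_d f k.+1)%N.
Proof.
move=> h; have d1 := char_gt1 h.
have g : good (char_d f k.+1) by apply: char_good => j jk; apply: h; apply: ltnW.
have [_ _ dG _ _] := cv_good cv g d1.
rewrite char_dS char_rE // ltn_neqAle dvdn_leq ?dvdn_gcdl ?(ltnW d1) // andbT.
by apply: contra dG => /eqP {1}<-; apply: dvdn_gcdr.
Qed.

Lemma char_hP : char_d f (char_h f).+1 = 1%N /\
  forall k, (k < char_h f)%N -> char_d f k.+1 <> 1%N.
Proof.
have ex : exists k, char_d f k.+1 == 1%N.
  apply: contrapT => /forallNP h; have h' k : char_d f k.+1 <> 1%N by move=> e; apply: (h k); apply/eqP.
  have le k : (char_d f k.+1 + k <= n)%N.
    elim: k => [|k IH]; first by rewrite char_d1 addn0.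
    by have := @char_lt k (fun j _ => h' j); lia.
  have := le n; have := @char_gt1 n (fun j _ => h' j); lia.
have [h /eqP hh minh] := ex_minnP ex.
apply: (@xgetPex _ 0%N [set h | char_d f h.+1 = 1%N /\
                    forall k, (k < h)%N -> char_d f k.+1 <> 1%N]%classic).
by exists h; split=> // k kh e; have := minh k; rewrite e eqxx leqNgt kh => /(_ isT).
Qed.

Lemma char_h_gt0 : (0 < char_h f)%N.
Proof.
rewrite lt0n; apply/eqP => h0; have [] := char_hP; rewrite h0 char_d1 => n1.
by move: n_gt1; rewrite n1.
Qed.

Lemma char_range k : (k < char_h f)%N -> [/\ good (char_d f k.+1), (1 < char_d f k.+1)%N,
  char_r f k.+1 = v (App (char_d f k.+1) f) & (char_d f k.+2 < char_d f k.+1)%N].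
Proof.
move=> kh; have [_ h] := char_hP.
have h' j : (j <= k)%N -> char_d f j.+1 <> 1%N by move=> jk; apply: h; apply: leq_ltn_trans kh.
have g : good (char_d f k.+1) by apply: char_good => j jk; apply: h'; apply: ltnW.
have d1 := char_gt1 h'.
by split=> //; [apply: char_rE | apply: char_lt].
Qed.

(** Modulo [d] the terms of the expansion have values [i * r] with [i < d / gcd(d, r)]. These are
    distinct, so a single term gives the value of [p]. *)
Lemma App_expansion d p : good d -> (1 < d)%N -> p != 0 ->
  (size p <= n %/ gcdn d (v (App d f)))%N ->
  exists j b, [/\ (j < d %/ gcdn d (v (App d f)))%N, b != 0, (size b <= n %/ d)%N,
    (d %| v b)%N & v p = (v b + j * v (App d f))%N].
Proof.
move=> g d1 p0; have [[mG sG _] nG dG _ low] := cv_good cv g d1.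
set r := v (App d f) in dG *; set d' := gcdn d r; set e := (n %/ d)%N in low sG *.
have [d0 dn] := cv_good_gt0 cv g.
have d'0 : (0 < d')%N by rewrite gcdn_gt0 d0.
have me : (n %/ d' = d %/ d' * e)%N.
  by rewrite -(divnK dn) -/e -{1}(divnK (dvdn_gcdl d r)) -/d' mulnA mulnK // mulnC.
rewrite me => sp.
have [b [sb _ eb]] := @adic_expansion _ idfun (App d f) e (d %/ d') p mG sG sp
  (map_poly_id (fun _ _ => erefl)) (map_poly_id (fun _ _ => erefl)).
pose F i := b i * App d f ^+ i.
have vF i : b i != 0 -> nz (F i) /\ v (F i) = (v (b i) + i * r)%N.
  move=> bi; have [nb _] := low _ (sb i) bi; have [nX vX] := nzX cv i nG.
  by have [h ->] := cvM cv nb nX; rewrite vX.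
have nb0 i : nz (F i) -> b i != 0.
  by move=> nF; apply: contra_notN nF => /eqP bi; rewrite /F bi mul0r; apply: oc00.
case: (@sum_val _ _ _ _ _ cv (d %/ d') F).
- move=> i _; have [bi|bi] := eqVneq (b i) 0; first by left; rewrite /F bi mul0r.
  by right; have [] := vF i bi.
- move=> i l im lm /nb0 bi /nb0 bl; have [_ ->] := vF i bi; have [_ ->] := vF l bl => e'.
  apply: (@modn_mul_gcd d r) => //.
  have [_ di] := low _ (sb i) bi; have [_ dl] := low _ (sb l) bl.
  have := congr1 (fun t => t %% d)%N e'.
  by rewrite -(modnDml (v (b i))) -(modnDml (v (b l))) (eqP di) (eqP dl) !add0n.
- by move=> all0; move: p0; rewrite eb big1 ?eqxx // => i _; apply: (all0 i).
case=> k [km nk _ vk]; have bk := nb0 k nk; have [_ vFk] := vF k bk.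
exists k, (b k); split=> //; first by have [] := low _ (sb k) bk.
by rewrite {1}eb vk vFk.
Qed.

Lemma values1_all : values f v 1%N -> forall t, values f v t.
Proof. by move=> h t; have := values_mul cv t h; rewrite muln1. Qed.

(** [r_h = d_(h+1) = 1] is itself a value. *)
Lemma char_values1 :
  (forall i, (1 <= i <= char_h f)%N -> char_r f i = char_d f i.+1) -> values f v 1%N.
Proof.
have [hd _] := char_hP; have := char_range; have := char_h_gt0.
case: (char_h f) hd => // h hd _ range eqr.
have [g d1 rE _] := range h (ltnSn h).
have [_ nG _ _ _] := cv_good cv g d1.
by exists (App (char_d f h.+1) f); split=> //; rewrite -rE eqr ?leqnn ?hd.
Qed.

Lemma char_d_dvd i j : (i <= j)%N -> (char_d f j.+1 %| char_d f i.+1)%N.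
Proof.
move=> ij; rewrite -(subnKC ij); elim: (j - i)%N => [|k IH]; first by rewrite addn0.
by rewrite addnS char_dS; apply: dvdn_trans (dvdn_gcdl _ _) IH.
Qed.

(** An element of the required value is reduced modulo [f], then replaced step by step by the
    dominating digit of its expansion, which lowers the degree bound from [n / d_(k+1)] to
    [n / d_k]. *)
Lemma value_low_degree i : (forall t, values f v t) -> (i < char_h f)%N ->
  exists p, [/\ p != 0, (size p <= n %/ char_d f i.+2)%N & v p = char_d f i.+2].
Proof.
move=> all_v ih; set t := char_d f i.+2.
suff main m k : (k + m = char_h f)%N -> (i < k)%N ->
    exists p, [/\ p != 0, (size p <= n %/ char_d f k.+1)%N & v p = t].
  by apply: (main (char_h f - i.+1)%N i.+1); rewrite ?subnKC.
elim: m k => [|m IH] k km ik.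
  have [hd _] := char_hP; rewrite addn0 in km; rewrite km hd divn1.
  have [p0 [np vp]] := all_v t.
  have [q [r [e sr]]] := monic_division p0 f_monic.
  have pr : on_curve0 f (p0 - r) by exists q; rewrite e addrK.
  exists r; split; last by rewrite -(cv_mod cv pr).
    by apply: contra_notN np => /eqP r0; rewrite -[p0]subr0 -r0.
  by rewrite -ltnS -f_size.
have kh : (k < char_h f)%N by lia.
have [p [p0 sp vp]] : exists p, [/\ p != 0, (size p <= n %/ char_d f k.+2)%N & v p = t].
  by apply: IH; lia.
have [g d1 rE dlt] := char_range kh.
have sp' : (size p <= n %/ gcdn (char_d f k.+1) (v (App (char_d f k.+1) f)))%N.
  by rewrite -rE -char_dS.
have [j [b [jm b0 sb db vpb]]] := App_expansion g d1 p0 sp'.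
exists b; split=> //; rewrite -vp vpb.
(* Both [t] and the value of the digit are multiples of [d_k], so [d_k] divides [j * r_k]; the bound
   on [j] leaves only 0, and the digit has the value of [p]. *)
suff -> : j = 0%N by rewrite addn0.
have dt : (char_d f k.+1 %| t)%N by apply: char_d_dvd.
have dj : (char_d f k.+1 %| j * v (App (char_d f k.+1) f))%N.
  by rewrite -(dvdn_addr _ db) -vpb vp.
have d0 := ltnW d1; apply: (modn_mul_gcd d0 jm); last by rewrite mul0n mod0n; apply/eqP.
by rewrite divn_gt0 ?gcdn_gt0 ?d0 // dvdn_leq // dvdn_gcdl.
Qed.

(** Take an element of value [d_(i+1)] and small degree. A dominating exponent 0 of [g_i] would make
    [d_i] divide the smaller number [d_(i+1)]; so the exponent is positive and [r_i <= d_(i+1)],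
    which divides [r_i]. *)
Lemma char_eq_of_values : (forall t, values f v t) ->
  forall i, (1 <= i <= char_h f)%N -> char_r f i = char_d f i.+1.
Proof.
move=> all_v [|i] //= ih; have [p [p0 sp vp]] := value_low_degree all_v ih.
have [g d1 rE dlt] := char_range ih; have [_ _ dG _ _] := cv_good cv g d1.
have sp' : (size p <= n %/ gcdn (char_d f i.+1) (v (App (char_d f i.+1) f)))%N.
  by rewrite -rE -char_dS.
have [j [b [jm b0 sb db vpb]]] := App_expansion g d1 p0 sp'.
have t0 : (0 < char_d f i.+2)%N by rewrite char_dS gcdn_gt0 (ltnW d1).
have j0 : (0 < j)%N.
  rewrite lt0n; apply/eqP => j0; move: vpb; rewrite vp j0 addn0 => e.
  by move: db; rewrite -e gtnNdvd.
rewrite -/(char_d f i.+2); rewrite -rE in dG vpb.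
have r0 : (0 < char_r f i.+1)%N by case: (char_r f i.+1) dG => //; rewrite dvdn0.
apply/eqP; rewrite eqn_leq; apply/andP; split.
  by rewrite -vp vpb (leq_trans (leq_pmull _ j0)) // leq_addl.
by rewrite dvdn_leq // char_dS dvdn_gcdr.
Qed.

(** For [i = 1] the condition says that [r_1] equals its gcd with [n]. *)
Lemma char_eq_dvd :
  (forall i, (1 <= i <= char_h f)%N -> char_r f i = char_d f i.+1) ->
  ((size (f`_0)%R).-1 %| n)%N.
Proof.
move=> h; have := h 1%N; rewrite char_h_gt0 => /(_ isT).
by rewrite char_dS char_d1 /char_r /= => e; rewrite {1}e dvdn_gcdl.
Qed.

Lemma conductor0 : is_conductor (Gamma f) 0 <-> forall t, values f v t.
Proof.
split=> [[h _] t|h]; first by apply/(GammaE cv); apply: h.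
by split=> // t _; apply/(GammaE cv).
Qed.

Lemma char_eq_conductor :
  (forall i, (1 <= i <= char_h f)%N -> char_r f i = char_d f i.+1) <->
  is_conductor (Gamma f) 0.
Proof.
split=> [h|/conductor0 h]; last exact: char_eq_of_values.
by apply/conductor0/values1_all/char_values1.
Qed.

Lemma milnor0 : milnor f = Some 0%N <-> (v (dfdy f)).+1 = n.
Proof. by rewrite /milnor quotient_dim0; apply: cv_milnor cv. Qed.

Lemma values_of_dfdy : (v (dfdy f)).+1 = n -> forall t, values f v t.
Proof.
move=> vf; have desc p m : nz p -> (m <= v p)%N -> values f v (v p - m)%N.
  elim: m p => [|m IH] p np mv; first by rewrite subn0; exists p.
  have vp : (0 < v p)%N by apply: leq_trans mv.
  have [nJ vJ] := cv_jac cv np vp.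
  have vJ' : v (jac f p) = (v p).-1 by lia.
  have -> : (v p - m.+1 = v (jac f p) - m)%N by rewrite vJ'; lia.
  by apply: IH => //; rewrite vJ'; lia.
(* [x^t] has value [n * t], at least [t], and is lowered to [t] one unit at a time. *)
move=> t; have [nx vx] := cv_x cv; have [nX vX] := nzX cv t nx.
have le : (t <= v ('X%:P ^+ t))%N by rewrite vX vx leq_pmulr // ltnW.
by have := desc _ (v ('X%:P ^+ t) - t)%N nX (leq_subr _ _); rewrite subKn.
Qed.

End CharacteristicSequences.

(** * Substitution into one-variable polynomials and the chain rule *)

Section Substitution.
Variable K : closedFieldType.
Implicit Types (p z : {poly {poly K}}) (X Y P : {poly K}).

Definition subst z P : {poly {poly K}} := (map_poly (@polyC {poly K} \o @polyC K) P).[z].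

Lemma subst_is_zmod_morphism z : zmod_morphism (subst z).
Proof. by move=> P Q; rewrite /subst rmorphB hornerD hornerN. Qed.
Lemma subst_is_monoid_morphism z : monoid_morphism (subst z).
Proof. by split=> [|P Q]; rewrite /subst ?rmorph1 ?hornerC // rmorphM hornerM. Qed.
HB.instance Definition _ z :=
  GRing.isZmodMorphism.Build {poly K} {poly {poly K}} (subst z) (subst_is_zmod_morphism z).
HB.instance Definition _ z :=
  GRing.isMonoidMorphism.Build {poly K} {poly {poly K}} (subst z) (subst_is_monoid_morphism z).

Lemma substC z c : subst z c%:P = c%:P%:P.
Proof. by rewrite /subst map_polyC hornerC. Qed.

Lemma substX z : subst z 'X = z.
Proof. by rewrite /subst map_polyX hornerX. Qed.

(** The arguments are reordered so that evaluation at a fixed point can carry a ring morphism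
    structure. *)
Definition ev2 X Y p := eval2 p X Y.

Lemma ev2_is_zmod_morphism X Y : zmod_morphism (ev2 X Y).
Proof. by move=> p q; rewrite /ev2 /eval2 rmorphB hornerD hornerN. Qed.
Lemma ev2_is_monoid_morphism X Y : monoid_morphism (ev2 X Y).
Proof. by split=> [|p q]; rewrite /ev2 /eval2 ?rmorph1 ?hornerC // rmorphM hornerM. Qed.
HB.instance Definition _ X Y :=
  GRing.isZmodMorphism.Build {poly {poly K}} {poly K} (ev2 X Y) (ev2_is_zmod_morphism X Y).
HB.instance Definition _ X Y :=
  GRing.isMonoidMorphism.Build {poly {poly K}} {poly K} (ev2 X Y) (ev2_is_monoid_morphism X Y).

Lemma ev2E X Y p : ev2 X Y p = eval2 p X Y. Proof. by []. Qed.

Lemma ev2_polyC X Y q : ev2 X Y q%:P = q \Po X.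
Proof. by rewrite /ev2 /eval2 map_polyC hornerC. Qed.

Lemma ev2_CC X Y (c : K) : ev2 X Y c%:P%:P = c%:P.
Proof. by rewrite ev2_polyC comp_polyC. Qed.

Lemma ev2B X Y p q : ev2 X Y (p - q) = ev2 X Y p - ev2 X Y q.
Proof. exact: ev2_is_zmod_morphism. Qed.

Lemma ev2M X Y p q : ev2 X Y (p * q) = ev2 X Y p * ev2 X Y q.
Proof. exact: (ev2_is_monoid_morphism X Y).2. Qed.

Lemma ev2_y X Y : ev2 X Y 'X = Y.
Proof. by rewrite /ev2 /eval2 map_polyX hornerX. Qed.

Lemma ev2_subst X Y z P : ev2 X Y (subst z P) = P \Po ev2 X Y z.
Proof.
elim/poly_ind: P => [|P c IH]; first by rewrite comp_poly0 !rmorph0.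
by rewrite !(rmorphD, rmorphM) /= substX substC ev2_polyC !comp_polyC comp_polyX IH.
Qed.

Lemma dfdxD p q : dfdx (p + q) = dfdx p + dfdx q.
Proof. exact: raddfD. Qed.

Lemma dfdxN p : dfdx (- p) = - dfdx p.
Proof. exact: raddfN. Qed.

Lemma dfdxC (c : {poly K}) : dfdx c%:P = c^`()%:P.
Proof. by rewrite /dfdx map_polyC. Qed.

Lemma dfdxM p q : dfdx (p * q) = dfdx p * q + p * dfdx q.
Proof.
apply/polyP => i; rewrite coef_map coefD !coefM raddf_sum -big_split.
by apply: eq_bigr => j _; rewrite /= derivM !coef_map.
Qed.

Lemma dfdx_y : dfdx ('X : {poly {poly K}}) = 0.
Proof.
apply/polyP => i; rewrite coef_map coefX coef0 /=.
by case: (i == 1%N); rewrite ?derivC ?deriv0 // -polyC1 derivC.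
Qed.

Lemma subst_derivation (dl : {poly {poly K}} -> {poly {poly K}}) z P :
  (forall p q, dl (p + q) = dl p + dl q) ->
  (forall p q, dl (p * q) = dl p * q + p * dl q) ->
  (forall c : K, dl c%:P%:P = 0) ->
  dl (subst z P) = subst z P^`() * dl z.
Proof.
move=> dD dM dC; elim/poly_ind: P => [|P c IH].
  by rewrite deriv0 rmorph0 mul0r -(polyC0 {poly K}) -(polyC0 K) dC.
rewrite derivD derivM derivX derivC mulr1 addr0 !(rmorphD, rmorphM) /= substX substC.
by rewrite dD dM dC IH addr0; ring.
Qed.

End Substitution.

(* Keeps unification from evaluating polynomials. *)
Opaque ev2 subst.

(** * Polynomial parametrizations and elements of value one *)

Section Parametrization.
Variables (K : closedFieldType) (f : {poly {poly K}}).
Hypothesis charK0 : [pchar K] =i pred0.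
Variables (n : nat) (good : nat -> Prop) (v : {poly {poly K}} -> nat).
Hypothesis cv : curve_valuation f n good v.
Hypothesis n_gt1 : (1 < n)%N.
Hypothesis f_monic : f \is monic.
Hypothesis f_size : size f = n.+1.
Implicit Types (p z : {poly {poly K}}) (X Y P : {poly K}).
Local Notation oc0 p := (on_curve0 f p).
Local Notation nz p := (~ on_curve0 f p).

(** The powers of [z] realise every value, so a multiple of [z ^+ m] lowers any element of value
    [m]. *)
Lemma span_subst z p : nz z -> v z = 1%N -> exists P, oc0 (p - subst z P).
Proof.
move=> nzz vz; have [h|np] := pselect (oc0 p); first by exists 0; rewrite rmorph0 subr0.
move eqm : (v p) => m; elim/ltn_ind: m p np eqm => m IH p np vp.
have [nX vX] := nzX cv m nzz; rewrite vz muln1 in vX.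
have [c [c0 hc]] := cv_sub cv np nX (etrans vp (esym vX)).
set p' := p - _ in hc.
have [P' hP'] : exists P, oc0 (p' - subst z P).
  have [h|np'] := pselect (oc0 p'); first by exists 0; rewrite rmorph0 subr0.
  by apply: (IH (v p')) => //; rewrite -vp; apply: hc.
exists (P' + c%:P * 'X^m).
have -> : p - subst z (P' + c%:P * 'X^m) = p' - subst z P'; last by [].
rewrite rmorphD rmorphM rmorphXn /= substX substC /p' -mul_polyC; ring.
Qed.

Lemma val_subst z P : nz z -> (0 < v z)%N -> P != 0 ->
  nz (subst z P) /\ v (subst z P) = ((size P).-1 * v z)%N.
Proof.
move=> nzz vz; elim/poly_ind: P => [|P c IH]; first by rewrite eqxx.
rewrite rmorphD rmorphM /= substX substC size_MXaddC.
have [->|P0] := eqVneq P 0.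
  rewrite mul0r !add0r rmorph0 mul0r add0r; have [->|c0] := eqVneq c 0; first by rewrite eqxx.
  by rewrite size_poly0 => _; have [? ?] := cvC cv c0.
move=> _; have [n1 v1] := IH P0; have [n2 v2] := cvM cv n1 nzz.
have sP : (size P).-1.+1 = size P by rewrite prednK // size_poly_gt0.
have v2' : v (subst z P * z) = (size P * v z)%N by rewrite v2 v1 addnC -mulSn sP.
have [->|c0] := eqVneq c 0; first by rewrite addr0 /= v2'.
have [n3 v3] := cvC cv c0.
have lt : (v c%:P%:P < v (subst z P * z))%N by rewrite v3 v2' muln_gt0 vz size_poly_gt0 P0.
by rewrite /= addrC; have [? ->] := cv_lt cv n3 n2 lt.
Qed.

Lemma oc0_subst_eq0 z P : nz z -> (0 < v z)%N -> oc0 (subst z P) -> P = 0.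
Proof.
by move=> nzz vz h; apply/eqP/negPn/negP => /(val_subst nzz vz)[].
Qed.

Lemma oc0_rmorph (phi : {rmorphism {poly {poly K}} -> {poly {poly K}}}) :
  (forall c : K, phi c%:P%:P = c%:P%:P) -> oc0 (phi 'X%:P - 'X%:P) -> oc0 (phi 'X - 'X) ->
  forall p, oc0 (phi p - p).
Proof.
move=> hC hx hy; have mulc a b : oc0 (phi a - a) -> oc0 (phi b - b) -> oc0 (phi (a * b) - a * b).
  move=> ha hb; have -> : phi (a * b) - a * b = phi b * (phi a - a) + a * (phi b - b).
    by rewrite rmorphM; ring.
  by apply: oc0D; apply: oc0M.
have addc a b : oc0 (phi a - a) -> oc0 (phi b - b) -> oc0 (phi (a + b) - (a + b)).
  by move=> ha hb; rewrite rmorphD opprD addrACA; apply: oc0D.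
elim/poly_ind => [|p c IH]; first by rewrite rmorph0 subr0; apply: oc00.
apply: (addc); first exact: (mulc).
elim/poly_ind: c => [|c e IHc]; first by rewrite rmorph0 subr0; apply: oc00.
rewrite polyCD polyCM; apply: (addc); first exact: (mulc).
by rewrite hC subrr; apply: oc00.
Qed.

Lemma oc0_subst_ev2 z X Y p : oc0 ('X%:P - subst z X) -> oc0 ('X - subst z Y) ->
  oc0 (subst z (ev2 X Y p) - p).
Proof.
move=> hX hY; apply: (@oc0_rmorph (subst z \o ev2 X Y)) => [c||] /=.
- by rewrite ev2_polyC comp_polyC substC.
- by rewrite ev2_polyC comp_polyX -opprB; apply: oc0N.
by rewrite ev2_y -opprB; apply: oc0N.
Qed.

(** On the curve [x = X(z)] and [y = Y(z)]. Both claims are checked after substituting [z], which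
    loses nothing: no nonzero polynomial in an element of positive value vanishes on the curve. *)
Lemma param_of_values : values f v 1%N ->
  exists X Y : {poly K}, eval2 f X Y = 0 /\ generate_Kt X Y.
Proof.
case=> z [nzz vz]; have vz0 : (0 < v z)%N by rewrite vz.
have [X hX] := span_subst 'X%:P nzz vz; have [Y hY] := span_subst 'X nzz vz.
have hsub p := oc0_subst_ev2 p hX hY.
exists X, Y; split.
  by rewrite -ev2E; apply: (oc0_subst_eq0 nzz vz0); apply: oc0_cong (hsub f) (oc0f f).
have zt : ev2 X Y z = 'X.
  apply/eqP; rewrite -subr_eq0; apply/eqP/(oc0_subst_eq0 nzz vz0).
  have -> : subst z (ev2 X Y z - 'X) = subst z (ev2 X Y z) - z.
    have e := subst_is_zmod_morphism z (ev2 X Y z) 'X.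
    exact: etrans e (congr1 (fun t => subst z (ev2 X Y z) - t) (substX z)).
  exact: hsub.
by move=> q; exists (subst z q); rewrite -ev2E ev2_subst zt comp_polyXr.
Qed.

(** If [p] were not a multiple of [f], a nonzero polynomial in x would kill [X], so [X] would be
    constant; then [Y] would be constant as well since [f] is monic in y, and they could not
    generate K[t]. *)
Lemma ev2_kernel X Y : eval2 f X Y = 0 -> generate_Kt X Y ->
  forall p, ev2 X Y p = 0 -> oc0 p.
Proof.
move=> fXY gen p pXY; apply: contrapT => np.
have [q [u [w [e q0]]]] := cv_norm cv np.
have qX : q \Po X = 0.
  by rewrite -(ev2_polyC X Y) e rmorphD !rmorphM /= pXY (ev2E X Y f) fXY !mulr0 addr0.
have sX : (size X <= 1)%N.
  rewrite leqNgt; apply/negP => sX; have := lead_coef_comp q sX.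
  rewrite qX lead_coef0 => /esym/eqP; rewrite mulf_eq0 lead_coef_eq0 (negbTE q0) /=.
  rewrite expf_eq0 lead_coef_eq0 => /andP[_ /eqP X0]; by rewrite X0 size_poly0 in sX.
have [c Xc] : exists c, X = c%:P by exists X`_0; apply: size1_polyC.
have ev2c g : ev2 X Y g = map_poly (horner_eval c) g \Po Y.
  transitivity (map_poly polyC (map_poly (horner_eval c) g)).[Y]; last by [].
  rewrite ev2E /eval2 Xc; congr (_.[_]); apply/polyP => i.
  by rewrite !coef_map /= comp_polyCr.
have sY : (size Y <= 1)%N.
  rewrite leqNgt; apply/negP => sY.
  have mf : map_poly (horner_eval c) f \is monic by apply: monic_map.
  have := lead_coef_comp (map_poly (horner_eval c) f) sY; rewrite -ev2c (ev2E X Y f) fXY.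
  rewrite lead_coef0 (monicP mf) mul1r => /esym/eqP; rewrite expf_eq0 lead_coef_eq0.
  by move=> /andP[_ /eqP Y0]; rewrite Y0 size_poly0 in sY.
have [g eg] := gen 'X; have [e' Yc] : exists c, Y = c%:P by exists Y`_0; apply: size1_polyC.
have := congr1 (fun p : {poly K} => size p) eg.
rewrite -ev2E ev2c Yc comp_polyCr size_polyX size_polyC.
by case: (_ != 0).
Qed.

(** The [z] that maps to t generates K[x, y] modulo [f], so all values are multiples of [v z]. Some
    value is 1 modulo [v z], hence [v z = 1]. *)
Lemma values_of_param X Y : eval2 f X Y = 0 -> generate_Kt X Y -> values f v 1%N.
Proof.
move=> fXY gen; have ker := ev2_kernel fXY gen.
have [z ez] := gen 'X; have {}ez : ev2 X Y z = 'X by rewrite ev2E.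
have XC c : 'X != c%:P :> {poly K}.
  apply/eqP => /(congr1 (fun p : {poly K} => size p)).
  by rewrite size_polyX size_polyC; case: (_ != 0).
have fz : ev2 X Y f = 0 by rewrite ev2E.
have nzz : nz z.
  case=> u eu; have := XC 0; rewrite -ez eu ev2M fz mulr0 polyC0 eqxx //.
have vz : (0 < v z)%N.
  rewrite lt0n; apply/eqP => /(cv0_const cv nzz)[c [_ [u eu]]].
  have := congr1 (ev2 X Y) eu; rewrite ev2B ev2M ez fz mulr0 ev2_CC.
  by move/eqP; rewrite subr_eq0 (negbTE (XC c)).
have all_dvd t : values f v t -> (v z %| t)%N.
  case=> p [np <-]; have hp : oc0 (p - subst z (ev2 X Y p)).
    by apply: ker; rewrite ev2B ev2_subst ez comp_polyXr subrr.
  have P0 : ev2 X Y p != 0 by apply: contra_notN np => /eqP; apply: ker.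
  by rewrite (cv_mod cv hp); have [_ ->] := val_subst nzz vz P0; rewrite dvdn_mull.
have [t [vt t1]] := values_one_mod cv vz.
have := all_dvd t vt; rewrite /dvdn t1 => h.
have : (v z %| 1)%N by [].
by rewrite dvdn1 => /eqP vz1; exists z.
Qed.

Lemma nz_dfdy : nz (dfdy f).
Proof.
apply: (cv_small cv); first by rewrite -ltnS -f_size lt_size_deriv ?monic_neq0.
apply/eqP => /(congr1 (fun p : {poly {poly K}} => p`_n.-1)).
rewrite coef_deriv coef0 (prednK (ltnW n_gt1)).
have -> : f`_n = 1 by have /monicP := f_monic; rewrite lead_coefE f_size.
by move/eqP; rewrite (negbTE (natP_neq0 charK0 (ltnW n_gt1))).
Qed.

(* If x = X(z) and y = Y(z) on the curve, differentiating these two congruences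
   shows that jac z divides 1 modulo f, hence has value 0. *)
Lemma dfdy_of_values : values f v 1%N -> (v (dfdy f)).+1 = n.
Proof.
case=> z [nzz vz]; have vz0 : (0 < v z)%N by rewrite vz.
have [X [u hu]] := span_subst 'X%:P nzz vz; have [Y [w hw]] := span_subst 'X nzz vz.
have dyC (c : K) : dfdy c%:P%:P = 0 by rewrite /dfdy derivC.
have dxC (c : K) : dfdx c%:P%:P = 0 by rewrite dfdxC derivC.
have dx P := subst_derivation z P (@dfdxD K) (@dfdxM K) dxC.
have dy P : dfdy (subst z P) = subst z P^`() * dfdy z.
  exact: (@subst_derivation K (@dfdy K) z P (@derivD _) (@derivM _) dyC).
have dyx : dfdy ('X%:P : {poly {poly K}}) = 0 by rewrite /dfdy derivC.
have dyy : dfdy ('X : {poly {poly K}}) = 1 by rewrite /dfdy derivX.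
have dfdyB p q : dfdy (p - q) = dfdy p - dfdy q by rewrite /dfdy derivB.
have dfdxB p q : dfdx (p - q) = dfdx p - dfdx q by rewrite dfdxD dfdxN.
have dfdyM p q : dfdy (p * q) = dfdy p * q + p * dfdy q by rewrite /dfdy derivM.
have e1 := congr1 (@dfdx K) hu; rewrite dfdxB dfdxM dx dfdxC derivX in e1.
have e2 := congr1 (@dfdy K) hu; rewrite dfdyB dfdyM dy dyx in e2.
have e3 := congr1 (@dfdx K) hw; rewrite dfdxB dfdxM dx dfdx_y in e3.
have e4 := congr1 (@dfdy K) hw; rewrite dfdyB dfdyM dy dyy in e4.
have [nJ vJ] := cv_jac cv nzz vz0.
set a := subst z X^`() in e1 e2; set b := subst z Y^`() in e3 e4.
set zx := dfdx z in e1 e3; set zy := dfdy z in e2 e4.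
set fx := dfdx f in e1 e3; set fy := dfdy f in e2 e4 vJ *.
have hE : jac f z = fy * zx - fx * zy by [].
(* [e1] and [e2] replace [a * zx] by [1 - u * fx] and [a * zy] by [- u * fy] modulo [f]; the mixed
   terms cancel. *)
have hA : oc0 (a * jac f z - fy).
  exists (- (fy * dfdx u) + fx * dfdy u); rewrite hE.
  have -> : a * (fy * zx - fx * zy) - fy = - fy * (1%:P - a * zx) + fx * (0 - a * zy).
    by rewrite polyC1; ring.
  by rewrite e1 e2; ring.
have na : nz a.
  move=> ha; apply: nz_dfdy; rewrite -/fy; apply: (@oc0_cong _ _ _ (a * jac f z)).
    by rewrite -opprB; apply: oc0N.
  by rewrite mulrC; apply: oc0M.
(* By [e2] and [hA] this holds after multiplication by [a], which can be cancelled on the curve. *)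
have hB : oc0 (zy + u * jac f z).
  apply: (oc0_cancel cv na); have [k ek] := hA.
  exists (u * k - dfdy u).
  have -> : a * (zy + u * jac f z) = - (0 - a * zy) + u * (a * jac f z - fy) + u * fy by ring.
  by rewrite e2 ek; ring.
(* In [e4], [zy] and [fy] are both multiples of [jac f z] modulo [f], so 1 is one too. *)
have hC : oc0 (1 - jac f z * (w * a - u * b)).
  have [k ek] := hA; have [l el] := hB.
  exists (dfdy w + b * l - w * k).
  have -> : 1 - jac f z * (w * a - u * b) =
    (1 - b * zy) + b * (zy + u * jac f z) - w * (a * jac f z - fy) - w * fy by ring.
  by rewrite e4 ek el; ring.
have [n1 v1] := nz1 cv.
have nprod := nz_cong hC n1; have vprod := cv_mod cv hC.
have nwa : nz (w * a - u * b) by move=> h; apply: nprod; apply: oc0M.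
have [_ vv] := cvM cv nJ nwa.
by move: vJ; rewrite vz; move: vprod; rewrite v1 vv; lia.
Qed.

End Parametrization.

(** * From the place at infinity to the valuation *)

Section PlaceAtInfinity.
Variable K : closedFieldType.
Hypothesis charK0 : [pchar K] =i pred0.

Definition ps_of_poly (p : {poly K}) : pseries K := PSeries (fun i => p`_i).

Lemma ps_of_poly_is_zmod_morphism : zmod_morphism ps_of_poly.
Proof. by move=> p q; apply: psP => i; rewrite /= coefB. Qed.
Lemma ps_of_poly_is_monoid_morphism : monoid_morphism ps_of_poly.
Proof.
by split=> [|p q]; apply: psP => i; rewrite ?ps_coefM /= ?coef1 ?coefM.
Qed.
HB.instance Definition _ := GRing.isZmodMorphism.Build {poly K} (pseries K)
  ps_of_poly ps_of_poly_is_zmod_morphism.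
HB.instance Definition _ := GRing.isMonoidMorphism.Build {poly K} (pseries K)
  ps_of_poly ps_of_poly_is_monoid_morphism.

Lemma ps_of_polyC c : ps_of_poly c%:P = psC c.
Proof. by apply: psP => -[|i]; rewrite /= coefC. Qed.

Lemma ps_of_polyX : ps_of_poly 'X = ps_tau.
Proof. by apply: psP => i; rewrite /= coefX. Qed.

Variables (n : nat) (f : {poly {poly K}}).
Hypothesis n_gt0 : (0 < n)%N.
Hypothesis f_monic : f \is monic.
Hypothesis f_size : size f = n.+1.
Hypothesis f_deg : forall j, (j < n)%N -> (size (f`_j)%R <= n - j)%N.

Let A := at_infinity f.

Lemma coef_at_infinity j : (j < n)%N ->
  A`_j = \sum_(i < n | (i + j < n)%N) (f`_j)`_i *: 'X^(n - i - j).
Proof.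
move=> jn; rewrite /A /at_infinity (degy_f f_size) coefD coefXn ltn_eqF // add0r.
rewrite [LHS]coef_sum [LHS](bigD1 (Ordinal jn)) //= [X in _ + X]big1 ?addr0 => [|l lj].
  rewrite [LHS]coef_sum; apply: eq_bigr => i _.
  by rewrite coefZ coefXn eqxx mulr1.
rewrite [LHS]coef_sum big1 // => i _; rewrite coefZ coefXn; case: eqP => [e|_]; last by rewrite mulr0.
by case/eqP: lj; apply/val_inj.
Qed.

Lemma at_infinity_monic : A \is monic /\ size A = n.+1.
Proof.
have An : A`_n = 1.
  rewrite /A /at_infinity (degy_f f_size) coefD coefXn eqxx coef_sum big1 ?addr0 // => l _.
  by rewrite coef_sum big1 // => i _; rewrite coefZ coefXn gtn_eqF ?mulr0 // ltn_ord.
have sA : size A = n.+1.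
  apply/eqP; rewrite eqn_leq; apply/andP; split; last first.
    by rewrite ltnNge; apply/negP => h; move: An; rewrite nth_default // => /esym/eqP; rewrite oner_eq0.
  apply/leq_sizeP => j nj; rewrite /A /at_infinity (degy_f f_size) coefD coefXn gtn_eqF // add0r.
  rewrite coef_sum big1 // => l _; rewrite coef_sum big1 // => i _.
  rewrite coefZ coefXn gtn_eqF ?mulr0 //.
  exact: ltn_trans (ltn_ord l) nj.
by split=> //; rewrite monicE lead_coefE sA An.
Qed.

(** With [u = 1 / x], [at_infinity f] is [f (x, x * y)] divided by [x^n]; so the roots of [f] are
    [x] times the conjugate series, with [x = t^-n]. *)
Lemma parametrization_at_infinity (L : laurent K) : one_place_at_infinity f ->
  exists (w : K) (sg : {rmorphism L -> L}) (s : pseries K),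
    [/\ n.-primitive_root w, forall a, sg (emb L a) = emb L (rot w a),
        forall k, (0 < k < n)%N -> rot (w ^+ k) s != s &
        map_poly (evx L n) f = conj_prod n sg s].
Proof.
move=> irr; have [mA sA] := at_infinity_monic.
pose P : {poly pseries K} := map_poly ps_of_poly A.
have mP : P \is monic by apply: monic_map.
have sP : size P = n.+1.
  by rewrite size_map_poly_id0 ?sA // (monicP mA) rmorph1 oner_neq0.
(* Each lower term has [i + j < n], hence a positive power of [u]. *)
have P0 : slice 0 P = 'X^n.
  apply/polyP => j; rewrite coef_slice coef_map /= coefXn.
  case: (ltngtP j n) => [jn|nj|->]; last first.
  - by have /monicP := mA; rewrite lead_coefE sA => ->; rewrite coef1.
  - by rewrite [A`_j]nth_default ?coef0 // sA.
  rewrite coef_at_infinity // coef_sum big1 // => i ij; rewrite coefZ coefXn.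
  by rewrite ltn_eqF ?mulr0 // -subnDA subn_gt0.
have irrP : series2_irreducible (series2_of P).
  move: irr; rewrite /one_place_at_infinity; congr series2_irreducible.
  by apply: funext => i; apply: funext => j; rewrite /series2_of coef_map.
have [w [s [pw eP dist]]] := irreducible_parametrization charK0 n_gt0 mP sP P0 irrP.
have w0 := prim_neq0 pw.
have rinj : injective (@rot K w).
  by move=> a b /(congr1 (rot w^-1)); rewrite !rot_comp mulVf // !rot1.
have [sg sgE] := laurent_lift L rinj.
exists w, sg, s; split=> //; pose x := xL L n.
have x0 : x != 0 by rewrite expfz_neq0 // tauL_neq0.
pose psi := fun p : {poly K} => emb L (dilq n.-1 (ps_of_poly p)).
have psiZX c k : psi (c *: 'X^k) = kap L c * x ^- k.
  rewrite /psi -mul_polyC !rmorphM !rmorphXn /= ps_of_polyC ps_of_polyX dil_psC dil_tau.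
  rewrite (prednK n_gt0) rmorphXn -/(tauL L) -/(kap L c); congr (_ * _).
  by rewrite /x /xL -exprnN exprVn invrK.
have psiA j : (j <= n)%N -> x ^+ j * evx L n f`_j = x ^+ n * psi A`_j.
  rewrite leq_eqVlt => /orP[/eqP ->|jn].
    have /monicP := f_monic; have /monicP := mA.
    by rewrite !lead_coefE sA f_size /= => -> ->; rewrite /psi !rmorph1.
  rewrite coef_at_infinity // /psi !raddf_sum mulr_sumr.
  have -> : evx L n f`_j = \sum_(i < n | (i + j < n)%N) kap L (f`_j)`_i * x ^+ i.
    rewrite /evx (@horner_coef_wide _ n); last first.
      apply: leq_trans (size_poly _ _) _; apply: leq_trans (f_deg jn) (leq_subr _ _).
    rewrite [RHS]big_mkcond; apply: eq_bigr => i _; rewrite coef_map.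
    case: ltnP => // nij; rewrite nth_default ?raddf0 ?mul0r //.
    by apply: leq_trans (f_deg jn) _; rewrite leq_subLR addnC.
  rewrite mulr_sumr; apply: eq_bigr => i ij.
  have e : emb L _ = _ := psiZX (f`_j)`_i (n - i - j)%N.
  rewrite [X in _ = _ * X]e.
  rewrite [LHS]mulrCA [RHS]mulrCA; congr (_ * _).
  apply: (canRL (mulfK (expf_neq0 _ x0))).
  by rewrite -!exprD; congr (_ ^+ _); lia.
apply: (comp_scaleX_inj x0) => /=; transitivity (x ^+ n *: map_poly (emb L) (map_poly (dilq n.-1) P)).
  apply/polyP => j; rewrite coef_comp_scaleX coefZ !coef_map /=.
  have [jn|nj] := leqP j n; first exact: psiA.
  by rewrite !nth_default ?f_size ?sA // !raddf0 !mulr0.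
rewrite eP /conj_prod rmorph_prod -[n in x ^+ n]card_ord -prodr_const.
rewrite [X in _ = X \Po _](_ : _ = \prod_(r <- [seq Sk n sg s k | k <- iota 0 n]) ('X - r%:P)); last first.
  by rewrite big_map -[n in iota 0 n]subn0 big_mkord.
rewrite comp_prod_XsubC big_map -[n in iota 0 n]subn0 big_mkord -scaler_prod.
apply: eq_bigr => k _; rewrite /= map_polyXsubC scalerBr /Sk (iter_sg pw sgE).
by rewrite -[x *: _%:P]mul_polyC -polyCM.
Qed.

(** Here the series, the root of unity and K((t)) are forgotten; only values and the admissible [d]
    remain. *)
Lemma curve_valuation_exists : (1 < n)%N -> one_place_at_infinity f ->
  exists good v, curve_valuation f n good v.
Proof.
move=> n1 irr; have [L _] := laurent_exists K.
have [w [sg [s [pw sgE dist fc]]]] := parametrization_at_infinity L irr.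
have [Th [ThM ThE]] := laurent_derivation L.
have ocE p : on_curve0 f p <-> ev n sg s p = 0.
  by split=> [/(ev0P pw sgE dist f_monic f_size fc)|/(ev0P pw sgE dist f_monic f_size fc)].
have nzP p : ~ on_curve0 f p <-> ev n sg s p != 0.
  by rewrite ocE; split=> [h|/eqP//]; apply/eqP.
exists (good n s), (val n sg s); split.
- move=> p q /nzP np /nzP nq; split; first by apply/nzP; apply: evM_neq0.
  exact: (valM pw sgE f_monic f_size fc).
- move=> c c0; split; first by apply/nzP; apply: evCC_neq0.
  exact: (valCC pw sgE f_monic f_size fc).
- by move=> p q /ocE; rewrite ev_is_zmod_morphism => /subr0_eq e; rewrite /val e.
- move=> p q /nzP np /nzP nq lt; have [h ->] := valD_lt pw sgE f_monic f_size fc np nq lt.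
  by split=> //; apply/nzP.
- move=> p q /nzP np /nzP nq e; have [c [c0 h]] := val_sub pw sgE f_monic f_size fc np nq e.
  by exists c; split=> // /nzP; apply: h.
- move=> p /nzP np; have [q [u [u' [e q0 _]]]] := val_norm pw sgE f_monic f_size fc np.
  by exists q, u, u'.
- by have [h vx] := val_x pw sgE f_monic f_size fc; split=> //; apply/nzP.
- by have [] := val_y pw sgE dist f_monic f_size fc n1.
- by move=> p sp p0; apply/nzP; apply: (ev_small pw sgE dist).
- by move=> d [b [? ? _ _]].
- exact: good_n pw.
- move=> d g d1; have [aG nG dG gG low] := good_App charK0 pw sgE dist f_monic f_size fc g d1.
  split=> //; first exact/nzP.
  by move=> p sp p0; have [/nzP h dv] := low p sp p0.
- move=> p /nzP np vp; have [h e] := val_jac charK0 pw sgE dist f_monic f_size fc ThM ThE np vp.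
  by split=> //; apply/nzP.
exact: (milnor_val charK0 pw sgE dist f_monic f_size fc n1).
Qed.

End PlaceAtInfinity.

Theorem corollary7 (K : closedFieldType) (charK0 : [pchar K] =i pred0)
    (n : nat) (n_ge2 : (2 <= n)%N)
    (a : nat -> {poly K})
    (deg_a : forall i, (2 <= i <= n)%N -> (size (a i) <= i)%N)
    (f : {poly {poly K}})
    (fE : f = 'X^n + \sum_(2 <= i < n.+1) a i *: 'X^(n - i))
    (f_one_place : one_place_at_infinity f)
    (m : nat) (mE : m = (size (a n)).-1) :
  let cond_i := milnor f = Some 0%N in
  let cond_ii :=
    forall i, (1 <= i <= char_h f)%N -> char_r f i = char_d f i.+1 in
  let cond_iii := is_conductor (Gamma f) 0 in
  let cond_iv :=
    exists x y : {poly K}, eval2 f x y = 0 /\ generate_Kt x y in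
  [<-> cond_i; cond_ii; cond_iii; cond_iv] /\
  [/\ cond_i -> (m %| n)%N, cond_ii -> (m %| n)%N,
      cond_iii -> (m %| n)%N & cond_iv -> (m %| n)%N].
Proof.
move=> cond_i cond_ii cond_iii cond_iv.
(* [a i] sits in degree [n - i], so degree [j] carries [a (n - j)], and starting at 2 leaves degree
   [n - 1] empty. *)
have coef_f j : f`_j = (j == n)%:R + (if (j.+2 <= n)%N then a (n - j)%N else 0).
  rewrite fE coefD coefXn; congr (_ + _); rewrite coef_sum.
  under eq_bigr do rewrite coefZ coefXn.
  case: ifP => jn.
    rewrite (@big_cat_nat _ _ _ (n - j)) /=; [|lia|lia].
    rewrite [X in _ + X]big_ltn; last by lia.
    have -> : (j == n - (n - j))%N by lia.
    rewrite mulr1 big_nat big1 ?add0r; last first.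
      by move=> i ij; rewrite (_ : (j == n - i)%N = false) ?mulr0 //; lia.
    rewrite big_nat big1 ?addr0 // => i ij.
    by rewrite (_ : (j == n - i)%N = false) ?mulr0 //; lia.
  rewrite big_nat big1 // => i ij.
  by rewrite (_ : (j == n - i)%N = false) ?mulr0 //; lia.
have n_gt0 : (0 < n)%N by apply: ltnW.
have fn : f`_n = 1 by rewrite coef_f eqxx ifF ?addr0 //; lia.
have f_size : size f = n.+1.
  apply/eqP; rewrite eqn_leq; apply/andP; split.
    apply/leq_sizeP => j nj; rewrite coef_f gtn_eqF // ifF ?addr0 //; lia.
  by rewrite ltnNge; apply/negP => h; move: fn; rewrite nth_default // => /esym/eqP; rewrite oner_eq0.
have f_monic : f \is monic by rewrite monicE lead_coefE f_size fn.
have f_deg j : (j < n)%N -> (size (f`_j)%R <= n - j)%N.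
  move=> jn; rewrite coef_f ltn_eqF // add0r; case: ifP => jn2; last by rewrite size_poly0.
  by apply: deg_a; lia.
have f_tsch : f`_n.-1 = 0 by rewrite coef_f ltn_eqF ?ifF ?addr0 ?prednK //; lia.
have f0 : f`_0 = a n by rewrite coef_f ltn_eqF // add0r n_ge2 subn0.
have [good [v cv]] := curve_valuation_exists charK0 n_gt0 f_monic f_size f_deg n_ge2 f_one_place.
(* Condition (iii) is the hub: it is equivalent to (ii), and (i), (iii), (iv) form a cycle. The
   divisibility is read off (ii). *)
have ii_iii : cond_ii <-> cond_iii.
  exact: (char_eq_conductor charK0 cv n_ge2 f_monic f_size f_tsch).
have i_iii : cond_i -> cond_iii.
  move=> /(milnor0 cv) vf; apply/(conductor0 cv) => t.
  exact: (values_of_dfdy cv n_ge2 f_monic f_size vf).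
have iii_iv : cond_iii -> cond_iv.
  by move=> /(conductor0 cv) h; apply: (param_of_values cv).
have iv_i : cond_iv -> cond_i.
  case=> x [y [fxy gen]]; apply/(milnor0 cv).
  apply: (dfdy_of_values charK0 cv n_ge2 f_monic f_size).
  exact: (values_of_param cv f_monic fxy gen).
have ii_dvd : cond_ii -> (m %| n)%N.
  by move=> h; rewrite mE -f0; apply: (char_eq_dvd charK0 cv n_ge2 f_monic f_size f_tsch).
split.
  tfae=> // [/i_iii|]; by case: ii_iii; auto.
by split=> // h; apply/ii_dvd/ii_iii; auto.
Qed.
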